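(* Let $N\ge 1$ and let $\alpha,\beta,\lambda:\mathbb{R}^N\to\mathbb{R}$ be continuous functions. Assume $m>0$, $\theta>1$, $s\ge 0$, $\gamma\ge 1$, $\alpha(x)\ge 0$, $\beta(x)\ge 0$ and $\lambda(x)\ge\lambda_0$ for all $x\in\mathbb{R}^N$, where $\lambda_0>0$ is a constant. Let $p=\max\{m,\theta,2s+\gamma\}$ and let $(u,v)$, with real-valued $u,v\in L^p_{loc}(\mathbb{R}^N)$, be a distributional solution of the system $$ \begin{cases} -\Delta u+\alpha |u|^{m-1}u=-\lambda|u|^{\theta-1}u+\beta|u|^s|v|^{s+\gamma-1}v & \text{in }\mathbb{R}^N,\\ -\Delta v+\alpha |v|^{m-1}v=-\lambda|v|^{\theta-1}v+\beta|v|^s|u|^{s+\gamma-1}u & \text{in }\mathbb{R}^N. \end{cases} $$ Assume further that $\theta=2s+\gamma$. Then: (i) If $\inf_{\mathbb{R}^N}(\lambda-\beta)>0$, then $u=v=0$. (ii) If $\lambda\ge\beta$ on $\mathbb{R}^N$, $\alpha\ge\alpha_0$ on $\mathbb{R}^N$ for some constant $\alpha_0>0$, and $m>1$, then $u=v=0$. (iii) If $m=\theta$ and $\inf_{\mathbb{R}^N}(\alpha+\lambda-\beta)>0$, then $u=v=0$. (iv) If $\lambda=\beta$ and $\alpha=0$ on $\mathbb{R}^N$, then $u=v$ and $u$ is a harmonic function. In particular, if either $u$ or $v$ is bounded on one side (i.e. bounded from above or bounded from below), then $u=v=\text{const}$.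
   Context: A distributional solution is a pair $(u,v)$ in the stated integrability class such that both equations hold in $\mathcal{D}'(\mathbb{R}^N)$ (all terms other than the Laplacians being locally integrable functions). No sign condition is imposed on $u,v$. For $q>0$, $|t|^{q-1}t$ is understood to be $0$ at $t=0$; $|t|^s\equiv 1$ when $s=0$. Equalities between functions are a.e. on $\mathbb{R}^N$. *)

(* Defs.v *)
From HB Require Import structures.
From mathcomp Require Import all_boot all_order all_algebra.
From mathcomp Require Import all_classical all_reals all_analysis.

Set Implicit Arguments.
Unset Strict Implicit.
Unset Printing Implicit Defensive.
Import Order.TTheory GRing.Theory Num.Theory.
Import numFieldNormedType.Exports.
Local Open Scope classical_set_scope.
Local Open Scope ring_scope.

Fact borel_display : measure_display. Proof. exact: default_measure_display. Qed.

Section borel.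
Context (R : realType) (n : nat).

Let borel0 : <<s @open 'rV[R]_n >> set0.
Proof. exact: sigma_algebra0. Qed.

Let borelC A : <<s @open 'rV[R]_n >> A -> <<s @open 'rV[R]_n >> (~` A).
Proof. exact: sigma_algebraC. Qed.

Let borel_bigcup (F : (set 'rV[R]_n)^nat) :
  (forall i, <<s @open 'rV[R]_n >> (F i)) ->
  <<s @open 'rV[R]_n >> (\bigcup_i F i).
Proof. exact: sigma_algebra_bigcup. Qed.

HB.instance Definition _ := @isMeasurable.Build borel_display 'rV[R]_n
  <<s @open 'rV[R]_n >> borel0 borelC borel_bigcup.

End borel.

Lemma open_measurable_rV (R : realType) n (U : set 'rV[R]_n) :
  open U -> measurable U.
Proof. exact: sub_sigma_algebra. Qed.

Definition rV_cons (R : realType) n (p : measurableTypeR R * 'rV[R]_n) :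
    'rV[R]_n.+1 :=
  row_mx (const_mx p.1 : 'rV[R]_1) p.2.

Lemma rV_cons_ord0 (R : realType) n (p : measurableTypeR R * 'rV[R]_n) i :
  rV_cons p i ord0 = p.1.
Proof.
rewrite /rV_cons mxE; case: splitP => [j _|j //]; by rewrite mxE.
Qed.

Lemma rV_cons_lift (R : realType) n (p : measurableTypeR R * 'rV[R]_n) i j :
  rV_cons p i (lift ord0 j) = p.2 i j.
Proof.
rewrite /rV_cons mxE; case: splitP => [k|k /= E]; first by case: k => -[].
by congr (p.2 _ _); apply/val_inj; move: E => /=; rewrite /bump /= !add1n => -[].
Qed.

Lemma rat_mx_ball (R : realType) n (x : 'rV[R]_n) (e : R) : 0 < e ->
  exists (q : 'rV[rat]_n) (k : nat),
    ball (map_mx ratr q : 'rV[R]_n) k.+1%:R^-1 x /\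
    ball (map_mx ratr q : 'rV[R]_n) k.+1%:R^-1 `<=` ball x e.
Proof.
move=> e0.
have [k ke] : exists k : nat, k.+1%:R^-1 < e / 2 :> R.
  have /ltr_add_invr[k] : 0 < e / 2 by rewrite divr_gt0.
  by rewrite add0r; exists k.
have k0 : 0 < k.+1%:R^-1 :> R by rewrite invr_gt0.
have H (j : 'I_n) : exists q : rat, `|ratr q - x ord0 j| < k.+1%:R^-1.
  have /rat_in_itvoo[q] : x ord0 j - k.+1%:R^-1 < x ord0 j + k.+1%:R^-1.
    by rewrite ltrD2l gtrN.
  by rewrite in_itv/= => qx; exists q; rewrite ltr_distl.
pose q := \row_j sval (cid (H j)).
have bx : ball (map_mx ratr q : 'rV[R]_n) k.+1%:R^-1 x.
  split => // i j; rewrite /ball/= !mxE (ord1 i); exact: svalP (cid (H j)).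
exists q, k; split => // y by_.
rewrite (splitr e); apply: (@ball_triangle _ _ (map_mx ratr q : 'rV[R]_n)).
  by apply: ball_sym; apply: le_ball bx; exact: ltW.
by apply: le_ball by_; exact: ltW.
Qed.

Lemma measurable_rV_cons (R : realType) n :
  measurable_fun [set: measurableTypeR R * 'rV[R]_n] (@rV_cons R n).
Proof.
apply: (@measurability _ _ _ _ _ _ (@open 'rV[R]_n.+1)) => //.
move=> _ [U oU <-]; rewrite setTI.
pose B (c : 'rV[rat]_n.+1 * nat) : set 'rV[R]_n.+1 :=
  ball (map_mx ratr c.1 : 'rV[R]_n.+1) c.2.+1%:R^-1.
pose P c : set (measurableTypeR R * 'rV[R]_n) :=
  if pselect (B c `<=` U) then @rV_cons R n @^-1` B c else set0.
have -> : @rV_cons R n @^-1` U = \bigcup_c P c.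
  apply/seteqP; split=> [p /= Up|p [c _]]; last first.
    by rewrite /P; case: pselect => // cU; apply: cU.
  move: oU; rewrite openE => /(_ _ Up) /nbhs_ballP[e /= e0 eU].
  have [q [k [bq qe]]] := rat_mx_ball (rV_cons p) e0.
  exists (q, k) => //; rewrite /P; case: pselect => // -[].
  exact: subset_trans qe eU.
apply: countable_bigcupT_measurable => // c; rewrite /P.
case: pselect => BU /=; last exact: measurable0.
pose qt : 'rV[R]_n := \row_j ratr (c.1 ord0 (lift ord0 j)).
have -> : @rV_cons R n @^-1` B c =
    (ball (ratr (c.1 ord0 ord0) : R) c.2.+1%:R^-1) `*` ball qt c.2.+1%:R^-1.
  apply/seteqP; split=> [p [c0 bp]|p [b1 [c0 b2]]].
    split=> /=.
      by have := bp ord0 ord0; rewrite rV_cons_ord0 mxE.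
    split => // i j; have := bp i (lift ord0 j).
    by rewrite rV_cons_lift !mxE (ord1 i).
  split => // i j; rewrite (ord1 i).
  case: (unliftP ord0 j) => [k|] ->; last by rewrite rV_cons_ord0 mxE.
  by rewrite rV_cons_lift; have := b2 ord0 k; rewrite !mxE.
apply: measurableX; first exact: measurable_realfun.measurable_ball.
by apply: open_measurable_rV; exact: ball_open.
Qed.

Definition rV_behead (R : realType) n (v : 'rV[R]_n.+1) : 'rV[R]_n :=
  \row_j v ord0 (lift ord0 j).

Lemma rV_consK (R : realType) n :
  cancel (@rV_cons R n) (fun v => (v ord0 ord0, rV_behead v)).
Proof.
move=> [x v]; congr pair; first by rewrite rV_cons_ord0.
by apply/rowP => j; rewrite mxE rV_cons_lift.
Qed.

Lemma measurable_coord_rV (R : realType) n (i : 'I_n) :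
  measurable_fun [set: 'rV[R]_n] (fun v => v ord0 i : measurableTypeR R).
Proof.
apply: (@measurability _ _ _ _ _ _ (measurable_realfun.RGenOpens.G (R := R))).
  exact: measurable_realfun.RGenOpens.measurableE.
move=> _ [_ [x [y ->]] <-]; rewrite setTI; apply: open_measurable_rV.
apply: open_comp; last exact: interval_open.
by move=> v _; exact: coord_continuous.
Qed.

Lemma measurable_rV_behead (R : realType) n :
  measurable_fun [set: 'rV[R]_n.+1] (@rV_behead R n).
Proof.
apply: (@measurability _ _ _ _ _ _ (@open 'rV[R]_n)) => //.
move=> _ [U oU <-]; rewrite setTI; apply: open_measurable_rV.
apply: open_comp => // v _ A /nbhs_ballP[e /= e0 eA].
apply/nbhs_ballP; exists e => //= w [_ vw]; apply: eA; split => // i j.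
by rewrite !mxE.
Qed.

Section lebesgue_rV_step.
Context (R : realType) (n : nat).
Variable m : {sigma_finite_measure set 'rV[R]_n -> \bar R}.

Definition lebesgue_rV_step : set 'rV[R]_n.+1 -> \bar R :=
  pushforward (@lebesgue_measure R \x m)%E (@rV_cons R n).

Let mcons := @measurable_rV_cons R n.

Let lebesgue_rV_step0 : lebesgue_rV_step set0 = 0%E.
Proof. exact: measure0. Qed.

Let lebesgue_rV_step_ge0 A : (0 <= lebesgue_rV_step A)%E.
Proof. exact: measure_ge0. Qed.

Let lebesgue_rV_step_semi_sigma_additive : semi_sigma_additive lebesgue_rV_step.
Proof. exact: measure_semi_sigma_additive. Qed.

HB.instance Definition _ := isMeasure.Build _ _ _ lebesgue_rV_step
  lebesgue_rV_step0 lebesgue_rV_step_ge0 lebesgue_rV_step_semi_sigma_additive.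

Let lebesgue_rV_step_sigma_finite : sigma_finite setT lebesgue_rV_step.
Proof.
have /sigma_finiteP[F [FT ndF Foo]] := sigma_finiteT (@lebesgue_measure R).
have /sigma_finiteP[G [GT ndG Goo]] := sigma_finiteT m.
pose hd (v : 'rV[R]_n.+1) : measurableTypeR R := v ord0 ord0.
exists (fun i => (hd @^-1` F i) `&` (@rV_behead R n @^-1` G i)).
  apply/esym; rewrite -subTset => v _.
  have [i _ Fi] : (\bigcup_i F i) (hd v) by rewrite -FT.
  have [j _ Gj] : (\bigcup_i G i) (rV_behead v) by rewrite -GT.
  exists (maxn i j) => //; split.
    by have /subsetPset := ndF _ _ (leq_maxl i j); apply.
  by have /subsetPset := ndG _ _ (leq_maxr i j); apply.
move=> i; have [mF Fi] := Foo i; have [mG Gi] := Goo i; split.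
  apply: measurableI; rewrite -[X in measurable X]setTI.
    by apply: measurable_coord_rV.
  by apply: measurable_rV_behead.
rewrite /lebesgue_rV_step /pushforward (_ : _ @^-1` _ = F i `*` G i); last first.
  apply/seteqP; split=> p /=;
    by rewrite /hd rV_cons_ord0 (_ : rV_behead _ = p.2)// -[RHS](congr1 snd (rV_consK p)).
by rewrite product_measure1E// lte_mul_pinfty// ge0_fin_numE.
Qed.

HB.instance Definition _ := Measure_isSigmaFinite.Build _ _ _ lebesgue_rV_step
  lebesgue_rV_step_sigma_finite.

End lebesgue_rV_step.

Fixpoint lebesgue_rV (R : realType) (n : nat) :
    {sigma_finite_measure set 'rV[R]_n -> \bar R} :=
  match n with
  | 0%N => \d_(0 : 'rV[R]_0)
  | k.+1 => lebesgue_rV_step (lebesgue_rV R k)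
  end.

Lemma lebesgue_rV_box (R : realType) n (a b : 'rV[R]_n) :
  (forall i, a ord0 i <= b ord0 i) ->
  lebesgue_rV R n [set x : 'rV[R]_n | forall i, x ord0 i \in `[a ord0 i, b ord0 i]] =
  (\prod_(i < n) (b ord0 i - a ord0 i))%:E.
Proof.
have mbox k (c d : 'rV[R]_k) :
    measurable [set x : 'rV[R]_k |
      forall i, x ord0 i \in `[c ord0 i, d ord0 i]].
  rewrite [X in measurable X](_ : _ = \bigcap_(i in [set: 'I_k])
      (fun x : 'rV[R]_k => x ord0 i) @^-1` `[c ord0 i, d ord0 i]); last first.
    by apply/seteqP; split=> [x xcd i _|x xcd i]; [exact: xcd|exact: (xcd i)].
  apply: fin_bigcap_measurable => // i _; rewrite -[X in measurable X]setTI.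
  by apply: measurable_coord_rV => //; exact: measurable_itv.
elim: n a b => [|n IHn] a b ab.
  by rewrite /= big_ord0 diracE mem_set// => -[].
rewrite big_ord_recl /= /lebesgue_rV_step /pushforward.
have -> : rV_cons (n := n) @^-1`
      [set x : 'rV[R]_n.+1 | forall i, x ord0 i \in `[a ord0 i, b ord0 i]] =
    [set` `[a ord0 ord0, b ord0 ord0]] `*`
    [set x : 'rV[R]_n | forall i,
       x ord0 i \in `[rV_behead a ord0 i, rV_behead b ord0 i]].
  apply/seteqP; split=> [p /= pab|p /= [p1 p2] i].
    split=> [|i]; first by have := pab ord0; rewrite rV_cons_ord0.
    by have := pab (lift ord0 i); rewrite rV_cons_lift !mxE.
  case: (unliftP ord0 i) => [k|] ->; last by rewrite rV_cons_ord0.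
  by rewrite rV_cons_lift; have := p2 k; rewrite !mxE.
rewrite product_measure1E//; last exact: mbox.
rewrite IHn => [|i]; last by rewrite !mxE.
rewrite [X in (X * _)%E](lebesgue_measure_itv `[_, _]) /= lte_fin EFinM.
congr (_ * _)%E; last first.
  by congr EFin; apply: eq_bigr => i _; rewrite !mxE.
case: ltP => // ba; congr EFin; apply/esym/eqP.
by rewrite subr_eq0 eq_le ba ab.
Qed.

Section smooth.
Context (R : realType) (N : nat).
Implicit Types f : 'rV[R]_N -> R.

Definition partial (i : 'I_N) f : 'rV[R]_N -> R := 'D_(delta_mx 0 i) f.

Fixpoint Ck (k : nat) f : Prop :=
  if k is l.+1 then
    continuous f /\
    forall i, (forall x, derivable f x (delta_mx 0 i)) /\ Ck l (partial i f)
  else continuous f.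

Definition laplacian f : 'rV[R]_N -> R :=
  fun x => \sum_(i < N) partial i (partial i f) x.

Definition harmonic_fun f := Ck 2 f /\ forall x, laplacian f x = 0.

Definition test_function f :=
  (forall k, Ck k f) /\ compact (closure [set x | f x != 0]).

End smooth.

Section distributions.
Context (R : realType) (N : nat).
Local Notation mu := (lebesgue_rV R N).
Implicit Types f g h u v : 'rV[R]_N -> R.

(* Measurability is Borel measurability; every class in L^p_loc has a Borel
   representative. *)
Definition Lp_loc (p : R) u :=
  measurable_fun [set: 'rV[R]_N] u /\
  forall K : set 'rV[R]_N, compact K ->
    mu.-integrable K (fun x => (`|u x| `^ p)%:E).

(* - Delta u + g = h in D'(R^N) *)
Definition distributional_eq u g h :=
  forall phi, test_function phi ->
    \int[mu]_x (u x * - laplacian phi x) + \int[mu]_x (g x * phi x) =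
    \int[mu]_x (h x * phi x).

(* The convention 0 `^ r = (r == 0)%:R of powR agrees with the conventions
   |t|^(q-1) t = 0 at t = 0 and |t|^0 = 1. *)
Definition signed_pow (q t : R) : R := `|t| `^ (q - 1) * t.

(* For p = max(m, theta, 2s+gamma) every nonlinear term is in L^1_loc, so all
   the integrals in [distributional_eq] converge. *)
Definition distributional_solution (m theta s gamma : R)
    (alpha beta lambda : 'rV[R]_N -> R) u v :=
  let p := Num.max m (Num.max theta (2 * s + gamma)) in
  [/\ Lp_loc p u, Lp_loc p v,
      distributional_eq u
        (fun x => alpha x * signed_pow m (u x))
        (fun x => - lambda x * signed_pow theta (u x) +
                  beta x * `|u x| `^ s * signed_pow (s + gamma) (v x)) &
      distributional_eq v
        (fun x => alpha x * signed_pow m (v x))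
        (fun x => - lambda x * signed_pow theta (v x) +
                  beta x * `|v x| `^ s * signed_pow (s + gamma) (u x))].

Definition ae_eq_fun u v := {ae mu, forall x, u x = v x}.

Definition bounded_one_side u :=
  (exists M, {ae mu, forall x, u x <= M}) \/
  (exists M, {ae mu, forall x, M <= u x}).

End distributions.

(* Main.v *)
(* Write both equations as [Delta u = f], [Delta v = g] in the sense of
   distributions, with locally integrable [f] and [g]. Mollification gives Kato's
   inequality [Delta |u| >= sgn(u) f].

   Since (x^s - y^s)(x^a - y^a) >= 0 with a = s + gamma and theta = s + a, the sum
   w = |u| + |v| satisfies, in cases (i)-(iii), Delta w >= c w^q with c > 0 and
   q > 1 (q = theta or m). By Jensen's inequality the mollified w satisfies the
   same inequality in the classical sense; looking at the maximum of w_e zeta^k for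
   zeta(y) = 1 - |y - x|^2 / rho^2 and k(q - 1) >= 2 bounds w_e(x)^(q-1) by
   C / rho^2 for every rho (Keller-Osserman), so w = 0.

   In case (iv), D = u - v satisfies sgn(D) Delta D >= c |D|^theta, by the
   monotonicity of the signed powers, so u = v by the same argument, and then
   Delta u = 0. If K_e is a suitable radial kernel of radius e, then u * K_e is e^N
   times a quantity independent of e, because its derivative in e tests Delta u
   against a bump; so u equals a.e. each of its normalized mollifications, which are
   harmonic. These kernels at scale e are dominated by a constant times those at
   scale 3e with a shifted centre, whence Harnack's inequality h(x) - inf h <=
   K (h(y) - inf h) for a harmonic h bounded below, and h is constant. *)

Require Import Defs.
From mathcomp Require Import all_boot all_order all_algebra.
From mathcomp Require Import all_classical all_reals all_analysis.
From mathcomp Require Import measurable_realfun.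
From mathcomp Require Import ring lra.
Import Order.TTheory GRing.Theory Num.Theory.
Import numFieldNormedType.Exports.
Local Open Scope classical_set_scope.
Local Open Scope ring_scope.
Set Implicit Arguments.
Unset Strict Implicit.
Unset Printing Implicit Defensive.

(** * Differential calculus *)

(** A solution is only locally integrable, so it has neither reliable pointwise values nor a
    maximum. Every pointwise argument is therefore run on a mollified function, and mollifications
    converge only in [L^1] on cubes. Kato's inequality then needs a Lipschitz estimate in place of
    almost everywhere convergence. The relation [theta = 2s + gamma] gives coupling and absorption
    the same total degree, whence the coefficient [lambda - beta] in (i) and (iii); in (ii) the
    constant comes from [alpha], with [q = m]. In (iv) the sum [w] keeps no absorption, but
    subtracting the equations leaves [lambda (|u|^s + |v|^s)] times a difference of signed powers of
    order [s + gamma], whose product with [sgn(D)] controls [|D|^theta]. The radial profile is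
    chosen so that the Laplacian of a bump can be integrated exactly in the scale. Translation
    invariance and differentiation under the integral then replace spherical means, polar
    coordinates and dilations; even the scaling of the mass of the kernel comes from this identity,
    applied to the constant [1]. *)

Section calculus.
Context (R : realType) (N : nat).
Implicit Types (f g : 'rV[R]_N -> R).

(** The two difference quotients are the same function. Through this equivalence the chain rule,
    affine substitution and translation for directional derivatives reduce to one real variable. *)
Lemma is_derive_line (V : normedModType R) (f : V -> R) (x v : V) (d : R) :
  is_derive (0 : R) 1 (fun t : R => f (t *: v + x)) d <-> is_derive x v f d.
Proof.
have E : 'D_1 (fun t : R => f (t *: v + x)) 0 = 'D_v f x.
  rewrite /derive; set g1 := (X in lim (X @ _)); set g2 := (X in _ = lim (X @ _)).
  suff -> : g1 = g2 by []. apply/funext => h; rewrite /g1 /g2 /=.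
  by rewrite addr0 scale0r add0r [_%:A]mulr1.
by split=> -[D <-]; apply: DeriveDef; rewrite ?E//; apply/(derivable1P f x v).
Qed.

Lemma is_derive_along (V : normedModType R) (f : V -> R) (x v : V) (t d : R) :
  is_derive (t *: v + x) v f d <->
  is_derive t 1 (fun t : R => f (t *: v + x)) d.
Proof.
rewrite -is_derive_line -[X in _ <-> X]is_derive_line.
rewrite (_ : (fun s => f (s *: v + (t *: v + x))) =
             (fun s => f ((s *: 1 + t) *: v + x)))//.
by apply/funext => s; rewrite [s *: 1]mulr1 scalerDl addrA.
Qed.

Lemma is_derive_chain (V : normedModType R) (g : R -> R) (f : V -> R) (x v : V) (dg df : R) :
  is_derive (f x) 1 g dg -> is_derive x v f df ->
  is_derive x v (fun z : V => g (f z)) (dg * df).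
Proof.
move=> Dg /is_derive_line Df; apply/is_derive_line.
apply: (@is_derive1_comp _ g (fun t : R => f (t *: v + x))).
by rewrite scale0r add0r.
Qed.

Lemma is_derive_coord (i j : 'I_N) x :
  is_derive x (delta_mx 0 i) (fun y : 'rV[R]_N => y 0 j) (i == j)%:R.
Proof.
apply/is_derive_line.
rewrite (_ : (fun _ => _) = (fun t : R => t * (i == j)%:R + x 0 j)); last first.
  by apply/funext => t; rewrite !mxE eqxx (eq_sym j).
by apply: is_derive_eq; rewrite addr0 scaler0 add0r [_ *: _]mulr1.
Qed.

Lemma continuous_add (T : topologicalType) (f g : T -> R) :
  continuous f -> continuous g -> continuous (fun x => f x + g x).
Proof. by move=> cf cg x; exact: continuousD (cf x) (cg x). Qed.

Lemma continuous_mul (T : topologicalType) (f g : T -> R) :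
  continuous f -> continuous g -> continuous (fun x => f x * g x).
Proof. by move=> cf cg x; exact: continuousM (cf x) (cg x). Qed.

Lemma continuous_fcomp (T U V : topologicalType) (f : T -> U) (g : U -> V) :
  continuous f -> continuous g -> continuous (fun x => g (f x)).
Proof. by move=> cf cg x; apply: continuous_comp; [exact: cf|exact: cg]. Qed.

Lemma partialE f x i d : is_derive x (delta_mx 0 i) f d -> partial i f x = d.
Proof. by case. Qed.

Definition smooth f := forall k, Ck k f.

Lemma Ck_continuous k f : Ck k f -> continuous f.
Proof. by case: k => [|k] //= []. Qed.

Lemma CkW k f : Ck k.+1 f -> Ck k f.
Proof.
elim: k f => [|k IH] f; first by case.
case=> cf H; split=> // i; split; first exact: (H i).1.
exact: IH (H i).2.
Qed.

Lemma Ck_le k l f : (l <= k)%N -> Ck k f -> Ck l f.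
Proof.
move=> /subnK <-; elim: (k - l)%N => // n IH /CkW; exact: IH.
Qed.

Lemma Ck_is_derive k f x i : Ck k.+1 f ->
  is_derive x (delta_mx 0 i) f (partial i f x).
Proof. by case=> _ H; apply: DeriveDef => //; exact: (H i).1. Qed.

Lemma Ck_partial k f i : Ck k.+1 f -> Ck k (partial i f).
Proof. by case=> _ H; exact: (H i).2. Qed.

Lemma CkS k f : continuous f ->
  (forall i, exists2 g, Ck k g & forall x, is_derive x (delta_mx 0 i) f (g x)) ->
  Ck k.+1 f.
Proof.
move=> cf H; split=> // i; have [g Cg Dg] := H i; split.
  by move=> x; have [] := Dg x.
rewrite (_ : partial i f = g)//; apply/funext => x; exact: partialE.
Qed.

Lemma Ck_cst k (c : R) : Ck k (fun _ : 'rV[R]_N => c).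
Proof.
elim: k c => [|k IH] c; first by exact: cst_continuous.
apply: CkS => [|i]; first exact: cst_continuous.
by exists (fun=> 0) => // x; exact: is_derive_cst.
Qed.

Lemma Ck_add k f g : Ck k f -> Ck k g -> Ck k (fun x => f x + g x).
Proof.
elim: k f g => [|k IH] f g Cf Cg.
  exact: continuous_add.
apply: CkS => [|i].
  by apply: continuous_add; [exact: Ck_continuous Cf|exact: Ck_continuous Cg].
exists (fun x => partial i f x + partial i g x) => [|x].
  by apply: IH; exact: Ck_partial.
exact: is_deriveD (Ck_is_derive x i Cf) (Ck_is_derive x i Cg).
Qed.

Lemma Ck_mul k f g : Ck k f -> Ck k g -> Ck k (fun x => f x * g x).
Proof.
elim: k f g => [|k IH] f g Cf Cg.
  exact: continuous_mul.
apply: CkS => [|i].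
  by apply: continuous_mul; [exact: Ck_continuous Cf|exact: Ck_continuous Cg].
exists (fun x => f x * partial i g x + g x * partial i f x) => [|x].
  apply: Ck_add; apply: IH; [exact: CkW|exact: Ck_partial Cg|
      exact: CkW|exact: Ck_partial Cf].
exact: is_deriveM (Ck_is_derive x i Cf) (Ck_is_derive x i Cg).
Qed.

Lemma Ck_sum k (I : Type) (s : seq I) (F : I -> 'rV[R]_N -> R) :
  (forall i, Ck k (F i)) -> Ck k (fun x => \sum_(i <- s) F i x).
Proof.
move=> CF; elim: s => [|i s IH].
  by rewrite (_ : (fun _ => _) = fun=> 0);
    [exact: Ck_cst|apply/funext => x; rewrite big_nil].
rewrite (_ : (fun _ => _) = fun x => F i x + \sum_(j <- s) F j x).
  exact: Ck_add.
by apply/funext => x; rewrite big_cons.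
Qed.

Lemma Ck_coord k (j : 'I_N) : Ck k (fun x : 'rV[R]_N => x 0 j).
Proof.
case: k => [|k]; first exact: coord_continuous.
apply: CkS => [|i]; first exact: coord_continuous.
by exists (fun=> (i == j)%:R) => [|x]; [exact: Ck_cst|exact: is_derive_coord].
Qed.

Lemma Ck_exp k f n : Ck k f -> Ck k (fun x => f x ^+ n).
Proof.
move=> Cf; elim: n => [|n IH].
  by rewrite (_ : (fun _ => _) = fun=> 1);
    [exact: Ck_cst|apply/funext => x; rewrite expr0].
rewrite (_ : (fun _ => _) = fun x => f x * f x ^+ n); first exact: Ck_mul.
by apply/funext => x; rewrite exprS.
Qed.

(* [D] maps the index of a function to that of its derivative. *)
Lemma Ck_comp (I : Type) (G : I -> R -> R) (D : I -> I) k p f :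
  (forall q (t : R), is_derive t 1 (G q) (G (D q) t)) -> Ck k f ->
  Ck k (fun x => G p (f x)).
Proof.
move=> DG; have cG q : continuous (G q).
  move=> t; apply/differentiable_continuous/derivable1_diffP.
  by have [] := DG q t.
elim: k p f => [|k IH] p f Cf.
  exact: continuous_fcomp.
apply: CkS => [|i].
  by apply: continuous_fcomp; [exact: Ck_continuous Cf|exact: cG].
exists (fun x => G (D p) (f x) * partial i f x) => [|x].
  by apply: Ck_mul; [apply: IH; exact: CkW|exact: Ck_partial Cf].
exact: is_derive_chain (DG _ _) (Ck_is_derive x i Cf).
Qed.

Lemma is_derive_affine f x v (a : R) (b : 'rV[R]_N) (d : R) :
  is_derive (a *: x + b) v f d ->
  is_derive x v (fun y => f (a *: y + b)) (a * d).
Proof.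
move=> D; apply/is_derive_line.
rewrite (_ : (fun _ => _) = (fun t : R => f ((a * t) *: v + (a *: x + b)))).
  rewrite mulrC.
  apply: (@is_derive_chain _ (fun s : R => f (s *: v + (a *: x + b)))
    (fun t : R => a * t)).
    by rewrite mulr0; apply/is_derive_line.
  by apply: is_derive_eq; exact: mulr1.
by apply/funext => t; rewrite scalerDr addrA scalerA.
Qed.

End calculus.

(** * Bump functions *)

Section flat.
Context {R : realType}.
Implicit Types (p : {poly R}) (t s : R).

(* Powers of [1/t] are allowed in front of [exp (-1/t)] because the resulting
   family is closed under differentiation. *)
Definition flat p t : R := if 0 < t then p.[t^-1] * expR (- t^-1) else 0.

(** From [d/dt (p(1/t) exp(-1/t)) = t^-2 (p - p')(1/t) exp(-1/t)]. *)
Definition flatD p : {poly R} := 'X^2 * (p - p^`()).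

(** Each monomial satisfies [s^i exp(-s) <= i!], by keeping a single term of the exponential
    series. *)
Lemma poly_expR_bounded p : exists2 C : R, 0 <= C &
  forall s, 0 < s -> `|p.[s]| * expR (- s) <= C.
Proof.
exists (\sum_(i < size p) `|p`_i| * i`!%:R) => [|s s0].
  by apply: sumr_ge0 => i _; rewrite mulr_ge0.
rewrite horner_coef.
apply: (@le_trans _ _ (\sum_(i < size p) `|p`_i * s ^+ i| * expR (- s))).
  by rewrite -mulr_suml ler_wpM2r ?expR_ge0//; exact: ler_norm_sum.
apply: ler_sum => i _; rewrite normrM -mulrA ler_wpM2l//.
rewrite ger0_norm ?exprn_ge0 ?(ltW s0)// expRN ler_pdivrMr ?expR_gt0//.
rewrite mulrC -ler_pdivrMr ?ltr0n ?fact_gt0//.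
case: i => -[|i] _ /=.
  by rewrite expr0 fact0 divr1 ltW// expR_gt1.
by apply: le_trans (expR_ge1Dxn i (ltW s0)); rewrite lerDr.
Qed.

(** The factor [1/t] is absorbed by applying the previous bound to [p * 'X]. The linear bound yields
    differentiability at [0] and bounds on the bumps that are uniform in the scale. *)
Lemma flat_norm_le p : exists2 C : R, 0 <= C &
  forall t, `|flat p t| <= C * `|t|.
Proof.
have [C C0 H] := poly_expR_bounded (p * 'X).
exists C => // t; rewrite /flat; case: ifPn => t0; last first.
  by rewrite normr0 mulr_ge0.
have := H t^-1; rewrite invr_gt0 => /(_ t0).
rewrite hornerM hornerX normrM (gtr0_norm t0) normrM (gtr0_norm (expR_gt0 _)).
rewrite (@gtr0_norm _ t^-1) ?invr_gt0// => {}H.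
rewrite -ler_pdivrMr//; apply: le_trans H.
by rewrite le_eqVlt mulrAC eqxx.
Qed.

Lemma is_derive_flat p t : is_derive t 1 (flat p) (flat (flatD p) t).
Proof.
have [t0|t0|<-] := ltgtP 0 t.
- have D : is_derive t 1 (fun x => p.[x^-1] * expR (- x^-1)) (flat (flatD p) t).
    have H' : is_derive t 1 (fun x : R => x^-1) (- t ^- 2).
      have := is_deriveV (lt0r_neq0 t0) (is_derive_id t 1).
      by rewrite [_ *: _]mulr1.
    have H : is_derive t 1 (fun x : R => - x^-1) (t ^- 2).
      by rewrite -[t ^- 2]opprK; exact: is_deriveN.
    have D1 : is_derive t 1 (fun x : R => p.[x^-1]) _ :=
      is_derive_chain (is_derive_poly p t^-1) H'.
    have D2 : is_derive t 1 (fun x : R => expR (- x^-1)) _ :=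
      is_derive_chain (g := expR) (is_derive_expR _) H.
    have := is_deriveM D1 D2; set d := (X in is_derive _ _ _ X -> _).
    suff -> : d = flat (flatD p) t by exact.
    rewrite {}/d.
    rewrite /flat t0 /flatD !hornerE.
    rewrite /GRing.scale /= exprVn; ring.
  apply: near_eq_is_derive D; near=> x.
  by rewrite /flat ifT//; near: x; exact: lt_nbhsr.
- have -> : flat (flatD p) t = 0 by rewrite /flat ltNge (ltW t0).
  have Z : is_derive t 1 (fun _ : R => 0 : R) 0 by exact: is_derive_cst.
  apply: near_eq_is_derive Z; near=> x; rewrite /flat ifN// -leNgt ltW//; near: x; exact: lt_nbhsl.
(* At the origin the difference quotient of [flat p] is [flat (p * 'X)], which the linear bound
   sends to [0]. *)
- have [C C0 H] := flat_norm_le (p * 'X).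
  have f0 q : flat q 0 = 0 by rewrite /flat ltxx.
  rewrite f0; suff L : h^-1 *: (flat p (h *: (1 : R) + 0) - flat p 0) @[h --> 0^'] --> (0 : R).
    by split; [apply/cvg_ex; exists 0|exact/cvg_lim].
  apply/cvgr0Pnorm_lt => e e0.
  have [d d0 Hd] : exists2 d : R, 0 < d & C * d < e.
    exists (e / (C + 1)); first by rewrite divr_gt0// ltr_wpDl.
    rewrite mulrCA gtr_pMr// ltr_pdivrMr ?ltr_wpDl// mul1r ltrDl//.
  near=> h.
  have hd : `|h| < d by near: h; apply: dnbhs0_lt.
  have h0 : h != 0 by near: h; exact: nbhs_dnbhs_neq.
  rewrite addr0 f0 subr0 [h *: 1]mulr1.
  have -> : h^-1 *: flat p h = flat (p * 'X) h.
    rewrite /flat; case: ifP => _; last by rewrite scaler0.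
    by rewrite hornerM hornerX /GRing.scale /=; ring.
  by rewrite (le_lt_trans (H _))// (le_lt_trans _ Hd)// ler_wpM2l// ltW.
Unshelve. all: by end_near. Qed.

End flat.

(** * Radial bumps: supports, Laplacian, derivative in the scale *)

Section rbump.
Context {R : realType} {N : nat}.
Implicit Types (x y z : 'rV[R]_N) (f g : 'rV[R]_N -> R).

(* The norm of ['rV[R]_N] is the sup norm; [nsq] is the Euclidean one, squared. *)
Definition nsq x : R := \sum_(j < N) (x 0 j) ^+ 2.

Lemma nsq_ge0 x : 0 <= nsq x.
Proof. by apply: sumr_ge0 => j _; exact: sqr_ge0. Qed.

Lemma nsq_coord_le x j : (x 0 j) ^+ 2 <= nsq x.
Proof.
rewrite /nsq (bigD1 j)//= lerDl; apply: sumr_ge0 => i _; exact: sqr_ge0.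
Qed.

Lemma coord_le_norm x j : `|x 0 j| <= `|x|.
Proof.
rewrite [leRHS]/Num.norm /= mx_normrE; apply/bigmax_geP; right => /=.
by exists (0, j).
Qed.

Lemma norm_le_coord x r : 0 <= r -> (forall j, `|x 0 j| <= r) -> `|x| <= r.
Proof.
move=> r0 H; rewrite [leLHS]/Num.norm /= mx_normrE; apply/bigmax_leP; split=> //.
by move=> [i j] _ /=; rewrite (ord1 i).
Qed.

Lemma norm_sqr_le_nsq x : `|x| ^+ 2 <= nsq x.
Proof.
have : `|x| <= Num.sqrt (nsq x).
  apply: norm_le_coord => // j.
  by rewrite -sqrtr_sqr ler_wsqrtr// nsq_coord_le.
rewrite -(@ler_pXn2r _ 2)// ?nnegrE// sqr_sqrtr//; exact: nsq_ge0.
Qed.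

Lemma nsq_le_norm_sqr x : nsq x <= N%:R * `|x| ^+ 2.
Proof.
apply: (@le_trans _ _ (\sum_(j < N) `|x| ^+ 2)).
  apply: ler_sum => j _; rewrite -real_normK ?num_real// ler_pXn2r ?nnegrE//.
  exact: coord_le_norm.
by rewrite sumr_const card_ord mulr_natl.
Qed.

Lemma nsqN x : nsq (- x) = nsq x.
Proof. by apply: eq_bigr => j _; rewrite mxE sqrrN. Qed.

Definition rbump (p : {poly R}) (e : R) x y : R := flat p (1 - nsq (y - x) / e ^+ 2).

Lemma smooth_nsqB x : smooth (fun y => nsq (y - x)).
Proof.
move=> k; apply: Ck_sum => j; apply: Ck_exp.
rewrite (_ : (fun _ => _) = fun y => y 0 j + - x 0 j).
  by apply: Ck_add; [exact: Ck_coord|exact: Ck_cst].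
by apply/funext => y; rewrite !mxE.
Qed.

Lemma smooth_bump_arg e x : smooth (fun y => 1 - nsq (y - x) / e ^+ 2).
Proof.
move=> k; rewrite (_ : (fun _ => _) = fun y => 1 + (- e ^- 2) * nsq (y - x)).
  apply: Ck_add; first exact: Ck_cst.
  by apply: Ck_mul; [exact: Ck_cst|exact: smooth_nsqB].
by apply/funext => y; rewrite mulNr mulrC.
Qed.

Lemma smooth_bump p e x : smooth (rbump p e x).
Proof.
move=> k; apply: (Ck_comp (G := flat) (D := flatD)); last exact: smooth_bump_arg.
by move=> q t; exact: is_derive_flat.
Qed.

Definition supp (r : R) f := forall x, r < `|x| -> f x = 0.

Lemma bump_out p e x y : 0 < e -> e <= `|y - x| -> rbump p e x y = 0.
Proof.
move=> e0 H; rewrite /rbump /flat ltNge subr_le0 ler_pdivlMr ?exprn_gt0// mul1r.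
rewrite (le_trans _ (norm_sqr_le_nsq _))// ler_pXn2r ?nnegrE//; exact: ltW.
Qed.

Lemma supp_bump p e x r : 0 < e -> `|x| + e <= r -> supp r (rbump p e x).
Proof.
move=> e0 xr y yr; apply: bump_out => //.
have := lerB_normD y (- x); rewrite normrN; lra.
Qed.

Lemma smooth_test_function f r : smooth f -> supp r f -> test_function f.
Proof.
move=> sf fr; split=> //; apply: bounded_closed_compact; last exact: closed_closure.
have cl : closed [set x : 'rV[R]_N | `|x| <= r].
  apply: (@closed_comp _ _ (fun x : 'rV[R]_N => `|x|) [set t | t <= r]).
    by move=> x _; exact: norm_continuous.
  exact: closed_le.
have sub : closure [set x | f x != 0] `<=` [set x : 'rV[R]_N | `|x| <= r].
  rewrite ((closure_id _).1 cl); apply: closure_subset => x /=.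
  by apply: contraNT; rewrite -ltNge => /fr ->.
exists r; split; first exact: num_real.
by move=> M rM x /sub /= xr; rewrite (le_trans xr)// ltW.
Qed.

Lemma test_function_supp f : test_function f -> exists2 r, 0 < r & supp r f.
Proof.
case=> _ /compact_bounded [M [Mr H]].
exists (Num.max (M + 1) 1); first by rewrite lt_max ltr01 orbT.
move=> x xr; apply/eqP; apply: contraTT xr => fx; rewrite -leNgt.
apply: H; first by rewrite lt_max ltrDl ltr01.
exact: subset_closure.
Qed.

Lemma test_bump p e x : 0 < e -> test_function (rbump p e x).
Proof.
move=> e0; apply: (@smooth_test_function _ (`|x| + e)); first exact: smooth_bump.
exact: supp_bump.
Qed.

Lemma is_derive_bump_arg e x y i :
  is_derive y (delta_mx 0 i) (fun z => 1 - nsq (z - x) / e ^+ 2)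
    (- (2 * (y 0 i - x 0 i) / e ^+ 2)).
Proof.
have D : is_derive y (delta_mx 0 i) (fun z => nsq (z - x)) (2 * (y 0 i - x 0 i)).
  rewrite (_ : 2 * _ = \sum_(j < N) (2 * (y 0 j - x 0 j)) * (i == j)%:R); last first.
    rewrite (bigD1 i)//= eqxx mulr1 big1 ?addr0// => j /negbTE ji.
    by rewrite eq_sym ji mulr0.
  rewrite (_ : (fun _ => _) = \sum_(j < N) (fun z : 'rV[R]_N => (z 0 j - x 0 j) ^+ 2)).
    apply: is_derive_sum => j.
    apply: (is_derive_chain (g := fun t : R => (t - x 0 j) ^+ 2)); last exact: is_derive_coord.
    apply: is_derive_eq; rewrite /GRing.scale /=; ring.
  by apply/funext => z; rewrite /nsq fct_sumE; apply: eq_bigr => j _; rewrite !mxE.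
rewrite (_ : - _ = - (e ^- 2) * (2 * (y 0 i - x 0 i))); last by ring.
apply: (is_derive_chain (g := fun t : R => 1 - t / e ^+ 2)) D.
apply: is_derive_eq; rewrite /GRing.scale /=; ring.
Qed.

Lemma is_derive_bump_arg2 e x y i :
  is_derive y (delta_mx 0 i) (fun z : 'rV[R]_N => - (2 * (z 0 i - x 0 i) / e ^+ 2))
    (- (2 / e ^+ 2)).
Proof.
rewrite -[X in is_derive _ _ _ X]mulr1.
apply: (is_derive_chain (g := fun t : R => - (2 * (t - x 0 i) / e ^+ 2))).
  apply: is_derive_eq; rewrite /GRing.scale /=; ring.
by have := is_derive_coord i i y; rewrite eqxx.
Qed.

Lemma is_derive_bump p e x y i :
  is_derive y (delta_mx 0 i) (rbump p e x)
    (rbump (flatD p) e x y * (- (2 * (y 0 i - x 0 i) / e ^+ 2))).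
Proof.
apply: is_derive_chain; first exact: is_derive_flat.
exact: is_derive_bump_arg.
Qed.

Lemma laplacian_bump p e x y :
  laplacian (rbump p e x) y =
  rbump (flatD (flatD p)) e x y * (4 * nsq (y - x) / e ^+ 4) -
  rbump (flatD p) e x y * (2 * N%:R / e ^+ 2).
Proof.
rewrite /laplacian.
have E i z : partial i (rbump p e x) z =
    rbump (flatD p) e x z * (- (2 * (z 0 i - x 0 i) / e ^+ 2)).
  by apply: partialE; exact: is_derive_bump.
transitivity (\sum_(i < N) (rbump (flatD (flatD p)) e x y * (4 / e ^+ 4) * (y 0 i - x 0 i) ^+ 2
    - rbump (flatD p) e x y * (2 / e ^+ 2))).
  apply: eq_bigr => i _; apply: partialE; rewrite (funext (E i)).
  have := is_deriveM (is_derive_bump (flatD p) e x y i) (is_derive_bump_arg2 e x y i).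
  set d := (X in is_derive _ _ _ X -> _).
  set d' := (X in _ -> is_derive _ _ _ X).
  suff -> : d = d' by exact.
  rewrite /d /d' /GRing.scale /= (_ : e ^- 4 = e ^- 2 * e ^- 2); first ring.
  by rewrite -invfM -exprD.
rewrite sumrB -mulr_sumr sumr_const card_ord -mulr_natr /nsq.
under [in RHS]eq_bigr do rewrite !mxE.
ring.
Qed.

(** Compared with [laplacian_bump], this shows that the Laplacian of [rbump p e x] is [2 / e] times
    the scale derivative of [rbump (flatD p) e x], minus [2 N / e^2] times that bump itself. Weyl's
    lemma rests on this identity. *)
Lemma is_derive_bump_scale p (e : R) x y : 0 < e ->
  is_derive e 1 (fun r : R => rbump p r x y)
    (rbump (flatD p) e x y * (2 * nsq (y - x) / e ^+ 3)).
Proof.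
move=> e0; apply: (is_derive_chain (g := flat p) (f := fun r : R => 1 - nsq (y - x) / r ^+ 2));
  first exact: is_derive_flat.
have P : is_derive e 1 (fun r : R => r ^+ 2) (2 * e).
  by apply: is_derive_eq; rewrite /GRing.scale /=; ring.
have H := is_deriveV (f := fun r : R => r ^+ 2) (lt0r_neq0 (exprn_gt0 2 e0)) P.
have := is_deriveB (is_derive_cst (1 : R) e (1 : R)) (is_deriveZ (nsq (y - x)) H).
set d := (X in is_derive _ _ _ X -> _).
set d' := (X in _ -> is_derive _ _ _ X).
suff -> : d = d' by exact.
rewrite /d /d' /GRing.scale /=; field; exact: lt0r_neq0.
Qed.

End rbump.

(** * Lebesgue measure *)

Section measure.
Context {R : realType} {N : nat}.
Local Notation mu := (lebesgue_rV R N).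
Implicit Types (u f g : 'rV[R]_N -> R) (r : R).

Lemma continuous_measurable_rV f : continuous f -> measurable_fun setT f.
Proof.
move=> cf; apply: (@measurability _ _ _ _ _ _ (measurable_realfun.RGenOpens.G (R := R))).
  exact: measurable_realfun.RGenOpens.measurableE.
move=> _ [_ [x [y ->]] <-]; rewrite setTI; apply: open_measurable_rV.
apply: open_comp; last exact: interval_open.
by move=> v _; exact: cf.
Qed.

Lemma measurable_continuous_rV M (F : 'rV[R]_N -> 'rV[R]_M) :
  continuous F -> measurable_fun setT F.
Proof.
move=> cF; apply: (@measurability _ _ _ _ _ _ (@open 'rV[R]_M)) => //.
move=> _ [U oU <-]; rewrite setTI; apply: open_measurable_rV.
by apply: open_comp => // v _; exact: cF.
Qed.

(** In the sup norm these balls are cubes, whose measure is given by [lebesgue_rV_box]; they exhaust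
    the space and serve as the standard compact sets. *)
Definition cb r : set 'rV[R]_N := [set x | `|x| <= r].

Lemma closed_cb r : closed (cb r).
Proof.
apply: (@closed_comp _ _ (fun x : 'rV[R]_N => `|x|) [set t | t <= r]).
  by move=> x _; exact: norm_continuous.
exact: closed_le.
Qed.

Lemma compact_cb r : compact (cb r).
Proof.
apply: bounded_closed_compact; last exact: closed_cb.
exists r; split; first exact: num_real.
by move=> M rM x /= xr; rewrite (le_trans xr)// ltW.
Qed.

Lemma measurable_cb r : measurable (cb r).
Proof.
rewrite -[cb r]setCK; apply: measurableC; apply: open_measurable_rV.
by apply: closed_openC; exact: closed_cb.
Qed.

Lemma cb_fin_measure r : (mu (cb r) < +oo)%E.
Proof.
pose a : 'rV[R]_N := const_mx (- `|r|); pose b : 'rV[R]_N := const_mx `|r|.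
have ab i : a ord0 i <= b ord0 i by rewrite !mxE (le_trans _ (normr_ge0 r))// oppr_le0.
have cl : measurable [set x : 'rV[R]_N | forall i, x ord0 i \in `[a ord0 i, b ord0 i]].
  rewrite (_ : mkset _ = \bigcap_(i in [set: 'I_N])
      (fun x : 'rV[R]_N => x ord0 i) @^-1` `[a ord0 i, b ord0 i]); last first.
    by apply/seteqP; split=> [x xcd i _|x xcd i]; [exact: xcd|exact: (xcd i)].
  apply: fin_bigcap_measurable => // i _; rewrite -[X in measurable X]setTI.
  by apply: measurable_coord_rV => //; exact: measurable_itv.
apply: (@le_lt_trans _ _ (mu [set x : 'rV[R]_N | forall i, x ord0 i \in `[a ord0 i, b ord0 i]])).
  apply: le_measure; rewrite ?inE//; first exact: measurable_cb.
  move=> x /= xr i; rewrite !mxE in_itv /= -ler_norml.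
  by rewrite (le_trans (coord_le_norm _ _))// (le_trans xr)// ler_norm.
by rewrite lebesgue_rV_box// ltry.
Qed.

End measure.

(** * Translation invariance of Lebesgue measure *)

Section translation.
Context {R : realType}.

Lemma lebesgue_measureD (c : R) (A : set (measurableTypeR R)) : measurable A ->
  lebesgue_measure ((fun t : measurableTypeR R => t + c : measurableTypeR R) @^-1` A) = lebesgue_measure A.
Proof.
have mc : measurable_fun setT (fun t : measurableTypeR R => t + c : measurableTypeR R).
  by apply: measurable_funD.
move=> mA; apply/esym.
apply: (@lebesgue_measure_unique R (pushforward (@lebesgue_measure R)
  (fun t : measurableTypeR R => t + c : measurableTypeR R))) => //= _ [[a b]] _ <-.
rewrite /pushforward.
have -> : (fun t : measurableTypeR R => t + c) @^-1` [set` `]a, b]] = [set` `]a - c, b - c]].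
  by apply/seteqP; split=> t /=; rewrite !in_itv /= ltrBlDr lerBrDr.
rewrite !lebesgue_measure_itv /= !lte_fin ltrD2r.
by case: ifP => // _; rewrite -!EFinB opprB addrA subrK.
Qed.

Lemma continuous_shift_rV N (c : 'rV[R]_N) : continuous (fun x : 'rV[R]_N => x + c).
Proof.
move=> x; have H := @continuousD _ _ _ (@idfun 'rV[R]_N) (cst c) x.
apply: (H (fun A a => a)) => B; exact: cst_continuous.
Qed.

(** Induction on the dimension: through [rV_cons] a translation splits into one of the line and one
    of the remaining coordinates, and a product measure is determined by its values on
    rectangles. *)
Lemma lebesgue_rV_shift N (c : 'rV[R]_N) (A : set 'rV[R]_N) : measurable A ->
  lebesgue_rV R N ((fun x => x + c) @^-1` A) = lebesgue_rV R N A.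
Proof.
elim: N c A => [|n IHn] c A mA.
  rewrite (_ : _ @^-1` _ = A)//; apply/seteqP; split=> x /=;
  by rewrite (_ : x + c = x)//; apply/rowP => -[].
rewrite /= /lebesgue_rV_step /pushforward.
pose S (p : measurableTypeR R * 'rV[R]_n) : measurableTypeR R * 'rV[R]_n :=
  (p.1 + c ord0 ord0, p.2 + rV_behead c).
have mS : measurable_fun setT S.
  apply/measurable_fun_pairP; split=> /=.
    by apply: (measurable_funD (measurable_fst)).
  exact: (measurableT_comp (measurable_continuous_rV
    (continuous_shift_rV (c := rV_behead c))) measurable_snd).
have -> : @rV_cons R n @^-1` ((fun x => x + c) @^-1` A) = S @^-1` (@rV_cons R n @^-1` A).
  apply/seteqP; split=> p /=;
    rewrite (_ : rV_cons (S p) = rV_cons p + c)//; apply/rowP => i; rewrite [RHS]mxE;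
    by case: (unliftP ord0 i) => [k|] ->; rewrite ?rV_cons_ord0 ?rV_cons_lift//= !mxE.
pose X := @rV_cons R n @^-1` A; rewrite -/X.
have mX : measurable X.
  by rewrite -[X]setTI; apply: measurable_rV_cons.
rewrite [RHS](@product_measure_unique _ _ _ _ _ _ _ (pushforward (@lebesgue_measure R \x lebesgue_rV R n)%E S))//.
move=> A1 A2 mA1 mA2.
transitivity ((@lebesgue_measure R \x lebesgue_rV R n)%E
  (((fun t : measurableTypeR R => t + c ord0 ord0 : measurableTypeR R) @^-1` A1) `*`
   ((fun x => x + rV_behead c) @^-1` A2))); first by [].
rewrite product_measure1E.
- by rewrite [X in (X * _)%E]lebesgue_measureD// [X in (_ * X)%E]IHn.
- by rewrite -[X in measurable X]setTI; apply: measurable_funD.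
- rewrite -[X in measurable X]setTI.
  by apply: measurable_continuous_rV => //; exact: continuous_shift_rV.
Qed.

Lemma integral_shift_rV N (c : 'rV[R]_N) (f : 'rV[R]_N -> \bar R) :
  measurable_fun setT f -> (forall x, 0 <= f x)%E ->
  (\int[lebesgue_rV R N]_x f (x + c)%R)%E = (\int[lebesgue_rV R N]_x f x)%E.
Proof.
move=> mf f0.
have mc : measurable_fun setT (fun x : 'rV[R]_N => x + c).
  by apply: measurable_continuous_rV; exact: continuous_shift_rV.
have := @ge0_integral_pushforward _ _ _ _ R _ mc (lebesgue_rV R N) setT f measurableT mf (fun x _ => f0 x).
rewrite preimage_setT => <-.
by apply: eq_measure_integral => A mA _; exact: lebesgue_rV_shift.
Qed.

Lemma Rintegral_shift_rV N (c : 'rV[R]_N) (f : 'rV[R]_N -> R) :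
  measurable_fun setT f ->
  \int[lebesgue_rV R N]_x f (x + c) = \int[lebesgue_rV R N]_x f x.
Proof.
move=> mf; congr fine; rewrite integralE [RHS]integralE.
have mF : measurable_fun setT (EFin \o f) by exact/measurable_EFinP.
rewrite -[X in _ = (X - _)%E](integral_shift_rV c)//; last exact: measurable_funepos.
rewrite -[X in _ = (_ - X)%E](integral_shift_rV c)//.
- by congr (_ - _)%E; apply: eq_integral => x _; rewrite ?funeposE ?funenegE.
- exact: measurable_funeneg.
Qed.

End translation.

(** * Locally integrable functions *)

Section local_integrability.
Context {R : realType} {N : nat}.
Local Notation mu := (lebesgue_rV R N).
Implicit Types (u f g phi : 'rV[R]_N -> R) (r : R).

Definition Lloc u := measurable_fun setT u /\
  forall r, mu.-integrable (cb r) (EFin \o u).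

Definition intg f := mu.-integrable setT (EFin \o f).

Lemma intg_le f g : measurable_fun setT f -> (forall x, `|f x| <= g x) ->
  intg g -> intg f.
Proof.
move=> mf fg; apply: le_integrable => //; first exact/measurable_EFinP.
by move=> x _; rewrite /= lee_fin (le_trans (fg x))// ler_norm.
Qed.

Lemma intgD f g : intg f -> intg g -> intg (fun x => f x + g x).
Proof.
by move=> If Ig; have := integrableD measurableT If Ig; apply: eq_integrable.
Qed.

Lemma intgZ c f : intg f -> intg (fun x => c * f x).
Proof.
by move=> If; have := integrableZl measurableT c If; apply: eq_integrable.
Qed.

Lemma intg_norm f : intg f -> intg (fun x => `|f x|).
Proof. exact: integrable_norm. Qed.

Lemma intg_cond D f : measurable D -> mu.-integrable D (EFin \o f) ->
  (forall x, ~ D x -> f x = 0) -> intg f.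
Proof.
move=> mD If f0; have /(integrable_mkcond _ mD) := If.
apply: eq_integrable => // x _; rewrite patchE /=; case: ifPn => // xD.
by rewrite f0// => /mem_set; exact/negP.
Qed.

Lemma continuous_supp_bounded phi r : continuous phi -> supp r phi ->
  exists2 C, 0 <= C & forall x, `|phi x| <= C.
Proof.
move=> cphi sphi.
have /compact_bounded[M [Mr H]] : compact (phi @` cb r).
  by apply: continuous_compact; [exact: continuous_subspaceT|exact: compact_cb].
exists (Num.max (M + 1) 0) => [|x]; first by rewrite le_max lexx orbT.
have [xr|xr] := leP `|x| r; last by rewrite (sphi _ xr) normr0 le_max lexx orbT.
by rewrite le_max (H (M + 1)) ?ltrDl//; exists x.
Qed.

Lemma Lloc_intgM u phi C r : Lloc u -> measurable_fun setT phi ->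
  (forall x, `|phi x| <= C) -> supp r phi -> intg (fun x => u x * phi x).
Proof.
move=> [mu_ Iu] mphi Cphi sphi.
apply: (@intg_cond (cb r)); first exact: measurable_cb; last first.
  by move=> x /negP; rewrite -ltNge => /sphi ->; rewrite mulr0.
apply: (@le_integrable _ _ _ mu _ (measurable_cb r) _ (fun x => C%:E * (EFin \o u) x)%E).
- by apply/measurable_EFinP; apply: measurable_funTS; exact: measurable_funM.
- move=> x _; rewrite /= lee_fin !normrM mulrC.
  by rewrite ler_wpM2r// (le_trans (Cphi x))// ler_norm.
- by apply: integrableZl; [exact: measurable_cb|exact: Iu].
Qed.

Lemma Lloc_intgM_cont u phi r : Lloc u -> continuous phi -> supp r phi ->
  intg (fun x => u x * phi x).
Proof.
move=> Lu cphi sphi; have [C _ HC] := continuous_supp_bounded cphi sphi.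
by apply: (Lloc_intgM Lu _ HC sphi); exact: continuous_measurable_rV.
Qed.

Lemma continuous_Lloc g : continuous g -> Lloc g.
Proof.
move=> cg; split; first exact: continuous_measurable_rV.
move=> r; apply: measurable_bounded_integrable => //.
- exact: measurable_cb.
- exact: cb_fin_measure.
- by apply: measurable_funTS; exact: continuous_measurable_rV.
- have /compact_bounded[M [Mr H]] : compact (g @` cb r).
    by apply: continuous_compact; [exact: continuous_subspaceT|exact: compact_cb].
  by exists M; split=> // M' MM' x xr; apply: H MM' _ _; exists x.
Qed.

Lemma Lloc_le f g : measurable_fun setT f -> (forall x, `|f x| <= g x) ->
  Lloc g -> Lloc f.
Proof.
move=> mf fg [mg Ig]; split=> // r.
apply: le_integrable (Ig r); first exact: measurable_cb.
  by apply/measurable_EFinP; exact: measurable_funTS.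
by move=> x _; rewrite /= lee_fin (le_trans (fg x))// ler_norm.
Qed.

Lemma LlocD f g : Lloc f -> Lloc g -> Lloc (fun x => f x + g x).
Proof.
move=> [mf If] [mg Ig]; split; first exact: measurable_funD.
move=> r; have := integrableD (measurable_cb r) (If r) (Ig r).
by apply: eq_integrable => //; exact: measurable_cb.
Qed.

Lemma LlocM f g : continuous g -> Lloc f -> Lloc (fun x => g x * f x).
Proof.
move=> cg [mf If]; have mg := continuous_measurable_rV cg.
split; first exact: measurable_funM.
move=> r; have /compact_bounded[M [Mr H]] : compact (g @` cb r).
  by apply: continuous_compact; [exact: continuous_subspaceT|exact: compact_cb].
apply: (@le_integrable _ _ _ mu _ (measurable_cb r) _ (fun x => (M + 1)%:E * (EFin \o f) x)%E).
- by apply/measurable_EFinP; apply: measurable_funTS; exact: measurable_funM.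
- move=> x xr; rewrite /= lee_fin !normrM ler_wpM2r//.
  rewrite (le_trans _ (ler_norm _))//; apply: H; first by rewrite ltrDl.
  by exists x.
- by apply: integrableZl; [exact: measurable_cb|exact: If].
Qed.

Lemma LlocZ c f : Lloc f -> Lloc (fun x => c * f x).
Proof. by move=> Lf; exact: (LlocM (@cst_continuous _ _ c) Lf). Qed.

Lemma Lloc_cst c : Lloc (fun=> c).
Proof. by apply: continuous_Lloc; exact: cst_continuous. Qed.

Lemma LlocN f : Lloc f -> Lloc (fun x => - f x).
Proof.
move=> Lf; rewrite (_ : (fun _ => _) = fun x => (fun=> -1) x * f x).
  by apply: LlocM => //; exact: cst_continuous.
by apply/funext => x; rewrite mulN1r.
Qed.

Lemma LlocB f g : Lloc f -> Lloc g -> Lloc (fun x => f x - g x).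
Proof. by move=> Lf Lg; apply: LlocD => //; exact: LlocN. Qed.

Lemma Lloc_norm f : Lloc f -> Lloc (fun x => `|f x|).
Proof.
move=> [mf If]; split; first exact: measurableT_comp.
by move=> r; apply: integrable_norm; exact: If.
Qed.

(** Heine-Cantor with only one of the two points confined to the cube, so that nearby translates may
    leave it. Compactness enters as a near-covering property, which makes the radius [d] uniform. *)
Lemma uniform_continuous_cb g (r e : R) : continuous g -> 0 < e ->
  exists2 d, 0 < d & forall x y, `|x| <= r -> `|y - x| < d -> `|g y - g x| < e.
Proof.
move=> cg e0.
have /compact_near_coveringP/(_ _ (0^'+)
    (fun d x => forall y, `|y - x| < d -> `|g y - g x| < e)) := @compact_cb R N r.
have H : forall x : 'rV[R]_N, cb r x ->
    \forall x' \near x & i \near (0 : R)^'+, forall y, `|y - x'| < i -> `|g y - g x'| < e.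
  move=> x _; have /cvgrPdist_lt/(_ (e / 2)) := cg x.
  rewrite divr_gt0// => /(_ isT)/nbhs_ballP[d /= d0 Hd].
  exists (ball x (d / 2), [set i | i < d / 2]) => /=.
    split; first by apply: nbhsx_ballx; rewrite divr_gt0.
    by apply: nbhs_right_lt; rewrite divr_gt0.
  move=> [x' i] /= [xx' id] y yx'.
  have D z : `|x - z| < d -> `|g x - g z| < e / 2.
    by move=> xz; apply: Hd; rewrite mx_norm_ball.
  have xx2 : `|x - x'| < d / 2 by move: xx'; rewrite mx_norm_ball.
  have h1 : `|g x - g x'| < e / 2.
    by apply: D; rewrite (lt_trans xx2)// gtr_pMr// invf_lt1 ?ltr1n.
  have h2 : `|g x - g y| < e / 2.
    apply: D; rewrite -(subrK x' x) -addrA (le_lt_trans (ler_normD _ _))//.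
    by rewrite (splitr d) ltrD// distrC (lt_trans yx').
  rewrite -(subrK (g x) (g y)) -addrA (le_lt_trans (ler_normD _ _))//.
  by rewrite (splitr e) ltrD// distrC.
move=> /(_ _ H) {}H.
near (0 : R)^'+ => d; exists d; first by near: d; exact: nbhs_right_gt.
by move=> x y xr; have : cb r `<=` (fun x => forall y, `|y - x| < d -> `|g y - g x| < e);
  [near: d|apply].
Unshelve. all: by end_near. Qed.

Lemma partial_supp f i r : supp r f -> supp r (partial i f).
Proof.
move=> sf x rx; apply: partialE.
have Z : is_derive x (delta_mx 0 i) (fun _ : 'rV[R]_N => 0 : R) 0 by exact: is_derive_cst.
apply: near_eq_is_derive Z.
have : open [set y : 'rV[R]_N | r < `|y|].
  apply: (@open_comp _ _ (fun x : 'rV[R]_N => `|x|) [set t | r < t]).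
    by move=> y _; exact: norm_continuous.
  exact: open_gt.
by rewrite openE => /(_ x rx); apply: filterS => y /= /sf ->.
Qed.

Lemma laplacian_supp f r : supp r f -> supp r (laplacian f).
Proof.
move=> sf x rx; rewrite /laplacian big1// => i _.
exact: (partial_supp i (partial_supp i sf)).
Qed.

Lemma Ck_laplacian k f : Ck k.+2 f -> Ck k (laplacian f).
Proof. by move=> Cf; apply: Ck_sum => i; do 2 apply: Ck_partial. Qed.

(** The derivative of the integrand is dominated by [|C| |u|] on the common cube containing all the
    supports. The parameter is a displacement in [is_derive_conv] and the scale of the kernel in
    [is_derive_conv_kern]. *)
Lemma diff_under_Rintegral u (k k' : R -> 'rV[R]_N -> R) (a b t r C : R) :
  Lloc u -> t \in `]a, b[ ->
  (forall s, s \in `]a, b[ -> continuous (k s)) ->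
  (forall s, s \in `]a, b[ -> supp r (k s)) ->
  (forall s, s \in `]a, b[ -> supp r (k' s)) ->
  (forall s y, s \in `]a, b[ -> `|k' s y| <= C) ->
  (forall s y, s \in `]a, b[ -> is_derive s 1 (k ^~ y) (k' s y)) ->
  is_derive t 1 (fun s => \int[mu]_y (u y * k s y)) (\int[mu]_y (u y * k' t y)).
Proof.
move=> Lu tab ck sk sk' Ck' dk.
have [mu_ Iu] := Lu.
pose F (s : R) y := u y * k s y.
have dF s y : s \in `]a, b[ -> is_derive s 1 (F ^~ y) (u y * k' s y).
  move=> sab; have := is_deriveZ (u y) (dk s y sab).
  by apply.
pose G y := `|u y| * (`|C| * \1_(cb r) y).
have IG : intg G.
  apply: (@Lloc_intgM (fun y => `|u y|) _ `|C| r); first exact: Lloc_norm.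
  - by apply: measurable_funM => //; apply: measurable_indic; exact: measurable_cb.
  - move=> x; rewrite normrM normr_id ler_piMr// indicE.
    by case: (_ \in _); rewrite ?normr1 ?normr0.
  - move=> x rx; rewrite indicE memNset ?mulr0//= => /le_lt_trans/(_ rx).
    by rewrite ltxx.
have IF s : `]a, b[%classic s -> mu.-integrable setT (EFin \o F s).
  by move=> sab; apply: (Lloc_intgM_cont Lu (ck _ sab) (sk _ sab)).
have d1 s y : `]a, b[%classic s -> setT y -> derivable (F ^~ y) s 1.
  by move=> sab _; have [] := dF s y sab.
have Gge y : 0 <= G y by rewrite !mulr_ge0.
have GF s y : `]a, b[%classic s -> setT y -> `|partial1of2 F s y| <= G y.
  move=> sab _; rewrite partial1of2E; have [_ ->] := dF s y sab.
  rewrite /G normrM ler_wpM2l// indicE.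
  have [yr|yr] := leP `|y| r.
    by rewrite mem_set// mulr1 (le_trans (Ck' _ _ sab))// ler_norm.
  by rewrite (sk' _ sab)// normr0 mulr_ge0.
have := @cvg_differentiation_under_integral R _ _ mu F setT measurableT t a b tab IF d1 G Gge IG GF.
have -> : \int[mu]_y (partial1of2 F t y) = \int[mu]_y (u y * k' t y).
  by apply: eq_Rintegral => y _; rewrite partial1of2E; have [_ ->] := dF t y tab.
move=> H; split.
  by apply/cvg_ex; eexists; under eq_fun do rewrite [_ *: 1]mulr1; exact: H.
by apply/cvg_lim => //; under eq_fun do rewrite [_ *: 1]mulr1; exact: H.
Qed.

End local_integrability.

(** * Convolution *)

Section convolution.
Context {R : realType} {N : nat}.
Local Notation mu := (lebesgue_rV R N).
Implicit Types (u f g phi psi : 'rV[R]_N -> R) (r : R) (x y : 'rV[R]_N).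

Definition L1 r u : R := \int[mu]_(x in cb r) `|u x|.

Lemma L1_ge0 r u : 0 <= L1 r u.
Proof. exact: Rintegral_ge0. Qed.

Lemma Rintegral_supp f r : supp r f ->
  \int[mu]_x f x = \int[mu]_(x in cb r) f x.
Proof.
move=> sf; rewrite [RHS]Rintegral_mkcond; apply: eq_Rintegral => x _.
rewrite patchE; case: ifPn => // /negP xr.
by apply: sf; rewrite ltNge; apply/negP => xr'; apply: xr; exact/mem_set.
Qed.

Lemma Lloc_integrable_cb u r : Lloc u -> mu.-integrable (cb r) (EFin \o u).
Proof. by case. Qed.

Lemma le_L1 u f r : Lloc u -> Lloc f -> (forall x, `|x| <= r -> `|u x| <= `|f x|) ->
  L1 r u <= L1 r f.
Proof.
move=> Lu Lf uf; apply: le_Rintegral; first exact: measurable_cb.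
- by apply: Lloc_integrable_cb; exact: Lloc_norm.
- by apply: Lloc_integrable_cb; exact: Lloc_norm.
- by move=> x /uf.
Qed.

Lemma L1D u f r : Lloc u -> Lloc f -> L1 r (fun x => u x + f x) <= L1 r u + L1 r f.
Proof.
move=> Lu Lf; rewrite /L1 -RintegralD; last 3 first.
- exact: measurable_cb.
- by apply: Lloc_integrable_cb; exact: Lloc_norm.
- by apply: Lloc_integrable_cb; exact: Lloc_norm.
apply: le_Rintegral; first exact: measurable_cb.
- by apply: Lloc_integrable_cb; apply: Lloc_norm; exact: LlocD.
- apply: (Lloc_integrable_cb (u := fun x => `|u x| + `|f x|)).
  by apply: LlocD; exact: Lloc_norm.
- by move=> x _; exact: ler_normD.
Qed.

Lemma L1_cst r c : L1 r (fun=> c) = `|c| * fine (mu (cb r)).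
Proof. by rewrite /L1 Rintegral_cst//; exact: measurable_cb. Qed.

Lemma Rintegral_mul_le u phi r c : Lloc u -> measurable_fun setT phi ->
  (forall x, `|phi x| <= c) -> supp r phi ->
  `|\int[mu]_x (u x * phi x)| <= c * L1 r u.
Proof.
move=> Lu mphi Hc sphi.
have I1 := Lloc_intgM Lu mphi Hc sphi.
apply: le_trans (le_normr_Rintegral measurableT I1) _.
rewrite (@Rintegral_supp _ r); last by move=> x rx; rewrite sphi// mulr0 normr0.
rewrite /L1 -RintegralZl; last 2 first.
- exact: measurable_cb.
- by apply: Lloc_integrable_cb; exact: Lloc_norm.
apply: le_Rintegral; first exact: measurable_cb.
- by apply: integrableS (intg_norm I1) => //; exact: measurable_cb.
- apply: (Lloc_integrable_cb (u := fun x => (fun=> c) x * `|u x|)).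
  by apply: LlocM; [exact: cst_continuous|exact: Lloc_norm].
- by move=> x _; rewrite normrM mulrC ler_wpM2r.
Qed.

(** A correlation: [psi] is evaluated at [y - x]. The kernels used are even, so this is the usual
    convolution for them; a derivative in [x] falls on [psi] with a minus sign, which disappears in
    the Laplacian. *)
Definition conv u psi x : R := \int[mu]_y (u y * psi (y - x)).

Lemma supp_shift psi r x : supp r psi -> supp (`|x| + r) (fun y => psi (y - x)).
Proof.
by move=> sp y ry; apply: sp; rewrite (lt_le_trans _ (lerB_dist _ _))// ltrBrDl.
Qed.

Lemma continuous_subl psi x : continuous psi -> continuous (fun y => psi (y - x)).
Proof.
by move=> cp; apply: (continuous_fcomp (f := fun y => y - x)) => //;
  exact: continuous_shift_rV.
Qed.

Lemma conv_intg u psi r x : Lloc u -> continuous psi -> supp r psi ->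
  intg (fun y => u y * psi (y - x)).
Proof.
move=> Lu cp sp; apply: (Lloc_intgM_cont Lu) (supp_shift sp).
exact: continuous_subl.
Qed.

Lemma continuous_rV_eps f :
  (forall x (e : R), 0 < e ->
    exists2 d, 0 < d & forall z, `|x - z| < d -> `|f x - f z| <= e) ->
  continuous f.
Proof.
move=> H x A /nbhs_ballP[e /= e0 eA].
have [|d d0 Hd] := H x (e / 2); first by rewrite divr_gt0.
apply/nbhs_ballP; exists d => //= z; rewrite mx_norm_ball => /Hd fxz.
apply: eA; apply: le_lt_trans fxz _.
by rewrite gtr_pMr// invf_lt1 ?ltr1n.
Qed.

(** The modulus of continuity of [psi] is multiplied by the [L^1] norm of [u] on a cube containing
    both translated supports. *)
Lemma continuous_conv u psi r : Lloc u -> continuous psi -> supp r psi ->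
  continuous (conv u psi).
Proof.
move=> Lu cp sp; apply: continuous_rV_eps => x e e0.
set M := L1 (`|x| + (`|r| + 1)) u.
have M0 : 0 < M + 1 by rewrite ltr_wpDl// L1_ge0.
have eM : 0 < e / (M + 1) by rewrite divr_gt0.
have [d d0 Hd] := uniform_continuous_cb (`|r| + 1) cp eM.
(* The cap at [1] keeps the supports of both translates inside the cube of radius [|x| + |r| + 1] on
   which [M] was computed. *)
have md0 : 0 < Num.min d 1 by rewrite lt_min d0 ltr01.
exists (Num.min d 1) => // z; rewrite lt_min => /andP[xzd xz1].
have sz : supp (`|x| + (`|r| + 1)) (fun y => psi (y - x) - psi (y - z)).
  move=> y ry.
  have ryx : `|r| + 1 < `|y - x| by rewrite (lt_le_trans _ (lerB_dist _ _))// ltrBrDl.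
  have ryz : `|r| < `|y - z|.
    have : `|y - x| <= `|y - z| + `|x - z|.
      by rewrite (distrC x) -{1}(subrK z y) -addrA ler_normD.
    move=> /(lt_le_trans ryx) H; rewrite -(ltrD2r 1) (lt_le_trans H)//.
    by rewrite lerD2l ltW.
  rewrite (sp (y - x)) ?(sp (y - z)) ?subrr//.
    by rewrite (le_lt_trans _ ryz)// ler_norm.
  by rewrite (le_lt_trans _ ryx)// (le_trans (ler_norm _))// lerDl.
have cz : continuous (fun y => psi (y - x) - psi (y - z)).
  move=> y; apply: (@continuousB _ _ _ (fun y => psi (y - x)) (fun y => psi (y - z)));
  exact: continuous_subl.
have Hc y : `|psi (y - x) - psi (y - z)| <= e / (M + 1).
  have [yr|yr] := leP `|y - x| (`|r| + 1).
    rewrite distrC ltW//; apply: Hd => //.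
    by rewrite opprB addrC addrA subrK.
  have [yr'|yr'] := leP `|y| (`|x| + (`|r| + 1)); last by rewrite sz// normr0 ltW.
  rewrite (sp (y - x)) ?(sp (y - z)) ?subrr ?normr0 ?(ltW eM)//.
    have : `|y - x| <= `|y - z| + `|x - z|.
      by rewrite (distrC x) -{1}(subrK z y) -addrA ler_normD.
    move=> /(lt_le_trans yr) H; rewrite (le_lt_trans (ler_norm _))//.
    by rewrite -(ltrD2r 1) (lt_le_trans H)// lerD2l ltW.
  by rewrite (le_lt_trans _ yr)// (le_trans (ler_norm _))// lerDl.
rewrite /conv -RintegralB; [|by []|exact: (conv_intg (r := r))..].
under eq_Rintegral do rewrite -mulrBr.
apply: le_trans (Rintegral_mul_le Lu (continuous_measurable_rV cz) Hc sz) _.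
by rewrite -/M mulrAC ler_pdivrMr// ler_pM2l// lerDl.
Qed.

Lemma is_derive_shift psi x v y d :
  is_derive (y - x) v psi d -> is_derive y v (fun y => psi (y - x)) d.
Proof.
move=> D; rewrite -[d]mul1r.
rewrite (_ : (fun _ => _) = (fun y => psi (1 *: y + - x))).
  by apply: is_derive_affine; rewrite scale1r.
by apply/funext => z; rewrite scale1r.
Qed.

Lemma is_derive_conv u psi r x i : Lloc u -> Ck 1 psi -> supp r psi ->
  is_derive x (delta_mx 0 i) (conv u psi) (- conv u (partial i psi) x).
Proof.
move=> Lu Cp sp; apply/is_derive_line.
pose e : 'rV[R]_N := delta_mx 0 i.
have e1 : `|e| <= 1.
  apply: norm_le_coord => // j; rewrite mxE eqxx /=.
  by case: (j == i); rewrite ?normr1 ?normr0.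
have sp' := partial_supp i sp.
have cp' : continuous (partial i psi) := Ck_partial i Cp.
have [C C0 HC] := continuous_supp_bounded cp' sp'.
have -> : - conv u (partial i psi) x =
    \int[mu]_y (u y * - partial i psi (y - (0 *: e + x))).
  rewrite /conv -mulN1r -RintegralZl//; last exact: (conv_intg (r := r)).
  by apply: eq_Rintegral => y _; rewrite scale0r add0r mulrN mulN1r.
(* Restricting [s] to []-1, 1[] keeps all the translated supports in one fixed cube, because [e] has
   norm at most [1]. *)
have suppS s f : supp r f -> s \in `]-1, 1[ ->
    supp (`|x| + 1 + r) (fun y => f (y - (s *: e + x))).
  move=> sf; rewrite in_itv /= => s1 y ry; apply: (supp_shift sf).
  apply: le_lt_trans ry; rewrite lerD2r (le_trans (ler_normD _ _))// addrC lerD2l.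
  rewrite normrZ -[1]mulr1 ler_pM//.
  by rewrite ltW// ltr_norml.
apply: (@diff_under_Rintegral R N u
  (fun s y => psi (y - (s *: e + x)))
  (fun s y => - partial i psi (y - (s *: e + x))) (-1) 1 0 (`|x| + 1 + r) C) => //.
- by rewrite in_itv /= ltrN10 ltr01.
- by move=> s _; apply: continuous_subl; exact: Ck_continuous Cp.
- by move=> s s1; exact: suppS.
- by move=> s s1 y ry; rewrite (suppS _ _ sp' s1 y ry) oppr0.
- by move=> s y _; rewrite normrN.
- move=> s y _.
  have D : is_derive (y - (s *: e + x)) e psi (partial i psi (y - (s *: e + x))).
    exact: Ck_is_derive Cp.
  have -> : (fun s : R => psi (y - (s *: e + x))) =
      (fun t : R => (fun q : R => psi (q *: e + (y - x))) (- t)).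
    by apply/funext => t; rewrite scaleNr opprD addrCA.
  rewrite -[- partial _ _ _]mulrN1.
  apply: (is_derive_chain (g := fun q : R => psi (q *: e + (y - x))) (f := -%R)).
  apply: (is_derive_along psi (y - x) e (- s) _).1.
  by rewrite scaleNr addrCA -opprD.
Qed.

Lemma Ck_conv k u psi r : Lloc u -> Ck k psi -> supp r psi -> Ck k (conv u psi).
Proof.
move=> Lu; elim: k psi => [|k IH] psi Cp sp; first exact: continuous_conv sp.
apply: CkS => [|i]; first exact: (continuous_conv Lu (Ck_continuous Cp) sp).
exists (fun x => - 1 * conv u (partial i psi) x).
  apply: Ck_mul; first exact: Ck_cst.
  by apply: IH; [exact: Ck_partial|exact: partial_supp].
move=> x; rewrite mulN1r; apply: (is_derive_conv x i Lu _ sp).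
by apply: (Ck_le _ Cp).
Qed.

Lemma partial_conv u psi r i x : Lloc u -> Ck 1 psi -> supp r psi ->
  partial i (conv u psi) x = - conv u (partial i psi) x.
Proof. by move=> Lu Cp sp; apply: partialE; exact: is_derive_conv sp. Qed.

Lemma RintegralZ_T c f : intg f -> \int[mu]_x (c * f x) = c * \int[mu]_x f x.
Proof. by move=> If; rewrite RintegralZl. Qed.

Lemma RintegralN_T f : intg f -> \int[mu]_x (- f x) = - \int[mu]_x f x.
Proof.
by move=> If; rewrite -mulN1r -RintegralZl//; apply: eq_Rintegral => x _; rewrite mulN1r.
Qed.

Lemma Rintegral_sum_T (I : Type) (s : seq I) (F : I -> 'rV[R]_N -> R) :
  (forall i, intg (F i)) ->
  intg (fun x => \sum_(i <- s) F i x) /\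
  \int[mu]_x (\sum_(i <- s) F i x) = \sum_(i <- s) \int[mu]_x F i x.
Proof.
move=> IF; elim: s => [|i s [I1 E1]].
  rewrite big_nil (_ : (fun x => _) = fun=> 0); last first.
    by apply/funext => x; rewrite big_nil.
  split; last by rewrite Rintegral_cst// mul0r.
  by apply: integrable0.
have -> : (fun x => \sum_(j <- i :: s) F j x) = fun x => F i x + \sum_(j <- s) F j x.
  by apply/funext => x; rewrite big_cons.
split; first exact: intgD.
by rewrite big_cons -E1 -RintegralD//; exact: IF.
Qed.

Lemma laplacian_conv u psi r x : Lloc u -> Ck 2 psi -> supp r psi ->
  laplacian (conv u psi) x = conv u (laplacian psi) x.
Proof.
move=> Lu Cp sp; rewrite /laplacian.
have C1 i : Ck 1 (partial i psi) := Ck_partial i Cp.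
have S1 i := partial_supp i sp.
have C2 i : continuous (partial i (partial i psi)) := Ck_partial i (C1 i).
have S2 i := partial_supp i (S1 i).
transitivity (\sum_(i < N) conv u (partial i (partial i psi)) x).
  apply: eq_bigr => i _.
  have -> : partial i (conv u psi) = fun x => -1 * conv u (partial i psi) x.
    by apply/funext => z; rewrite (partial_conv _ _ Lu (CkW Cp) sp) mulN1r.
  rewrite -[RHS]opprK -[RHS]mulN1r; apply: partialE.
  have D := is_derive_conv x i Lu (C1 i) (S1 i).
  by have := is_deriveZ (-1) D.
rewrite /conv -(Rintegral_sum_T _ _).2.
  by apply: eq_Rintegral => y _; rewrite mulr_sumr.
by move=> i; exact: conv_intg (S2 i).
Qed.

(** By translation invariance [conv 1 psi] is constant, and its partial derivative is minus the
    integral in question. This is integration by parts without Fubini. *)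
Lemma Rintegral_partial psi r i : Ck 1 psi -> supp r psi ->
  \int[mu]_x partial i psi x = 0.
Proof.
move=> Cp sp.
have L1' : Lloc (fun _ : 'rV[R]_N => 1 : R).
  by apply: continuous_Lloc; exact: cst_continuous.
have D := is_derive_conv 0 i L1' Cp sp.
have E : conv (fun=> 1) psi = fun=> \int[mu]_y psi y.
  apply/funext => x; rewrite /conv -[RHS](Rintegral_shift_rV (- x)).
    by apply: eq_Rintegral => y _; rewrite mul1r.
  by apply: continuous_measurable_rV; exact: Ck_continuous Cp.
have D0 : is_derive (0 : 'rV[R]_N) (delta_mx 0 i) (conv (fun=> 1) psi) 0.
  by rewrite E; exact: is_derive_cst.
have : - conv (fun=> 1) (partial i psi) 0 = 0.
  by case: D => _ <-; case: D0 => _ ->.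
move/eqP; rewrite oppr_eq0 => /eqP <-.
by apply: eq_Rintegral => y _; rewrite mul1r subr0.
Qed.

Lemma partial_shift psi i x y : Ck 1 psi ->
  partial i (fun y => psi (y - x)) y = partial i psi (y - x).
Proof.
by move=> Cp; apply: partialE; apply: is_derive_shift; exact: Ck_is_derive Cp.
Qed.

Lemma laplacian_shift psi x y : Ck 2 psi ->
  laplacian (fun y => psi (y - x)) y = laplacian psi (y - x).
Proof.
move=> Cp; apply: eq_bigr => i _.
rewrite (_ : partial i (fun y => psi (y - x)) = fun y => partial i psi (y - x)).
  exact: (partial_shift i x y (Ck_partial i Cp)).
by apply/funext => z; exact: (partial_shift i x z (CkW Cp)).
Qed.

Lemma Ck_shift k psi x : Ck k psi -> Ck k (fun y => psi (y - x)).
Proof.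
elim: k psi => [|k IH] psi Cp; first exact: continuous_subl.
apply: CkS => [|i]; first by apply: continuous_subl; exact: Ck_continuous Cp.
exists (fun y => partial i psi (y - x)); first by apply: IH; exact: Ck_partial.
by move=> y; apply: is_derive_shift; exact: Ck_is_derive Cp.
Qed.

Lemma test_shift psi x : test_function psi -> test_function (fun y => psi (y - x)).
Proof.
move=> tp; have [r r0 sp] := test_function_supp tp.
apply: smooth_test_function (supp_shift sp).
by move=> k; apply: Ck_shift; case: tp.
Qed.

(** The field [f grad phi - phi grad f] is supported in a cube and has divergence
    [f laplacian phi - phi laplacian f]; each term of the divergence integrates to [0]. *)
Lemma Rintegral_green f phi r : Ck 2 f -> Ck 2 phi -> supp r phi ->
  \int[mu]_x (f x * laplacian phi x) = \int[mu]_x (laplacian f x * phi x).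
Proof.
move=> Cf Cp sp.
pose F i x := f x * partial i phi x + -1 * phi x * partial i f x.
have CF i : Ck 1 (F i).
  apply: Ck_add; apply: Ck_mul; [exact: CkW|exact: Ck_partial| |exact: Ck_partial].
  by apply: Ck_mul; [exact: Ck_cst|exact: CkW].
have sF i : supp r (F i).
  by move=> x rx; rewrite /F (partial_supp i sp rx) (sp x rx) !(mulr0,mul0r) addr0.
have dF i x : partial i (F i) x = f x * partial i (partial i phi) x
     - partial i (partial i f) x * phi x.
  apply: partialE.
  have D1 := is_deriveM (Ck_is_derive x i (CkW Cf)) (Ck_is_derive x i (Ck_partial i Cp)).
  have D2 := is_deriveM (Ck_is_derive x i (CkW Cp)) (Ck_is_derive x i (Ck_partial i Cf)).
  have D3 := is_deriveB D1 D2.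
  have := D3; set a := (X in is_derive _ _ _ X -> _); set b := (X in _ -> is_derive _ _ _ X).
  have -> : a = b by rewrite /a /b /GRing.scale /=; ring.
  rewrite (_ : F i = f * partial i phi - phi * partial i f)//.
  by apply/funext => z; rewrite /F mulN1r mulNr.
have E : \int[mu]_x (\sum_(i < N) partial i (F i) x) = 0.
  rewrite (Rintegral_sum_T _ _).2.
    by rewrite big1// => i _; exact: Rintegral_partial (sF i).
  move=> i; rewrite (_ : partial i (F i) = fun x => 1 * partial i (F i) x).
    apply: (Lloc_intgM_cont (u := fun=> 1)) (partial_supp i (sF i)).
      by apply: continuous_Lloc; exact: cst_continuous.
    exact: (Ck_partial i (CF i)).
  by apply/funext => x; rewrite mul1r.
have I1 : intg (fun x => f x * laplacian phi x).
  apply: (Lloc_intgM_cont (continuous_Lloc (Ck_continuous Cf))) (laplacian_supp sp).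
  exact: (@Ck_laplacian _ _ 0).
have I2 : intg (fun x => laplacian f x * phi x).
  apply: (Lloc_intgM_cont _ (Ck_continuous Cp) sp).
  by apply: continuous_Lloc; exact: (@Ck_laplacian _ _ 0).
apply/eqP; rewrite -subr_eq0 -RintegralB//; apply/eqP; rewrite -[RHS]E.
apply: eq_Rintegral => x _; rewrite /laplacian mulr_sumr mulr_suml -sumrB.
by apply: eq_bigr => i _; rewrite dF.
Qed.

End convolution.

(** * Approximation in L^1 by continuous functions *)

Section density.
Context {R : realType} {N : nat}.
Local Notation mu := (lebesgue_rV R N).
Implicit Types (u f g : 'rV[R]_N -> R) (r : R) (x y : 'rV[R]_N).

(** The approximant may depend on the cube and on [e]. Hence the class is closed under local [L^1]
    limits, and it can be extended from open sets to Borel sets and then to simple functions. *)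
Definition approximable f := Lloc f /\ forall r (e : R), 0 < e ->
  exists2 g, continuous g & L1 r (fun x => f x - g x) <= e.

Lemma approximable_lim f :
  Lloc f ->
  (forall r (e : R), 0 < e -> exists2 f', approximable f' & L1 r (fun x => f x - f' x) <= e) ->
  approximable f.
Proof.
move=> Lf H; split=> // r e e0; have e2 : 0 < e / 2 by rewrite divr_gt0.
have [f' [Lf' /(_ r _ e2)[g cg Hg]] Hf'] := H r _ e2.
exists g => //.
rewrite (_ : (fun x => f x - g x) = fun x => (f x - f' x) + (f' x - g x)); last first.
  by apply/funext => x; rewrite addrA subrK.
have Lg := continuous_Lloc cg.
apply: le_trans (L1D r (LlocB Lf Lf') (LlocB Lf' Lg)) _.
by rewrite (splitr e) lerD.
Qed.

Lemma approximable_continuous g : continuous g -> approximable g.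
Proof.
move=> cg; split; first exact: continuous_Lloc.
move=> r e e0; exists g => //.
rewrite (_ : (fun x => g x - g x) = fun=> 0); last first.
  by apply/funext => x; rewrite subrr.
by rewrite L1_cst normr0 mul0r ltW.
Qed.

Lemma approximableD f1 f2 : approximable f1 -> approximable f2 ->
  approximable (fun x => f1 x + f2 x).
Proof.
move=> [L1' H1] [L2' H2]; split; first exact: LlocD.
move=> r e e0; have e2 : 0 < e / 2 by rewrite divr_gt0.
have [g1 c1 G1] := H1 r _ e2; have [g2 c2 G2] := H2 r _ e2.
exists (fun x => g1 x + g2 x); first exact: continuous_add.
rewrite (_ : (fun x => _) = fun x => (f1 x - g1 x) + (f2 x - g2 x)); last first.
  by apply/funext => x; rewrite opprD addrACA.
have Lg1 := continuous_Lloc c1; have Lg2 := continuous_Lloc c2.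
apply: le_trans (L1D r (LlocB L1' Lg1) (LlocB L2' Lg2)) _.
by rewrite (splitr e) lerD.
Qed.

Lemma L1Z r c f : Lloc f -> L1 r (fun x => c * f x) = `|c| * L1 r f.
Proof.
move=> Lf; rewrite /L1 -RintegralZl; last 2 first.
- exact: measurable_cb.
- by apply: Lloc_integrable_cb; exact: Lloc_norm.
by apply: eq_Rintegral => x _; rewrite normrM.
Qed.

Lemma approximableZ c f : approximable f -> approximable (fun x => c * f x).
Proof.
move=> [Lf H]; split; first by apply: LlocM => //; exact: cst_continuous.
move=> r e e0.
have c1 : 0 < `|c| + 1 by rewrite ltr_wpDl.
have [|g cg G] := H r (e / (`|c| + 1)); first by rewrite divr_gt0.
exists (fun x => c * g x); first by apply: continuous_mul => //; exact: cst_continuous.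
rewrite (_ : (fun x => _) = fun x => c * (f x - g x)); last first.
  by apply/funext => x; rewrite mulrBr.
rewrite L1Z; last by apply: LlocB => //; exact: continuous_Lloc.
apply: (@le_trans _ _ ((`|c| + 1) * (e / (`|c| + 1)))).
  by rewrite ler_pM ?L1_ge0// lerDl.
by rewrite mulrC divfK// gt_eqF.
Qed.

Lemma approximable_sum (I : Type) (s : seq I) (F : I -> 'rV[R]_N -> R) :
  (forall i, approximable (F i)) -> approximable (fun x => \sum_(i <- s) F i x).
Proof.
move=> H; elim: s => [|i s IH].
  rewrite (_ : (fun _ => _) = fun=> 0); last by apply/funext => x; rewrite big_nil.
  by apply: approximable_continuous; exact: cst_continuous.
rewrite (_ : (fun _ => _) = fun x => F i x + \sum_(j <- s) F j x).
  exact: approximableD.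
by apply/funext => x; rewrite big_cons.
Qed.

Lemma Lloc_bounded f c : measurable_fun setT f -> (forall x, `|f x| <= c) -> Lloc f.
Proof.
move=> mf fc; apply: Lloc_le mf fc _.
by apply: continuous_Lloc; exact: cst_continuous.
Qed.

Lemma L1_eventually f (f_ : nat -> 'rV[R]_N -> R) r e :
  measurable_fun setT f -> (forall n, measurable_fun setT (f_ n)) ->
  (forall n x, `|f_ n x| <= 1) ->
  (forall x, exists m, forall n, (m <= n)%N -> f_ n x = f x) ->
  0 < e -> exists n, L1 r (fun x => f x - f_ n x) <= e.
Proof.
move=> mf mf_ f1 ff e0.
have f1' x : `|f x| <= 1 by have [m /(_ m (leqnn m)) <-] := ff x.
have [|||||_ + _] := @dominated_convergence _ _ _ mu (cb r) (measurable_cb r)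
  (fun n => EFin \o f_ n) (EFin \o f) (EFin \o cst 1).
- by move=> n; apply/measurable_EFinP; exact: measurable_funTS.
- by apply/measurable_EFinP; exact: measurable_funTS.
- apply: aeW => x _; apply: cvg_near_cst.
  by have [m Hm] := ff x; exists m => // n /= mn; rewrite Hm.
- apply: Lloc_integrable_cb; apply: continuous_Lloc; exact: cst_continuous.
- by apply: aeW => x n _; rewrite lee_fin.
move=> /fine_cvgP[_] /cvgrPdist_le/(_ _ e0)[m _ /(_ m (leqnn m))] /= H.
exists m; apply: le_trans H; rewrite sub0r normrN (le_trans _ (ler_norm _))//.
rewrite /L1 /Rintegral.
by under eq_integral do rewrite distrC.
Qed.

(** The indicator is the limit of [min(1, n dist(x, ~U))]. The case [U = setT] is separated because
    the distance to an empty set is meaningless. *)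
Lemma approximable_open (U : set 'rV[R]_N) : open U -> approximable \1_U.
Proof.
move=> oU.
have LU : Lloc (\1_U : 'rV[R]_N -> R).
  apply: (@Lloc_bounded _ 1).
    by apply: measurable_indic; exact: open_measurable_rV.
  by move=> x; rewrite indicE; case: (_ \in _); rewrite ?normr1 ?normr0.
have [[y0 Uy0]|H] := pselect (exists y, ~ U y); last first.
  have -> : U = setT.
    by apply/seteqP; split=> // x _; apply: contrapT => Ux; apply: H; exists x.
  by rewrite indicT; apply: approximable_continuous; exact: cst_continuous.
pose S x := [set `|x - y| | y in ~` U].
pose D x := inf (S x).
have S0 x : S x !=set0 by exists `|x - y0|, y0.
have lS x : has_lbound (S x) by exists 0 => _ [y _ <-].
have D0 x : 0 <= D x by apply: lb_le_inf => // _ [y _ <-].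
have Dtri x z : D x <= `|x - z| + D z.
  rewrite -lerBlDl; apply: lb_le_inf => // _ [y Uy <-].
  rewrite lerBlDl; apply: (@le_trans _ _ `|x - y|).
    by apply: ge_inf => //; exists y.
  by rewrite -{1}(subrK z x) -addrA ler_normD.
have cD : continuous D.
  apply: continuous_rV_eps => x e e0; exists e => // z xz.
  rewrite ler_distl; apply/andP; split.
    by rewrite lerBlDr (le_trans (Dtri z x))// addrC lerD2l distrC ltW.
  by rewrite (le_trans (Dtri x z))// addrC lerD2l ltW.
have DU x : U x -> 0 < D x.
  move=> Ux; move: oU; rewrite openE => /(_ _ Ux) /nbhs_ballP[e /= e0 eU].
  apply: (lt_le_trans e0); apply: lb_le_inf => // _ [y Uy <-].
  rewrite leNgt; apply/negP => xy; apply: Uy; apply: eU.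
  by rewrite mx_norm_ball.
have DN x : ~ U x -> D x = 0.
  move=> Ux; apply/eqP; rewrite eq_le D0 andbT -[X in _ <= X](normr0 'rV[R]_N).
  by apply: ge_inf => //; exists x => //; rewrite subrr.
pose f_ n x := Num.min 1 (n%:R * D x).
have cf n : continuous (f_ n).
  move=> x; apply: (@continuous_min _ _ (fun=> 1) (fun x => n%:R * D x)).
    exact: cst_continuous.
  by apply: continuous_mul => //; exact: cst_continuous.
have f0 n x : 0 <= f_ n x by rewrite le_min ler01 mulr_ge0.
apply: approximable_lim => // r e e0.
have [|||||n Hn] := @L1_eventually \1_U f_ r e.
- by apply: measurable_indic; exact: open_measurable_rV.
- by move=> n; exact: continuous_measurable_rV.
- by move=> n x; rewrite ger0_norm// ge_min lexx.
- move=> x; have [Ux|Ux] := pselect (U x); last first.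
    by exists 0%N => n _; rewrite /f_ DN// mulr0 indicE memNset// min_r.
  (* As soon as [n >= 1 / D x] the approximant is exactly [1] at [x]. *)
  exists (Num.truncn (D x)^-1).+1 => n mn; rewrite indicE mem_set//=.
  rewrite /f_ min_l// -ler_pdivrMr ?DU// mul1r.
  by rewrite (le_trans (ltW (truncnS_gt _)))// ler_nat.
- by [].
by exists (f_ n) => //; exact: approximable_continuous.
Qed.

(** Dynkin's pi-lambda theorem: open sets are stable under intersection and generate the Borel sets.
    For a disjoint union, the partial sums of indicators are eventually constant at each point. *)
Lemma approximable_indic (A : set 'rV[R]_N) : measurable A -> approximable \1_A.
Proof.
have indic1 (B : set 'rV[R]_N) x : `|\1_B x| <= 1 :> R.
  by rewrite indicE; case: (_ \in _); rewrite ?normr1 ?normr0.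
move=> mA.
apply: (@dynkin_induction _ 'rV[R]_N (@open 'rV[R]_N) (fun A => approximable \1_A)) => //.
- exact: openI.
- rewrite indicT; apply: approximable_continuous; exact: cst_continuous.
- exact: approximable_open.
- move=> S mS /(approximableZ (-1)).
  have c1 : approximable (fun=> 1 : R) by apply: approximable_continuous; exact: cst_continuous.
  move=> /(approximableD c1); congr approximable; apply/funext => x.
  by rewrite !indicE in_setC; case: (_ \in _) => /=; rewrite ?mulr1 ?mulr0 ?subrr ?addr0.
- move=> F mF tF HF; apply: approximable_lim.
    by apply: (@Lloc_bounded _ 1) => //; apply: measurable_indic; exact: bigcup_measurable.
  move=> r e e0.
  pose f_ n x : R := \sum_(i < n) \1_(F i) x.
  have Ef n x : f_ n x = \1_(\bigcup_(i < n) F i) x.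
    rewrite /f_; have [[i /= ni Fix]|H] := pselect ((\bigcup_(i < n) F i) x).
      rewrite [RHS]indicE mem_set; last by exists i.
      rewrite (bigD1 (Ordinal ni))//= indicE mem_set// big1 ?addr0// => j ji.
      rewrite indicE memNset// => Fjx.
      have := tF i j I I (ex_intro _ x (conj Fix Fjx)) => ij.
      by move/eqP: ji; apply; apply/val_inj.
    rewrite [RHS]indicE memNset// big1// => i _; rewrite indicE memNset// => Fix.
    by apply: H; exists i => //=.
  have [|||||n Hn] := @L1_eventually (\1_(\bigcup_k F k)) f_ r e.
  - by apply: measurable_indic; exact: bigcup_measurable.
  - by move=> n; apply: measurable_sum => i; exact: measurable_indic.
  - by move=> n x; rewrite Ef.
  - move=> x; have [[i _ Fix]|H] := pselect ((\bigcup_k F k) x).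
      exists i.+1 => n ni; rewrite Ef !indicE !mem_set//; first by exists i.
      by exists i.
    exists 0%N => n _; rewrite Ef !indicE !memNset//; apply: contra_not H.
    by move=> [i _ Fix]; exists i.
  - by [].
  by exists (f_ n) => //; apply: approximable_sum.
Qed.

Import HBSimple.

Lemma approximable_Lloc u : Lloc u -> approximable u.
Proof.
move=> Lu; apply: approximable_lim => // r e e0.
have [g_ [Ig _ Hg]] := @approximation_sfun_integrable _ _ _ mu (cb r) (measurable_cb r)
  _ (Lloc_integrable_cb r Lu).
move: Hg => /fine_cvgP[_] /cvgrPdist_le/(_ _ e0)[m _ /(_ m (leqnn m))] /= H.
exists (g_ m).
  rewrite (funext (fimfunEord (g_ m))); apply: approximable_sum => i.
  by apply: approximableZ; apply: approximable_indic.
by apply: le_trans H; rewrite sub0r normrN (le_trans _ (ler_norm _)).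
Qed.

End density.

(** * Mollification *)

Section mollifier.
Context {R : realType} {N : nat}.
Local Notation mu := (lebesgue_rV R N).
Implicit Types (u f g : 'rV[R]_N -> R) (r e : R) (x y z : 'rV[R]_N).

(* With the profile [flatD 1] = (exp (-1/t))', the function [rbump 1 e x] has a
   Laplacian which is a linear combination of [kern e] and of its derivative
   with respect to [e]; see [is_derive_conv_kern]. *)
Definition kern e : 'rV[R]_N -> R := rbump (flatD 1) e 0.

Lemma kernE e x y : kern e (y - x) = rbump (flatD 1) e x y.
Proof. by rewrite /kern /rbump subr0. Qed.

Lemma flat1_ge0 (t : R) : 0 <= flat (flatD 1) t :> R.
Proof.
rewrite /flat; case: ifP => // t0.
by rewrite /flatD derivC subr0 mulr1 hornerXn mulr_ge0 ?expR_ge0// sqr_ge0.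
Qed.

(** The function is [t^-2 exp(-1/t)]; on [[1/2, 1]] the first factor is at least [1] and [1/t] is at
    most [2]. *)
Lemma flat1_ge (t : R) : 2^-1 <= t <= 1 -> expR (- 2) <= flat (flatD 1) t.
Proof.
move=> /andP[t1 t2]; have t0 : 0 < t by rewrite (lt_le_trans _ t1)// invr_gt0.
rewrite /flat t0 /flatD derivC subr0 mulr1 hornerXn -[leLHS]mul1r ler_pM//.
- by rewrite exprn_ege1// invf_ge1.
- by rewrite ler_expR lerN2 -[2]invrK lef_pV2// posrE.
Qed.

Lemma kern_ge0 e z : 0 <= kern e z.
Proof. exact: flat1_ge0. Qed.

Lemma smooth_kern e : smooth (kern e).
Proof. exact: smooth_bump. Qed.

Lemma kern_out e z : 0 < e -> e <= `|z| -> kern e z = 0.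
Proof. by move=> e0 ez; apply: bump_out => //; rewrite subr0. Qed.

Lemma supp_kern e : 0 < e -> supp e (kern e).
Proof. by move=> e0 z ez; apply: kern_out => //; exact: ltW. Qed.

Lemma kernN e z : kern e (- z) = kern e z.
Proof. by rewrite /kern /rbump !subr0 nsqN. Qed.

Lemma kern_out_nsq e z : 0 < e -> e ^+ 2 <= nsq z -> kern e z = 0.
Proof.
move=> e0 H; rewrite /kern /rbump /flat subr0 ltNge subr_le0 ler_pdivlMr ?exprn_gt0//.
by rewrite mul1r H.
Qed.

Lemma kern_ge e z : 0 < e -> nsq z <= e ^+ 2 / 2 -> expR (- 2) <= kern e z.
Proof.
move=> e0 H; apply: flat1_ge; rewrite subr0.
have -> : 1 - nsq z / e ^+ 2 <= 1 by rewrite gerBl divr_ge0 ?nsq_ge0// sqr_ge0.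
rewrite andbT lerBrDl -lerBrDr ler_pdivrMr ?exprn_gt0//.
by rewrite (le_trans H)//; lra.
Qed.

(** The bound is uniform in the scale because the argument [1 - nsq z / e^2] never exceeds [1]. *)
Lemma kern_le : exists2 C : R, 0 < C & forall e z, kern e z <= C.
Proof.
have [C C0 HC] := flat_norm_le (R := R) (flatD 1).
exists (C + 1) => [|e z]; first by rewrite ltr_wpDl.
rewrite /kern /rbump; set t := 1 - _.
have [t0|t0] := leP t 0.
  by rewrite /flat ltNge t0 addr_ge0.
rewrite (le_trans (ler_norm _))// (le_trans (HC t))// ltW// ltr_pwDr//.
rewrite ler_piMr// ger0_norm ?(ltW t0)//.
by rewrite /t gerBl divr_ge0 ?nsq_ge0// sqr_ge0.
Qed.

Definition mass e : R := \int[mu]_z kern e z.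

Lemma intg_kern e : 0 < e -> intg (kern e).
Proof.
move=> e0; rewrite (_ : kern e = fun z => (fun=> 1) z * kern e z).
  apply: (Lloc_intgM_cont _ _ (supp_kern e0)).
    by apply: continuous_Lloc; exact: cst_continuous.
  exact: Ck_continuous (smooth_kern e 0).
by apply/funext => z; rewrite mul1r.
Qed.

Lemma cb_measure_gt0 (d : R) : 0 < d -> (0 < mu (cb d))%E.
Proof.
move=> d0.
pose a : 'rV[R]_N := const_mx (- d); pose b : 'rV[R]_N := const_mx d.
have ab i : a ord0 i <= b ord0 i by rewrite !mxE ge0_cp// ltW.
have -> : cb d = [set x : 'rV[R]_N | forall i, x ord0 i \in `[a ord0 i, b ord0 i]].
  apply/seteqP; split=> x /= H.
    by move=> i; rewrite !mxE in_itv /= -ler_norml (le_trans (coord_le_norm _ _)).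
  apply: norm_le_coord; first exact: ltW.
  by move=> j; have := H j; rewrite !mxE in_itv /= -ler_norml.
rewrite lebesgue_rV_box// lte_fin; apply: prodr_gt0 => i _.
by rewrite !mxE opprK addr_gt0.
Qed.

Lemma mass_gt0 e : 0 < e -> 0 < mass e.
Proof.
move=> e0.
have N0 : 0 < N%:R + 1 :> R by rewrite ltr_wpDl.
(* Small enough that the cube of radius [d] lies in the Euclidean ball of squared radius [e^2 / 2],
   where [kern_ge] applies: as [d <= 1], [N d^2 <= (N + 1) d]. *)
pose d := Num.min 1 (e ^+ 2 / 2 / (N%:R + 1)).
have d0 : 0 < d by rewrite lt_min ltr01 divr_gt0// divr_gt0// exprn_gt0.
have d2 z : `|z| <= d -> nsq z <= e ^+ 2 / 2.
  move=> zd; apply: le_trans (nsq_le_norm_sqr z) _.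
  apply: (@le_trans _ _ ((N%:R + 1) * d)); last first.
    by rewrite mulrC -ler_pdivlMr// /d ge_min lexx orbT.
  rewrite ler_pM// ?sqr_ge0 ?lerDl//.
  apply: (@le_trans _ _ (`|z| ^+ 1)).
    by rewrite ler_wiXn2l// (le_trans zd)// /d ge_min lexx.
  by rewrite expr1.
have cd_gt0 : 0 < fine (mu (cb d)).
  rewrite fine_gt0// cb_measure_gt0//=; exact: cb_fin_measure.
apply: (@lt_le_trans _ _ (expR (-2) * fine (mu (cb d)))).
  by rewrite mulr_gt0// expR_gt0.
rewrite -Rintegral_cst; last exact: measurable_cb.
apply: (@le_trans _ _ (\int[mu]_(z in cb d) kern e z)).
  apply: le_Rintegral; first exact: measurable_cb.
  - by apply: (Lloc_integrable_cb (u := cst _)); apply: continuous_Lloc; exact: cst_continuous.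
  - by apply: integrableS (intg_kern e0) => //; exact: measurable_cb.
  - by move=> z zd; apply: kern_ge => //; exact: d2.
rewrite Rintegral_mkcond; apply: le_Rintegral => //.
- apply: (intg_le _ _ (intg_kern e0)).
    apply: (measurable_restrictT _ (@measurable_cb R N d)).1.
    by apply: measurable_funTS; apply: continuous_measurable_rV; exact: Ck_continuous (smooth_kern e 0).
  by move=> z; rewrite patchE; case: ifP; rewrite ?normr0 ?kern_ge0// ger0_norm ?kern_ge0.
- exact: intg_kern.
- by move=> z _; rewrite patchE; case: ifP; rewrite ?kern_ge0.
Qed.

Definition moll e z : R := kern e z / mass e.

Lemma moll_ge0 e z : 0 < e -> 0 <= moll e z.
Proof. by move=> e0; rewrite divr_ge0 ?kern_ge0 ?(ltW (mass_gt0 e0)). Qed.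

Lemma smooth_moll e : smooth (moll e).
Proof. by move=> k; apply: Ck_mul; [exact: smooth_kern|exact: Ck_cst]. Qed.

Lemma continuous_moll e : continuous (moll e).
Proof. exact: Ck_continuous (smooth_moll e 0). Qed.

Lemma supp_moll e : 0 < e -> supp e (moll e).
Proof. by move=> e0 z ez; rewrite /moll supp_kern// mul0r. Qed.

Lemma mollN e z : moll e (- z) = moll e z.
Proof. by rewrite /moll kernN. Qed.

Lemma moll1 e : 0 < e -> \int[mu]_z moll e z = 1.
Proof.
move=> e0; rewrite RintegralZr//; last exact: intg_kern.
by rewrite -/(mass e) divff// gt_eqF// mass_gt0.
Qed.

Lemma moll_shift1 e x : 0 < e -> \int[mu]_y moll e (y - x) = 1.
Proof.
move=> e0; rewrite (Rintegral_shift_rV (- x)) ?moll1//.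
by apply: continuous_measurable_rV; exact: continuous_moll.
Qed.

Lemma test_moll_shift e x : 0 < e -> test_function (fun y => moll e (y - x)).
Proof.
move=> e0; apply: test_shift; apply: smooth_test_function (supp_moll e0).
exact: smooth_moll.
Qed.

Definition mollify e u := conv u (moll e).

Lemma Ck_mollify k e u : 0 < e -> Lloc u -> Ck k (mollify e u).
Proof.
by move=> e0 Lu; apply: (Ck_conv Lu _ (supp_moll e0)); exact: smooth_moll.
Qed.

Lemma Lloc_mollify e u : 0 < e -> Lloc u -> Lloc (mollify e u).
Proof.
by move=> e0 Lu; apply: continuous_Lloc; exact: Ck_continuous (Ck_mollify 0 e0 Lu).
Qed.

Lemma moll_intg e u x : 0 < e -> Lloc u -> intg (fun y => u y * moll e (y - x)).
Proof.
by move=> e0 Lu; apply: (conv_intg x Lu _ (supp_moll e0)); exact: continuous_moll.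
Qed.

Lemma mollifyB e u f : 0 < e -> Lloc u -> Lloc f ->
  mollify e (fun x => u x - f x) = fun x => mollify e u x - mollify e f x.
Proof.
move=> e0 Lu Lf; apply/funext => x; rewrite /mollify /conv -RintegralB//.
- by apply: eq_Rintegral => y _; rewrite mulrBl.
- exact: moll_intg.
- exact: moll_intg.
Qed.

Lemma mollify_sub e u x c : 0 < e -> Lloc u ->
  mollify e u x - c = \int[mu]_y ((u y - c) * moll e (y - x)).
Proof.
move=> e0 Lu.
have Ic : intg (fun y => c * moll e (y - x)).
  apply: (@moll_intg e (fun=> c)) => //.
  by apply: continuous_Lloc; exact: cst_continuous.
have -> : c = \int[mu]_y (c * moll e (y - x)).
  rewrite RintegralZl// ?moll_shift1 ?mulr1//.
  rewrite (_ : (fun y => _) = fun y => (fun=> 1) y * moll e (y - x)).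
    by apply: (@moll_intg e) => //; apply: continuous_Lloc; exact: cst_continuous.
  by apply/funext => y; rewrite mul1r.
rewrite /mollify /conv -RintegralB//; last exact: moll_intg.
apply: eq_Rintegral => y _; rewrite mulrBl RintegralZl ?moll_shift1 ?mulr1//.
rewrite (_ : (_ \o _) = EFin \o (fun y => (fun=> 1) y * moll e (y - x))).
  by apply: (@moll_intg e) => //; apply: continuous_Lloc; exact: cst_continuous.
by apply/funext => z /=; rewrite mul1r.
Qed.

(** Pairs carry the product sigma-algebra, so continuity of the subtraction does not conclude
    directly; it is rebuilt coordinate by coordinate. This makes the integrand of Tonelli's theorem
    measurable below. *)
Lemma measurable_rV_sub M :
  measurable_fun setT (fun p : 'rV[R]_M * 'rV[R]_M => p.2 - p.1).
Proof.
elim: M => [|n IH].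
  rewrite (_ : (fun _ => _) = fun=> 0); first exact: measurable_cst.
  by apply/funext => p; apply/rowP => -[].
pose hd (v : 'rV[R]_n.+1) : measurableTypeR R := v ord0 ord0.
have mhd : measurable_fun setT hd by exact: measurable_coord_rV.
rewrite (_ : (fun _ => _) = (@rV_cons R n) \o (fun p : 'rV[R]_n.+1 * 'rV[R]_n.+1 =>
  (hd p.2 - hd p.1 : measurableTypeR R, rV_behead p.2 - rV_behead p.1))); last first.
  apply/funext => p; apply/rowP => i; rewrite [LHS]mxE /=.
  case: (unliftP ord0 i) => [k|] ->; rewrite ?rV_cons_ord0 ?rV_cons_lift//= !mxE//.
apply: measurableT_comp; first exact: measurable_rV_cons.
apply: measurable_fun_pair.
  apply: measurable_funB.
    exact: (measurableT_comp mhd measurable_snd).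
  exact: (measurableT_comp mhd measurable_fst).
have mg : measurable_fun setT (fun p : 'rV[R]_n.+1 * 'rV[R]_n.+1 =>
    (rV_behead p.1, rV_behead p.2)).
  apply: measurable_fun_pair.
    exact: (measurableT_comp (@measurable_rV_behead R n) measurable_fst).
  exact: (measurableT_comp (@measurable_rV_behead R n) measurable_snd).
exact: (measurableT_comp IH mg).
Qed.

Lemma L1E r u : Lloc u ->
  (L1 r u)%:E = (\int[mu]_(x in cb r) `|u x|%:E)%E.
Proof.
move=> Lu; rewrite /L1 /Rintegral fineK//; apply: integrable_fin_num.
  exact: measurable_cb.
exact: (Lloc_integrable_cb r (Lloc_norm Lu)).
Qed.

(** By Tonelli, the value [|u y|] is spread with total weight [1] over points within [e] of [y], so
    only the [y] in the cube of radius [r + e] contribute. *)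
Lemma mollify_contraction e u r : 0 < e -> Lloc u ->
  L1 r (mollify e u) <= L1 (r + e) u.
Proof.
move=> e0 Lu; have [mu_u _] := Lu; have m0 := moll_ge0 _ e0.
have mm : measurable_fun setT (moll e).
  by apply: continuous_measurable_rV; exact: continuous_moll.
rewrite -lee_fin !L1E//; last exact: Lloc_mollify.
pose F (p : 'rV[R]_N * 'rV[R]_N) : \bar R :=
  (\1_(cb r) p.1 * `|u p.2| * moll e (p.2 - p.1))%:E.
have mF : measurable_fun setT F.
  apply/measurable_EFinP; apply: measurable_funM.
    apply: measurable_funM.
      apply: (measurableT_comp _ measurable_fst).
      by apply: measurable_indic; exact: measurable_cb.
    apply: (measurableT_comp (f := fun x => `|u x|) _ measurable_snd).
    exact: measurableT_comp.
  exact: (measurableT_comp mm (@measurable_rV_sub N)).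
have F0 p : (0 <= F p)%E by rewrite lee_fin mulr_ge0// mulr_ge0// indicE.
apply: (@le_trans _ _ (\int[mu]_x \int[mu]_y F (x, y))%E).
  rewrite [leLHS]integral_mkcond; apply: ge0_le_integral => //.
  - by move=> x _; rewrite patchE; case: ifP.
  - apply: (measurable_restrictT _ (@measurable_cb R N r)).1.
    apply: measurable_funTS; apply/measurable_EFinP.
    by have [+ _] := Lloc_norm (Lloc_mollify e0 Lu).
  - exact: (@measurable_fun_fubini_tonelli_F _ _ _ _ _ mu _ mF F0).
  - move=> x _; rewrite patchE; case: ifPn => xr; last exact: integral_ge0.
    rewrite /mollify /conv EFin_normr_Rintegral//; last exact: moll_intg.
    have /integrableP[mI _] := moll_intg x e0 Lu.
    apply: le_trans (le_abse_integral _ _ mI) _ => //.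
    rewrite le_eqVlt; apply/orP; left; apply/eqP; apply: eq_integral => y _.
    by rewrite /F /= indicE xr mul1r normrM (ger0_norm (m0 _)).
rewrite (@fubini_tonelli _ _ _ _ _ mu mu _ mF F0) [leRHS]integral_mkcond; apply: ge0_le_integral => //.
- by move=> y _; apply: integral_ge0.
- exact: (@measurable_fun_fubini_tonelli_G _ _ _ _ _ mu _ mF F0).
- apply: (measurable_restrictT _ (@measurable_cb R N (r + e))).1.
  apply: measurable_funTS; apply/measurable_EFinP.
  by have [+ _] := Lloc_norm Lu.
move=> y _; rewrite /fubini_G patchE; case: ifPn => yr; last first.
  rewrite integral0_eq// => x _; rewrite /F /=.
  rewrite indicE; case: (boolP (x \in cb r)) => xr; last by rewrite !mul0r.
  rewrite supp_moll ?mulr0//.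
  have : ~ (`|y| <= r + e) by move=> H; move/negP: yr; apply; exact/mem_set.
  move=> /negP; rewrite -ltNge => ryx.
  rewrite (lt_le_trans _ (lerB_dist _ _))// ltrBrDr addrC.
  by rewrite (le_lt_trans _ ryx)// lerD2r; move/set_mem: xr.
apply: (@le_trans _ _ (\int[mu]_x (`|u y| * moll e (y - x))%:E)%E).
  apply: ge0_le_integral => //.
  - by apply: (measurableT_comp mF); exact: measurable_pair2.
  - apply/measurable_EFinP; apply: measurable_funM => //.
    rewrite (_ : (fun x => _) = fun x => moll e (x - y)).
      by apply: continuous_measurable_rV; apply: continuous_subl; exact: continuous_moll.
    by apply/funext => x; rewrite -mollN opprB.
  - move=> x _; have H : \1_(cb r) x <= 1 :> R by rewrite indicE; case: (_ \in _).
    by rewrite lee_fin ler_wpM2r// ler_piMl.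
have Im : intg (fun x => moll e (x - y)).
  rewrite (_ : (fun x => _) = fun x => (fun=> 1) x * moll e (x - y)).
    by apply: (@moll_intg e) => //; apply: continuous_Lloc; exact: cst_continuous.
  by apply/funext => x; rewrite mul1r.
have -> : (fun x => (`|u y| * moll e (y - x))%:E) =
    EFin \o (fun x => `|u y| * moll e (x - y)).
  by apply/funext => x /=; rewrite -[y - x]opprB mollN.
have I2 := intgZ `|u y| Im.
rewrite -[leLHS]fineK; last exact: integrable_fin_num.
rewrite -[fine _]/(Rintegral _ _ _) RintegralZl// moll_shift1// mulr1.
by [].
Qed.

Lemma L1_mollify_continuous g r (e : R) : continuous g -> 0 < e ->
  exists2 d, 0 < d & forall t, 0 < t < d -> L1 r (fun x => mollify t g x - g x) <= e.
Proof.
move=> cg e0; have Lg := continuous_Lloc cg.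
set M := fine (mu (cb r)).
have M0 : 0 <= M by rewrite fine_ge0.
have eM : 0 < e / (M + 1) by rewrite divr_gt0// ltr_wpDl.
have [d d0 Hd] := uniform_continuous_cb r cg eM.
exists d => // t /andP[t0 td].
have Lmg := Lloc_mollify t0 Lg.
apply: (@le_trans _ _ (L1 r (fun _ : 'rV[R]_N => e / (M + 1)))); last first.
  rewrite L1_cst -/M gtr0_norm// mulrAC ler_pdivrMr ?ltr_wpDl//.
  by rewrite ler_pM2l// lerDl.
apply: le_L1.
- by apply: LlocB.
- by apply: continuous_Lloc; exact: cst_continuous.
move=> x xr; rewrite mollify_sub// (gtr0_norm eM).
have Lgx : Lloc (fun y => g y - g x).
  by apply: LlocB => //; apply: continuous_Lloc; exact: cst_continuous.
have I1 := moll_intg x t0 Lgx.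
have I2 : intg (fun y => e / (M + 1) * moll t (y - x)).
  by apply: (@moll_intg t (fun=> _)) => //; apply: continuous_Lloc; exact: cst_continuous.
apply: le_trans (le_normr_Rintegral measurableT I1) _.
apply: (@le_trans _ _ (\int[mu]_y (e / (M + 1) * moll t (y - x)))).
  apply: le_Rintegral => //; first exact: intg_norm.
  move=> y _; rewrite normrM (ger0_norm (moll_ge0 _ t0)).
  have [yx|yx] := ltP `|y - x| t.
    apply: ler_wpM2r; first exact: moll_ge0.
    by apply: ltW; apply: Hd => //; exact: lt_trans td.
  by rewrite /moll kern_out// mul0r !mulr0.
rewrite RintegralZl ?moll_shift1 ?mulr1//.
rewrite (_ : (_ \o _) = EFin \o (fun y => (fun=> 1) y * moll t (y - x))).
  by apply: (@moll_intg t) => //; apply: continuous_Lloc; exact: cst_continuous.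
by apply/funext => z /=; rewrite mul1r.
Qed.

(** Three-epsilon argument with a continuous [g] close to [u] on the cube of radius [r + 1]: the
    extra unit pays for the enlargement in [mollify_contraction], since [t < 1]. *)
Lemma L1_mollify u r (e : R) : Lloc u -> 0 < e ->
  exists2 d, 0 < d & forall t, 0 < t < d -> L1 r (fun x => mollify t u x - u x) <= e.
Proof.
move=> Lu e0; have e3 : 0 < e / 3 by rewrite divr_gt0.
have [_ /(_ (r + 1) _ e3)[g cg Hg]] := approximable_Lloc Lu.
have Lg := continuous_Lloc cg.
have Lug := LlocB Lu Lg.
have [d d0 Hd] := L1_mollify_continuous r cg e3.
have mono t : t <= r + 1 -> L1 t (fun x => u x - g x) <= e / 3.
  move=> tr; apply: le_trans Hg.
  rewrite -lee_fin !L1E//; apply: ge0_subset_integral => //.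
  - exact: measurable_cb.
  - exact: measurable_cb.
  - apply: measurable_funTS; apply/measurable_EFinP.
    by have [] := Lloc_norm Lug.
  - by move=> x /= /le_trans; apply.
exists (Num.min d 1); first by rewrite lt_min d0 ltr01.
move=> t; rewrite lt_min => /andP[t0 /andP[td t1]].
have Lm := Lloc_mollify t0 Lug.
have Lmg := Lloc_mollify t0 Lg.
rewrite (_ : (fun x => _) = fun x => mollify t (fun x => u x - g x) x +
   ((mollify t g x - g x) + -1 * (u x - g x))); last first.
  by apply/funext => x; rewrite (mollifyB t0 Lu Lg); ring.
have L2 : Lloc (fun x => -1 * (u x - g x)).
  by apply: LlocM => //; exact: cst_continuous.
have L3 : Lloc (fun x => mollify t g x - g x) by exact: LlocB.
apply: le_trans (L1D r Lm (LlocD L3 L2)) _.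
have -> : e = e / 3 + (e / 3 + e / 3) by field.
apply: lerD.
  by apply: le_trans (mollify_contraction r t0 Lug) _; apply: mono; rewrite lerD2l ltW.
apply: le_trans (L1D r L3 L2) _; apply: lerD; first by apply: Hd; rewrite t0 td.
by rewrite L1Z// normrN1 mul1r; apply: mono; rewrite lerDl.
Qed.

End mollifier.

(** * Kato's inequality *)

Section smooth_abs.
Context {R : realType}.
Variable d : R.
Hypothesis d0 : 0 < d.
Implicit Types t a b : R.

(** A smooth convex regularization of [|t|], within [d] of it; its derivative [dsabs] regularizes
    the sign and vanishes at [0] just as [Num.sg] does. *)
Definition sabs t : R := Num.sqrt (t ^+ 2 + d ^+ 2).
Definition dsabs t : R := t / sabs t.

Let arg_gt0 t : 0 < t ^+ 2 + d ^+ 2.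
Proof. by rewrite ltr_wpDl ?sqr_ge0// exprn_gt0. Qed.

Lemma sabs_gt0 t : 0 < sabs t.
Proof. by rewrite sqrtr_gt0. Qed.

Lemma sabs_sqr t : sabs t ^+ 2 = t ^+ 2 + d ^+ 2.
Proof. by rewrite sqr_sqrtr// ltW. Qed.

Lemma le_abs_sabs t : `|t| <= sabs t.
Proof. by rewrite -sqrtr_sqr ler_wsqrtr// lerDl sqr_ge0. Qed.

Lemma le_d_sabs t : d <= sabs t.
Proof.
by rewrite -(gtr0_norm d0) -sqrtr_sqr ler_wsqrtr// lerDr sqr_ge0.
Qed.

Lemma sabs_le t : sabs t <= `|t| + d.
Proof.
rewrite -(@ler_pXn2r _ 2)// ?nnegrE ?(ltW (sabs_gt0 t)) ?addr_ge0 ?(ltW d0)//.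
rewrite sabs_sqr sqrrD real_normK ?num_real// lerD2r lerDl.
by rewrite mulrn_wge0// mulr_ge0// ltW.
Qed.

Lemma dsabs_le1 t : `|dsabs t| <= 1.
Proof.
rewrite normrM normfV (gtr0_norm (sabs_gt0 t)) ler_pdivrMr ?sabs_gt0// mul1r.
exact: le_abs_sabs.
Qed.

Lemma sabs_lip a b : `|sabs a - sabs b| <= `|a - b|.
Proof.
have S : 0 < sabs a + sabs b by rewrite addr_gt0 ?sabs_gt0.
rewrite -(ler_pM2r S) -{1}(gtr0_norm S) -normrM.
have -> : (sabs a - sabs b) * (sabs a + sabs b) = (a - b) * (a + b).
  rewrite -!subr_sqr !sabs_sqr; ring.
rewrite normrM ler_wpM2l// (le_trans (ler_normD _ _))// lerD//; exact: le_abs_sabs.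
Qed.

(** The difference is written as two quotients by [sabs a], which is at least [d]; each contributes
    [|a - b| / d], whence the factor [2]. *)
Lemma dsabs_lip a b : `|dsabs a - dsabs b| <= 2 / d * `|a - b|.
Proof.
have Sa := sabs_gt0 a; have Sb := sabs_gt0 b.
have -> : dsabs a - dsabs b = (a - b) / sabs a + dsabs b * ((sabs b - sabs a) / sabs a).
  by rewrite /dsabs; field; rewrite !gt_eqF.
have H c : `|c / sabs a| <= d^-1 * `|c|.
  rewrite normrM mulrC ler_wpM2r// normfV (gtr0_norm Sa) lef_pV2 ?posrE//.
  exact: le_d_sabs.
apply: le_trans (ler_normD _ _) _.
have -> : 2 / d * `|a - b| = d^-1 * `|a - b| + d^-1 * `|a - b| by ring.
apply: lerD; first exact: H.
rewrite normrM (le_trans (ler_piMl _ (dsabs_le1 b)))//.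
apply: le_trans (H _) _.
by rewrite ler_wpM2l ?invr_ge0 ?(ltW d0)// distrC sabs_lip.
Qed.

Lemma is_derive_sabs t : is_derive t 1 sabs (dsabs t).
Proof.
have D : is_derive t 1 (fun s : R => s ^+ 2 + d ^+ 2) (2 * t).
  apply: is_derive_eq; rewrite /GRing.scale /=; ring.
rewrite (_ : dsabs t = (2 * sabs t)^-1 * (2 * t)).
  exact: (is_derive_chain (g := Num.sqrt) (f := fun s : R => s ^+ 2 + d ^+ 2)
    (is_derive1_sqrt (arg_gt0 t)) D).
by rewrite /dsabs; field; rewrite gt_eqF// sabs_gt0.
Qed.

Let G (q : {poly R} * nat) t := q.1.[t] / sabs t ^+ q.2.
(** Derivatives of [sabs] stay among the quotients of a polynomial by a power of [sabs], using
    [sabs t ^+ 2 = t^2 + d^2]; [sabs] itself is the quotient of that polynomial by [sabs]. *)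
Let D (q : {poly R} * nat) : {poly R} * nat :=
  (q.1^`() * ('X^2 + (d ^+ 2)%:P) - q.2%:R *: ('X * q.1), q.2.+2).

Let is_derive_G q t : is_derive t 1 (G q) (G (D q) t).
Proof.
case: q => p n; rewrite /G /D /=.
have S0 : sabs t != 0 by rewrite gt_eqF// sabs_gt0.
have X1 : is_derive (sabs t) 1 (fun y : R => y ^+ n) (n%:R * sabs t ^+ n.-1).
  by split; [exact: exprn_derivable|rewrite exp_derive [_ *: _]mulr1].
have D1 : is_derive t 1 (fun s : R => sabs s ^+ n) (n%:R * sabs t ^+ n.-1 * dsabs t).
  exact: (is_derive_chain (f := sabs) X1 (is_derive_sabs t)).
have D2 := is_deriveV (f := fun s : R => sabs s ^+ n) (expf_neq0 n S0) D1.
have := is_deriveM (is_derive_poly p t) D2.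
set a := (X in is_derive _ _ _ X -> _); set b := (X in _ -> is_derive _ _ _ X).
suff -> : a = b by [].
rewrite /a /b /GRing.scale /= !hornerE -sabs_sqr /dsabs.
case: n {X1 D1 D2 a b} => [|n] /=.
  by rewrite !expr0; field.
rewrite !exprS; field.
by rewrite S0 expf_neq0.
Qed.

Lemma Ck_sabs N k (f : 'rV[R]_N -> R) : Ck k f -> Ck k (fun x => sabs (f x)).
Proof.
move=> Cf; rewrite (_ : (fun x => _) = fun x => G ('X^2 + (d ^+ 2)%:P, 1%N) (f x)).
  by apply: (Ck_comp (G := G) (D := D)).
apply/funext => x; rewrite /G /= !hornerE -sabs_sqr expr1 expr2 mulfK//.
by rewrite gt_eqF// sabs_gt0.
Qed.

Lemma is_derive_dsabs t : is_derive t 1 dsabs (d ^+ 2 / sabs t ^+ 3).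
Proof.
have S0 : sabs t != 0 by rewrite gt_eqF// sabs_gt0.
have D2 := is_deriveV S0 (is_derive_sabs t).
have := is_deriveM (is_derive_id t 1) D2.
set a := (X in is_derive _ _ _ X -> _); set b := (X in _ -> is_derive _ _ _ X).
suff -> : a = b by [].
rewrite /a /b /GRing.scale /= /dsabs.
have -> : d ^+ 2 = sabs t ^+ 2 - t ^+ 2 by rewrite sabs_sqr addrAC subrr add0r.
field; exact: S0.
Qed.

(** The chain rule adds the term [sabs''(U) |grad U|^2], which is nonnegative since
    [sabs'' = d^2 / sabs^3]. *)
Lemma laplacian_sabs_ge N (U : 'rV[R]_N -> R) x : Ck 2 U ->
  dsabs (U x) * laplacian U x <= laplacian (fun y => sabs (U y)) x.
Proof.
move=> CU; rewrite /laplacian mulr_sumr; apply: ler_sum => i _.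
have E : partial i (fun y => sabs (U y)) = fun y => dsabs (U y) * partial i U y.
  apply/funext => y; apply: partialE.
  exact: (is_derive_chain (is_derive_sabs (U y)) (Ck_is_derive y i (CkW CU))).
rewrite E.
have -> : partial i (fun y => dsabs (U y) * partial i U y) x =
    dsabs (U x) * partial i (partial i U) x + d ^+ 2 / sabs (U x) ^+ 3 * (partial i U x) ^+ 2.
  apply: partialE.
  have D1 := is_derive_chain (is_derive_dsabs (U x)) (Ck_is_derive x i (CkW CU)).
  have := is_deriveM D1 (Ck_is_derive x i (Ck_partial i CU)).
  set a := (X in is_derive _ _ _ X -> _); set b := (X in _ -> is_derive _ _ _ X).
  suff -> : a = b by [].
  rewrite /a /b /GRing.scale /=; ring.
rewrite lerDl mulr_ge0 ?sqr_ge0// divr_ge0 ?sqr_ge0//.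
by rewrite exprn_ge0// ltW// sabs_gt0.
Qed.

End smooth_abs.

(** * Kato's inequality for locally integrable functions *)

Section kato.
Context {R : realType} {N : nat}.
Local Notation mu := (lebesgue_rV R N).
Implicit Types (u f g phi : 'rV[R]_N -> R) (r d t : R) (x y : 'rV[R]_N).

Definition weak_laplacian u f := forall phi, test_function phi ->
  \int[mu]_x (u x * laplacian phi x) = \int[mu]_x (f x * phi x).

Lemma laplacian_mollify u f (e : R) x : 0 < e -> Lloc u -> weak_laplacian u f ->
  laplacian (mollify e u) x = mollify e f x.
Proof.
move=> e0 Lu uf.
rewrite (laplacian_conv x Lu (smooth_moll e 2) (supp_moll e0)).
rewrite [RHS]/conv -(uf _ (test_moll_shift x e0)).
apply: eq_Rintegral => y _; rewrite (laplacian_shift x y (smooth_moll e 2)) //.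
Qed.

Lemma kato_smooth d U phi r : 0 < d -> Ck 2 U -> Ck 2 phi -> supp r phi ->
  (forall x, 0 <= phi x) ->
  \int[mu]_x (dsabs d (U x) * laplacian U x * phi x) <=
  \int[mu]_x (sabs d (U x) * laplacian phi x).
Proof.
move=> d0 CU Cp sp p0.
have CS := Ck_sabs d0 CU.
rewrite (Rintegral_green CS Cp sp).
have cL : continuous (laplacian U) := @Ck_laplacian _ _ 0 _ CU.
have cp := Ck_continuous Cp.
have cd : continuous (fun x => dsabs d (U x)).
  apply: (continuous_fcomp (f := U)); first exact: Ck_continuous CU.
  move=> t; apply/differentiable_continuous/derivable1_diffP.
  by have [] := is_derive_dsabs d0 t.
apply: le_Rintegral => //.
- apply: (Lloc_intgM_cont _ cp sp); apply: continuous_Lloc.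
  exact: continuous_mul.
- apply: (Lloc_intgM_cont _ cp sp); apply: continuous_Lloc.
  exact: (@Ck_laplacian _ _ 0).
- by move=> x _; rewrite ler_wpM2r// laplacian_sabs_ge.
Qed.

Lemma measurable_dsabs d : 0 < d -> measurable_fun setT (dsabs d).
Proof.
move=> d0; apply: continuous_measurable_fun => t.
by apply/differentiable_continuous/derivable1_diffP; have [] := is_derive_dsabs d0 t.
Qed.

Lemma measurable_sabs d : 0 < d -> measurable_fun setT (sabs d).
Proof.
move=> d0; apply: continuous_measurable_fun => t.
by apply/differentiable_continuous/derivable1_diffP; have [] := is_derive_sabs d0 t.
Qed.

Lemma Lloc_dsabsM d u f : 0 < d -> Lloc u -> Lloc f -> Lloc (fun x => dsabs d (u x) * f x).
Proof.
move=> d0 [mu_ _] Lf; have [mf _] := Lf; apply: (Lloc_le _ _ (Lloc_norm Lf)).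
  by apply: measurable_funM => //; exact: (measurableT_comp (measurable_dsabs d0)).
by move=> x; rewrite normrM ler_piMl// dsabs_le1.
Qed.

Lemma Lloc_sabs d u : 0 < d -> Lloc u -> Lloc (fun x => sabs d (u x)).
Proof.
move=> d0 Lu; have [mu_ _] := Lu.
apply: (@Lloc_le _ _ _ (fun x => `|u x| + d)).
- exact: (measurableT_comp (measurable_sabs d0)).
- by move=> x; rewrite gtr0_norm ?sabs_gt0// sabs_le.
- apply: LlocD; first exact: Lloc_norm.
  by apply: continuous_Lloc; exact: cst_continuous.
Qed.

Let weighted_sum_le (a b c : R) : 0 <= a -> 0 <= b -> 0 <= c ->
  a * c + b * (4 * c) <= (a + b + 1) * (4 * c).
Proof. by move=> a0 b0 c0; have := mulr_ge0 a0 c0; lra. Qed.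

Let approx_le (a a' b b' c1 c2 e : R) : `|a' - a| <= c1 -> `|b' - b| <= c2 ->
  b' <= a' -> c1 + c2 <= e -> b <= a + e.
Proof. by rewrite !ler_norml => /andP[_ ?] /andP[? _]; lra. Qed.

(** The smooth case, applied to the mollifications [U] and [F] of [u] and [f], passes to the limit.
    The delicate term is the product [dsabs d (U x) * F x], since [U] and [F] converge in [L^1]
    only. *)
Lemma kato_sabs d u f phi : 0 < d -> Lloc u -> Lloc f -> weak_laplacian u f ->
  test_function phi -> (forall x, 0 <= phi x) ->
  \int[mu]_x (dsabs d (u x) * f x * phi x) <=
  \int[mu]_x (sabs d (u x) * laplacian phi x).
Proof.
move=> d0 Lu Lf uf tp p0; have [r r0 sp] := test_function_supp tp.
have Cp : Ck 2 phi by case: tp.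
have cp := Ck_continuous Cp.
have cL : continuous (laplacian phi) := @Ck_laplacian _ _ 0 _ Cp.
have sL := laplacian_supp sp.
have [C1 C1_0 HC1] := continuous_supp_bounded cL sL.
have [C2 C2_0 HC2] := continuous_supp_bounded cp sp.
apply/ler_addgt0Pr => eta eta0.
have LD := Lloc_dsabsM d0 Lu Lf.
have LS := Lloc_sabs d0 Lu.
(* [f] is first mollified at a fixed scale [s]: this yields a function bounded on
   [cb r], with which the scale [t] of the mollification of [u] is then chosen. *)
pose q := eta / (C1 + C2 + 1) / 4.
have CC : 0 < C1 + C2 + 1 by rewrite ltr_wpDl// addr_ge0.
have q0 : 0 < q by rewrite !divr_gt0.
have [s1 s1_0 Hs1] := L1_mollify r Lf q0.
pose s := s1 / 2.
have s0 : 0 < s by rewrite divr_gt0.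
have {}Hs1 : L1 r (fun x => mollify s f x - f x) <= q.
  by apply: Hs1; rewrite s0 /s gtr_pMr// invf_lt1 ?ltr1n.
have Cfs : continuous (mollify s f) := Ck_mollify 0 s0 Lf.
have [K K0 HK] : exists2 K : R, 0 <= K & forall x, `|x| <= r -> `|mollify s f x| <= K.
  have /compact_bounded[M [Mr H]] : compact (mollify s f @` cb r).
    by apply: continuous_compact; [exact: continuous_subspaceT|exact: compact_cb].
  exists (`|M| + 1); first by rewrite addr_ge0.
  move=> x xr; apply: H; last by exists x.
  by rewrite (le_lt_trans (ler_norm M))// ltrDl.
(* The Lipschitz constant of [dsabs] times the bound on [mollify s f]; adding [1] makes
   [q / K' <= q], which the error [E1] uses. *)
pose K' := 2 / d * K + 1.
have K'0 : 0 < K' by rewrite ltr_wpDl// mulr_ge0// divr_ge0// ltW.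
have [s2 s2_0 Hs2] := L1_mollify r Lu (divr_gt0 q0 K'0).
have [s3 s3_0 Hs3] := L1_mollify r Lf q0.
pose t := Num.min s2 s3 / 2.
have ms0 : 0 < Num.min s2 s3 by rewrite lt_min s2_0 s3_0.
have t0 : 0 < t by rewrite divr_gt0.
have tm : t < Num.min s2 s3 by rewrite /t gtr_pMr// invf_lt1 ?ltr1n.
have {}Hs2 : L1 r (fun x => mollify t u x - u x) <= q / K'.
  by apply: Hs2; rewrite t0 (lt_le_trans tm)// ge_min lexx.
have {}Hs3 : L1 r (fun x => mollify t f x - f x) <= q.
  by apply: Hs3; rewrite t0 (lt_le_trans tm)// ge_min lexx orbT.
pose U := mollify t u; pose F := mollify t f.
have CU : Ck 2 U by exact: Ck_mollify.
have LU : Lloc U by exact: Lloc_mollify.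
have LF : Lloc F by exact: Lloc_mollify.
have LSU := Lloc_sabs d0 LU.
have LDU := Lloc_dsabsM d0 LU LF.
have key := kato_smooth d0 CU Cp sp p0.
have {}key : \int[mu]_x (dsabs d (U x) * F x * phi x) <=
    \int[mu]_x (sabs d (U x) * laplacian phi x).
  apply: le_trans key; rewrite le_eqVlt; apply/orP; left; apply/eqP.
  by apply: eq_Rintegral => x _; rewrite (laplacian_mollify x t0 Lu uf).
have E1 : `|\int[mu]_x ((sabs d (U x) - sabs d (u x)) * laplacian phi x)| <= C1 * (q / K').
  apply: le_trans (Rintegral_mul_le (LlocB LSU LS) (continuous_measurable_rV cL) HC1 sL) _.
  rewrite ler_wpM2l//; apply: le_trans Hs2; apply: le_L1; [exact: LlocB..|].
  by move=> x _; exact: sabs_lip.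
(* The four [q] are: one from [F - f]; two from [f - mollify s f], multiplied by a difference of two
   numbers in [[-1, 1]]; and one from the bounded [mollify s f], multiplied by a Lipschitz
   difference. *)
have q2 : L1 r (fun x => dsabs d (U x) * F x - dsabs d (u x) * f x) <= 4 * q.
  pose A (x : 'rV[R]_N) : R := `|F x - f x|.
  pose B (x : 'rV[R]_N) : R := 2 * `|mollify s f x - f x|.
  pose D (x : 'rV[R]_N) : R := 2 / d * K * `|U x - u x|.
  have LA : Lloc A := Lloc_norm (LlocB LF Lf).
  have LB0 : Lloc (fun x => `|mollify s f x - f x|).
    exact: (Lloc_norm (LlocB (Lloc_mollify s0 Lf) Lf)).
  have LB : Lloc B := LlocZ 2 LB0.
  have LD0 : Lloc (fun x => `|U x - u x|) := Lloc_norm (LlocB LU Lu).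
  have LD' : Lloc D := LlocZ (2 / d * K) LD0.
  have L1n g : L1 r (fun x => `|g x|) = L1 r g.
    by apply: eq_Rintegral => x _; rewrite normr_id.
  apply: (@le_trans _ _ (L1 r (fun x => A x + (B x + D x)))).
    apply: le_L1; [exact: LlocB|by apply: LlocD => //; exact: LlocD|].
    move=> x xr.
    have AB0 : 0 <= A x + (B x + D x).
      have dK : 0 <= 2 / d * K by rewrite mulr_ge0// divr_ge0// ltW.
      rewrite /A /B /D addr_ge0//; apply: addr_ge0; exact: mulr_ge0.
    rewrite (ger0_norm AB0).
    have -> : dsabs d (U x) * F x - dsabs d (u x) * f x =
      dsabs d (U x) * (F x - f x) + ((dsabs d (U x) - dsabs d (u x)) * (f x - mollify s f x)
      + (dsabs d (U x) - dsabs d (u x)) * mollify s f x) by ring.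
    apply: le_trans (ler_normD _ _) _; apply: lerD.
      by rewrite normrM ler_piMl// dsabs_le1.
    apply: le_trans (ler_normD _ _) _; apply: lerD.
      rewrite normrM distrC (distrC (f x)) ler_wpM2r//.
      rewrite (le_trans (ler_normB _ _))// -[2]/(1 + 1) lerD// dsabs_le1//.
    rewrite normrM /D mulrAC ler_pM//; first exact: dsabs_lip.
    exact: HK.
  apply: le_trans (L1D r LA (LlocD LB LD')) _.
  have -> : 4 * q = q + (2 * q + q) by ring.
  apply: lerD; first by rewrite L1n.
  apply: le_trans (L1D r LB LD') _; apply: lerD.
    rewrite (L1Z r 2 LB0) (L1n (fun x => mollify s f x - f x)) normr_nat.
    exact: (ler_wpM2l (ler0n R 2) Hs1).
  rewrite (L1Z r (2 / d * K) LD0) (L1n (fun x => U x - u x)) ger0_norm; last first.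
    by rewrite mulr_ge0// divr_ge0// ltW.
  apply: (@le_trans _ _ (K' * (q / K'))).
    have dK : 0 <= 2 / d * K by rewrite mulr_ge0// divr_ge0// ltW.
    have dK' : 2 / d * K <= K' by rewrite lerDl.
    exact: (ler_pM dK (L1_ge0 _ _) dK' Hs2).
  by rewrite mulrC divfK// gt_eqF.
have E2 : `|\int[mu]_x ((dsabs d (U x) * F x - dsabs d (u x) * f x) * phi x)| <= C2 * (4 * q).
  apply: le_trans (Rintegral_mul_le (LlocB LDU LD) (continuous_measurable_rV cp) HC2 sp) _.
  by rewrite ler_wpM2l.
move: E1 E2.
under eq_Rintegral do rewrite mulrBl.
rewrite RintegralB//; [|exact: (Lloc_intgM_cont LSU cL sL)|exact: (Lloc_intgM_cont LS cL sL)].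
move=> E1.
under eq_Rintegral do rewrite mulrBl.
rewrite RintegralB//; [|exact: (Lloc_intgM_cont LDU cp sp)|exact: (Lloc_intgM_cont LD cp sp)].
move=> E2.
have qK : C1 * (q / K') <= C1 * q.
  by rewrite ler_wpM2l// ler_pdivrMr// ler_peMr ?(ltW q0)// lerDr mulr_ge0// divr_ge0// ltW.
have qe : C1 * q + C2 * (4 * q) <= eta.
  apply: le_trans (weighted_sum_le C1_0 C2_0 (ltW q0)) _.
  rewrite /q mulrC le_eqVlt; apply/orP; left; apply/eqP.
  by field; rewrite gt_eqF.
exact: (approx_le E1 E2 key (le_trans (lerD qK (lexx _)) qe)).
Qed.

Lemma Rintegral_dct (h_ : nat -> 'rV[R]_N -> R) (h g : 'rV[R]_N -> R) :
  (forall n, measurable_fun setT (h_ n)) -> measurable_fun setT h -> intg g ->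
  (forall n x, `|h_ n x| <= g x) ->
  (forall x, h_ ^~ x @ \oo --> h x) ->
  \int[mu]_x h_ n x @[n --> \oo] --> \int[mu]_x h x.
Proof.
move=> mh_ mh Ig hg hh.
have [|||||Ih _ H] := @dominated_convergence _ _ _ mu setT measurableT
  (fun n => EFin \o h_ n) (EFin \o h) (EFin \o g).
- by move=> n; apply/measurable_EFinP.
- exact/measurable_EFinP.
- apply: aeW => x _; apply: cvg_EFin; first exact: nearW.
  exact: hh.
- exact: Ig.
- by apply: aeW => x n _; rewrite lee_fin.
apply: fine_cvg; rewrite fineK//.
exact: integrable_fin_num Ih.
Qed.

Lemma dsabs_sg_le d t : 0 < d -> t != 0 -> `|dsabs d t - Num.sg t| <= d / `|t|.
Proof.
move=> d0 t0; have S := sabs_gt0 d0 t; have nt : 0 < `|t| by rewrite normr_gt0.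
have -> : dsabs d t - Num.sg t = Num.sg t * ((`|t| - sabs d t) / sabs d t).
  rewrite mulrBl mulrBr divff ?gt_eqF// mulr1 mulrA -numEsg//.
rewrite normrM normr_sg t0 mul1r normrM normfV (gtr0_norm S).
rewrite distrC ger0_norm ?subr_ge0 ?le_abs_sabs//.
apply: ler_pM; rewrite ?subr_ge0 ?le_abs_sabs ?invr_ge0 ?(ltW S)//.
  by rewrite lerBlDl sabs_le.
by rewrite lef_pV2 ?posrE// le_abs_sabs.
Qed.

Lemma measurable_sg u : measurable_fun setT u -> measurable_fun setT (fun x => Num.sg (u x)).
Proof.
move=> mu_.
rewrite (_ : (fun _ => _) = fun x => if 0 < u x then 1 else if u x < 0 then -1 else 0).
  apply: measurable_fun_ifT => //; first exact: measurable_fun_ltr.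
  by apply: measurable_fun_ifT => //; exact: measurable_fun_ltr.
by apply/funext => x; case: sgrP.
Qed.

(** The regularization is removed along [d = 1 / (n + 1)]: dominated convergence on the left, and on
    the right an error of at most [d] times a constant because [sabs] is within [d] of the absolute
    value. *)
Lemma kato u f phi : Lloc u -> Lloc f -> weak_laplacian u f ->
  test_function phi -> (forall x, 0 <= phi x) ->
  \int[mu]_x (Num.sg (u x) * f x * phi x) <= \int[mu]_x (`|u x| * laplacian phi x).
Proof.
move=> Lu Lf uf tp p0; have [r r0 sp] := test_function_supp tp.
have [mu_ _] := Lu; have [mf _] := Lf.
have Cp : Ck 2 phi by case: tp.
have cp := Ck_continuous Cp.
have cL : continuous (laplacian phi) := @Ck_laplacian _ _ 0 _ Cp.
have sL := laplacian_supp sp.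
have [C1 C1_0 HC1] := continuous_supp_bounded cL sL.
pose d_ n : R := n.+1%:R^-1.
have d0 n : 0 < d_ n by rewrite invr_gt0.
have Iu := Lloc_norm Lu.
set M := fine (mu (cb r)).
have M0 : 0 <= M by rewrite fine_ge0.
have H n : \int[mu]_x (dsabs (d_ n) (u x) * f x * phi x) <=
    \int[mu]_x (`|u x| * laplacian phi x) + C1 * M * d_ n.
  apply: le_trans (kato_sabs (d0 n) Lu Lf uf tp p0) _.
  have LS := Lloc_sabs (d0 n) Lu.
  rewrite -lerBlDl -RintegralB//;
    [|exact: (Lloc_intgM_cont LS cL sL)|exact: (Lloc_intgM_cont Iu cL sL)].
  under eq_Rintegral do rewrite -mulrBl.
  apply: le_trans (ler_norm _) _.
  apply: le_trans (Rintegral_mul_le (LlocB LS Iu) (continuous_measurable_rV cL) HC1 sL) _.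
  rewrite -mulrA ler_wpM2l//.
  apply: (@le_trans _ _ (L1 r (fun _ : 'rV[R]_N => d_ n))); last first.
    by rewrite L1_cst -/M gtr0_norm// mulrC.
  apply: (le_L1 (LlocB LS Iu) (Lloc_cst (d_ n))).
  move=> x _; rewrite (gtr0_norm (d0 n)) ger0_norm; last by rewrite subr_ge0 le_abs_sabs.
  by rewrite lerBlDl sabs_le.
have msg := measurable_sg mu_.
have L : \int[mu]_x (dsabs (d_ n) (u x) * f x * phi x) @[n --> \oo] -->
    \int[mu]_x (Num.sg (u x) * f x * phi x).
  apply: (Rintegral_dct (g := fun x => `|f x * phi x|)).
  - move=> n; apply: measurable_funM; last exact: continuous_measurable_rV.
    by apply: measurable_funM => //; exact: (measurableT_comp (measurable_dsabs (d0 n))).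
  - apply: measurable_funM; last exact: continuous_measurable_rV.
    exact: measurable_funM.
  - by apply: intg_norm; exact: (Lloc_intgM_cont Lf cp sp).
  - by move=> n x; rewrite -mulrA normrM ler_piMl// dsabs_le1.
  - move=> x; apply: cvgM; last exact: cvg_cst.
    apply: cvgM; last exact: cvg_cst.
    have [->|ux] := eqVneq (u x) 0.
      rewrite sgr0 (_ : (fun _ => _) = fun=> 0); first exact: cvg_cst.
      by apply/funext => n; rewrite /dsabs mul0r.
    apply/cvgrPdist_le => e e0.
    have eu : 0 < e * `|u x| by rewrite mulr_gt0// normr_gt0.
    have [k Hk] : exists k : nat, k.+1%:R^-1 < e * `|u x|.
      by have /ltr_add_invr[k] := eu; rewrite add0r; exists k.
    exists k => // n /= kn; rewrite distrC (le_trans (dsabs_sg_le (d0 n) ux))//.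
    rewrite ler_pdivrMr ?normr_gt0// (le_trans _ (ltW Hk))//.
    by rewrite lef_pV2 ?posrE// ler_nat ltnS.
have Z : \int[mu]_x (`|u x| * laplacian phi x) + C1 * M * d_ n @[n --> \oo] -->
   \int[mu]_x (`|u x| * laplacian phi x) + C1 * M * 0.
  apply: cvgD; first exact: cvg_cst.
  apply: cvgM; first exact: cvg_cst.
  exact: cvg_harmonic.
rewrite mulr0 addr0 in Z.
by apply: ler_cvg_to L Z _; exact: nearW.
Qed.

End kato.

(** * Keller-Osserman estimate *)

Section keller_osserman.
Context {R : realType} {N : nat}.
Implicit Types (u f g w phi : 'rV[R]_N -> R) (r : R) (x y z : 'rV[R]_N).

Lemma norm_delta_le1 (i : 'I_N) : `|delta_mx 0 i : 'rV[R]_N| <= 1.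
Proof.
apply: norm_le_coord => // j; rewrite mxE eqxx /=.
by case: (j == i); rewrite ?normr1 ?normr0.
Qed.

(** If [L] were positive, [h'] would be positive just to the right of [0], and the mean value
    theorem would produce a value above the maximum. *)
Lemma derivatives_at_max (h h' : R -> R) (L d : R) : 0 < d ->
  (forall t : R, is_derive t 1 h (h' t)) -> is_derive (0 : R) 1 h' L ->
  (forall t, `|t| < d -> h t <= h 0) -> h' 0 = 0 /\ L <= 0.
Proof.
move=> d0 dh dh' hmax.
have D0 : is_derive (0 : R) 1 h 0.
  apply: (derive1_at_max (a := - d) (b := d)).
  - by rewrite ge0_cp// ltW.
  - by move=> t _; have [] := dh t.
  - by rewrite in_itv /= oppr_lt0 d0.
  - by move=> t; rewrite in_itv /= -ltr_norml; exact: hmax.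
have h'0 : h' 0 = 0 by case: (dh 0) => _ <-; case: D0.
split=> //; rewrite leNgt; apply/negP => L0.
have [/cvg_ex[/= l Hl] El] := dh'.
have Ell : l = L by rewrite -El; apply/esym/cvg_lim.
rewrite -Ell in L0.
have [t /= t0 Ht] := cvgr_gt _ Hl _ L0.
have md0 : 0 < Num.min t d by rewrite lt_min t0 d0.
have [s s0 sm] : exists2 s, 0 < s & s < Num.min t d.
  exists (Num.min t d / 2); first by rewrite divr_gt0.
  by rewrite gtr_pMr// invf_lt1 ?ltr1n.
move: sm; rewrite lt_min => /andP[st sd].
have ch : {within `[0, s], continuous h}.
  apply: continuous_subspaceT => r; apply/differentiable_continuous/derivable1_diffP.
  by have [] := dh r.
have [c] := MVT s0 (fun r _ => dh r) ch.
rewrite in_itv /= => /andP[c0 cs] E.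
have hs : h s <= h 0 by apply: hmax; rewrite gtr0_norm.
have := Ht c; rewrite /= sub0r normrN gtr0_norm// (lt_trans cs)// => /(_ isT).
rewrite gt_eqF// => /(_ isT); rewrite addr0 h'0 subr0 [c *: 1]mulr1.
rewrite pmulr_rgt0 ?invr_gt0// => hc.
have : 0 < h s - h 0 by rewrite E mulr_gt0// subr0.
by rewrite subr_gt0 ltNge hs.
Qed.

Lemma partial_at_max g z (d : R) i : Ck 2 g -> 0 < d ->
  (forall y, `|y - z| < d -> g y <= g z) ->
  partial i g z = 0 /\ partial i (partial i g) z <= 0.
Proof.
move=> Cg d0 H; pose e : 'rV[R]_N := delta_mx 0 i.
have := @derivatives_at_max (fun t => g (t *: e + z))
  (fun t => partial i g (t *: e + z)) (partial i (partial i g) z) d d0.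
rewrite scale0r add0r; apply.
- move=> t; apply: (is_derive_along g z e t _).1; exact: Ck_is_derive (CkW Cg).
- by apply: (is_derive_line _ z e _).2; exact: Ck_is_derive (Ck_partial i Cg).
- move=> t td; apply: H; rewrite addrK normrZ; apply: le_lt_trans td.
  by apply: ler_piMr => //; exact: norm_delta_le1.
Qed.

(** Here [p] and [q] stand for the first derivatives of [w] and of the weight [z], and [a] and [b]
    for the second ones. The first-order condition gives [z p = - (l+2) w q], which eliminates [p]
    from the second-order one. *)
Let max_weighted_arith (z w p q a b : R) l : 0 < z ->
  p * z ^+ l.+2 + l.+2%:R * (w * (z ^+ l.+1 * q)) = 0 ->
  z ^+ 2 * a + 2 * l.+2%:R * z * p * q +
    w * (l.+2%:R * l.+1%:R * q ^+ 2 + l.+2%:R * z * b) <= 0 ->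
  z ^+ 2 * a <= w * ((2 * l.+2%:R ^+ 2 - l.+2%:R * l.+1%:R) * q ^+ 2 - l.+2%:R * z * b).
Proof.
move=> z0 G1 G2.
have pq : z * p = - (l.+2%:R * w * q).
  have : z ^+ l.+1 * (z * p + l.+2%:R * w * q) = 0.
    by rewrite -[RHS]G1 !exprS; ring.
  move/eqP; rewrite mulf_eq0 expf_eq0 /= (gt_eqF z0) /= => /eqP/(canRL (addrK _)) ->.
  by rewrite sub0r.
have E : 2 * l.+2%:R * z * p * q = - (2 * l.+2%:R ^+ 2 * w * q ^+ 2).
  by rewrite -(mulrA _ z) pq; ring.
rewrite E in G2.
rewrite -subr_ge0; apply: le_trans (_ : 0 <= - _) _; first by rewrite oppr_ge0; exact: G2.
by rewrite le_eqVlt; apply/orP; left; apply/eqP; ring.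
Qed.

(* The second-order condition at an interior maximum of [w zeta^(l+2)],
   multiplied by [zeta^2]. *)
Lemma max_weighted_laplacian w (zeta : 'rV[R]_N -> R) z (d : R) l i :
  Ck 2 w -> Ck 2 zeta -> 0 < d -> 0 < zeta z ->
  (forall y, `|y - z| < d -> w y * zeta y ^+ l.+2 <= w z * zeta z ^+ l.+2) ->
  zeta z ^+ 2 * partial i (partial i w) z <=
  w z * ((2 * l.+2%:R ^+ 2 - l.+2%:R * l.+1%:R) * (partial i zeta z) ^+ 2
    - l.+2%:R * zeta z * partial i (partial i zeta) z).
Proof.
move=> Cw Cz d0 z0 H.
have CG : Ck 2 (fun y => w y * zeta y ^+ l.+2) := Ck_mul Cw (Ck_exp l.+2 Cz).
have [G1 G2] := partial_at_max i CG d0 H.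
have dX f n y : Ck 1 f -> is_derive y (delta_mx 0 i) (fun y => f y ^+ n.+1)
    (n.+1%:R * f y ^+ n * partial i f y).
  move=> Cf; apply: (is_derive_chain (g := fun t : R => t ^+ n.+1)); last exact: Ck_is_derive Cf.
  by split; [exact: exprn_derivable|rewrite exp_derive [_ *: _]mulr1].
have dG y : partial i (fun y => w y * zeta y ^+ l.+2) y =
    partial i w y * zeta y ^+ l.+2 + l.+2%:R * (w y * (zeta y ^+ l.+1 * partial i zeta y)).
  apply: partialE.
  have := is_deriveM (Ck_is_derive y i (CkW Cw)) (dX zeta l.+1 y (CkW Cz)).
  set a := (X in is_derive _ _ _ X -> _); set b := (X in _ -> is_derive _ _ _ X).
  suff -> : a = b by [].
  rewrite /a /b /GRing.scale /=; ring.
rewrite (funext dG) in G2; rewrite dG in G1.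
set p := partial i w z in G1 *; set q := partial i zeta z in G1 *.
have dG2 : partial i (fun y => partial i w y * zeta y ^+ l.+2 +
      l.+2%:R * (w y * (zeta y ^+ l.+1 * partial i zeta y))) z =
    zeta z ^+ l * (zeta z ^+ 2 * partial i (partial i w) z + 2 * l.+2%:R * zeta z * p * q
      + w z * (l.+2%:R * l.+1%:R * q ^+ 2 + l.+2%:R * zeta z * partial i (partial i zeta) z)).
  apply: partialE.
  have D1 := is_deriveM (Ck_is_derive z i (Ck_partial i Cw)) (dX zeta l.+1 z (CkW Cz)).
  have D2 : is_derive z (delta_mx 0 i) (fun y => zeta y ^+ l.+1 * partial i zeta y) _ :=
    is_deriveM (dX zeta l z (CkW Cz)) (Ck_is_derive z i (Ck_partial i Cz)).
  have D3 := is_deriveM (Ck_is_derive z i (CkW Cw)) D2.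
  have := is_deriveD D1 (is_deriveZ l.+2%:R D3).
  set a := (X in is_derive _ _ _ X -> _); set b := (X in _ -> is_derive _ _ _ X).
  suff -> : a = b by [].
  rewrite /a /b /GRing.scale /= -/p -/q !exprS {a b D1 D2 D3}.
  clear G1 G2 dG dX CG H; clearbody p q.
  move: (partial i (partial i w) z) (partial i (partial i zeta) z) z0.
  by move: (w z) (zeta z) => ? ? ? ? _; ring.
rewrite dG2 pmulr_rle0 ?exprn_gt0// in G2.
exact: max_weighted_arith z0 G1 G2.
Qed.

End keller_osserman.

(** * Osserman's bound for smooth subsolutions *)

Section keller_osserman_smooth.
Context {R : realType} {N : nat}.
Implicit Types (u f g w phi : 'rV[R]_N -> R) (r c q rho : R) (x y z : 'rV[R]_N).

Let cutoff rho x y : R := 1 - nsq (y - x) / rho ^+ 2.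

Let partial_cutoff rho x i :
  partial i (cutoff rho x) = fun y => - (2 * (y 0 i - x 0 i) / rho ^+ 2).
Proof. by apply/funext => y; apply: partialE; exact: is_derive_bump_arg. Qed.

Let partial2_cutoff rho x i y :
  partial i (partial i (cutoff rho x)) y = - (2 / rho ^+ 2).
Proof. by rewrite partial_cutoff; apply: partialE; exact: is_derive_bump_arg2. Qed.

(** With [s = 1 / rho^2] and [a] a coordinate of [z - x], the cutoff has derivatives [- 2 a s] and
    [- 2 s]; since [a^2 s <= 1], the squared gradient term gives [8 k^2 s] and the second derivative
    [2 k s]. *)
Let cutoff_arith (k k1 a z s W : R) : 0 <= k -> 0 <= k1 -> 0 <= W ->
  0 <= s -> 0 < z <= 1 -> a ^+ 2 * s <= 1 ->
  W * ((2 * k ^+ 2 - k * k1) * (- (2 * a * s)) ^+ 2 - k * z * - (2 * s)) <=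
  W * ((8 * k ^+ 2 + 2 * k) * s).
Proof.
move=> k0 k10 W0 s0 /andP[z0 z1] as1; apply: ler_wpM2l => //.
have kk : 0 <= k * k1 by exact: mulr_ge0.
have k2 : 0 <= k ^+ 2 by exact: sqr_ge0.
have E1 : 0 <= (a * s) ^+ 2 by exact: sqr_ge0.
have E2 : (a * s) ^+ 2 <= s.
  by rewrite exprMn [s ^+ 2]expr2 mulrA ler_piMl.
have E3 : k ^+ 2 * (a * s) ^+ 2 <= k ^+ 2 * s by exact: ler_wpM2l.
have E4 : 0 <= k * k1 * (a * s) ^+ 2 by exact: mulr_ge0.
have E5 : k * s * z <= k * s by rewrite ler_piMr// mulr_ge0.
have -> : (2 * k ^+ 2 - k * k1) * (- (2 * a * s)) ^+ 2 - k * z * - (2 * s) =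
  8 * (k ^+ 2 * (a * s) ^+ 2) - 4 * (k * k1 * (a * s) ^+ 2) + 2 * (k * s * z) by ring.
have -> : (8 * k ^+ 2 + 2 * k) * s = 8 * (k ^+ 2 * s) + 2 * (k * s) by ring.
lra.
Qed.

Let smooth_cutoff rho x k : Ck k (cutoff rho x).
Proof. exact: smooth_bump_arg. Qed.

Let laplacian_at_max w x z l (d rho : R) : Ck 2 w -> 0 < d -> 0 < rho ->
  0 <= w z -> 0 < cutoff rho x z ->
  (forall y, `|y - z| < d ->
    w y * cutoff rho x y ^+ l.+2 <= w z * cutoff rho x z ^+ l.+2) ->
  cutoff rho x z ^+ 2 * laplacian w z <=
  w z * (N%:R * (8 * l.+2%:R ^+ 2 + 2 * l.+2%:R) / rho ^+ 2).
Proof.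
move=> Cw d0 rho0 w0 z0 H.
have r2 : 0 < rho ^+ 2 by rewrite exprn_gt0.
have z1 : cutoff rho x z <= 1 by rewrite gerBl divr_ge0 ?nsq_ge0// ltW.
have zr : nsq (z - x) <= rho ^+ 2.
  by move: z0; rewrite /cutoff subr_gt0 ltr_pdivrMr// mul1r => /ltW.
rewrite /laplacian mulr_sumr.
apply: (@le_trans _ _ (\sum_(i < N) w z * ((8 * l.+2%:R ^+ 2 + 2 * l.+2%:R) * rho ^- 2))).
  apply: ler_sum => i _.
  apply: le_trans (max_weighted_laplacian i Cw (smooth_cutoff rho x 2) d0 z0 H) _.
  rewrite partial2_cutoff partial_cutoff; apply: cutoff_arith => //.
  - by rewrite invr_ge0 ltW.
  - by rewrite z0 z1.
  - rewrite ler_pdivrMr// mul1r (le_trans _ zr)//.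
    by have := nsq_coord_le (z - x) i; rewrite !mxE.
rewrite sumr_const card_ord -mulr_natl.
by rewrite le_eqVlt; apply/orP; left; apply/eqP; ring.
Qed.

Let compact_ball2 x rho : compact [set y : 'rV[R]_N | nsq (y - x) <= rho ^+ 2].
Proof.
apply: (@subclosed_compact _ _ (cb (`|x| + `|rho|))).
- apply: (@closed_comp _ _ (fun y : 'rV[R]_N => nsq (y - x)) [set t | t <= rho ^+ 2]).
    by move=> y _; exact: (Ck_continuous (smooth_nsqB x 0)).
  exact: closed_le.
- exact: compact_cb.
- move=> y /= H.
  have : `|y - x| <= `|rho|.
    rewrite -(@ler_pXn2r _ 2)// ?nnegrE// real_normK ?num_real//.
    exact: le_trans (norm_sqr_le_nsq _) H.
  by rewrite /cb /= -lerBlDl; apply: le_trans; exact: lerB_dist.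
Qed.

(* Osserman's estimate at the maximum of [w cutoff^(l+2)]; since
   [(l+2)(q-1) >= 2], the cutoff raised to the power [(l+2)(q-1)] is at most its
   square. *)
Lemma osserman_bound w c q l rho x : Ck 2 w -> (forall y, 0 <= w y) -> 0 < c ->
  1 < q -> 2 <= l.+2%:R * (q - 1) ->
  (forall y, c * w y `^ q <= laplacian w y) -> 0 < rho -> 0 < w x ->
  c * w x `^ (q - 1) <= N%:R * (8 * l.+2%:R ^+ 2 + 2 * l.+2%:R) / rho ^+ 2.
Proof.
move=> Cw w0 c0 q1 lq Hw rho0 wx0.
have r2 : 0 < rho ^+ 2 by rewrite exprn_gt0.
pose G y := w y * cutoff rho x y ^+ l.+2.
have CG : Ck 2 G := Ck_mul Cw (Ck_exp l.+2 (smooth_cutoff rho x 2)).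
have cG := Ck_continuous CG.
have cx : cutoff rho x x = 1.
  by rewrite /cutoff subrr /nsq big1 ?mul0r ?subr0// => j _; rewrite mxE expr0n.
pose K := [set y : 'rV[R]_N | nsq (y - x) <= rho ^+ 2].
have Kx : K x.
  by rewrite /K /= subrr /nsq big1 ?ltW// => j _; rewrite mxE expr0n.
have [z /set_mem Kz Hz] := compact_EVT_max (ex_intro _ x Kx)
  (@compact_ball2 x rho) (continuous_subspaceT cG).
have cz0 : 0 <= cutoff rho x z by rewrite /cutoff subr_ge0 ler_pdivrMr// mul1r.
have Gxz : w x <= G z.
  by have := Hz x (mem_set Kx); rewrite {1}/G cx expr1n mulr1.
have cz : 0 < cutoff rho x z.
  rewrite lt_def cz0 andbT; apply/negP => /eqP E.
  by move: Gxz; rewrite /G E expr0n mulr0 leNgt wx0.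
have wz : 0 < w z.
  rewrite lt_def w0 andbT; apply/negP => /eqP E.
  by move: Gxz; rewrite /G E mul0r leNgt wx0.
(* [z] maximizes [G] on the closed ball only: outside, a power of the negative cutoff may be large.
   Positivity of the cutoff at [z] makes it an interior point, hence a local maximum. *)
have [d d0 Hd] : exists2 d, 0 < d & forall y, `|y - z| < d -> G y <= G z.
  have cc := Ck_continuous (smooth_cutoff rho x 0).
  have : open [set y | 0 < cutoff rho x y].
    apply: (@open_comp _ _ (cutoff rho x) [set t | 0 < t]); last exact: open_gt.
    by move=> y _; exact: cc.
  rewrite openE => /(_ z cz) /nbhs_ballP[d /= d0 Hd]; exists d => // y yz.
  apply: Hz; apply/mem_set; rewrite /K /=.
  have : 0 < cutoff rho x y by apply: Hd; rewrite mx_norm_ball /= distrC.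
  by rewrite subr_gt0 ltr_pdivrMr// mul1r => /ltW.
have key := laplacian_at_max Cw d0 rho0 (w0 z) cz Hd.
set A := _ / rho ^+ 2 in key *.
have {}key : c * (w z `^ (q - 1) * cutoff rho x z ^+ 2) <= A.
  rewrite -(ler_pM2l wz); apply: le_trans key.
  have : cutoff rho x z ^+ 2 * (c * w z `^ q) <= cutoff rho x z ^+ 2 * laplacian w z.
    by apply: ler_wpM2l => //; exact: sqr_ge0.
  apply: le_trans; rewrite -(@mulr_powRB1 _ (w z) q) ?(ltW wz) ?(lt_trans ltr01)//.
  by rewrite le_eqVlt; apply/orP; left; apply/eqP; ring.
apply: le_trans key; apply: ler_wpM2l; first exact: ltW.
have q10 : 0 <= q - 1 by rewrite subr_ge0 ltW.
apply: (@le_trans _ _ (G z `^ (q - 1))).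
  by apply: ge0_ler_powR => //; rewrite nnegrE ?(ltW wx0)// (le_trans (ltW wx0)).
rewrite /G powRM ?exprn_ge0// ?(ltW wz)//; apply: ler_wpM2l; first exact: powR_ge0.
rewrite -powR_mulrn// -powRrM -[leRHS]powR_mulrn//.
apply: ger_powR => //; rewrite cz /=.
by rewrite gerBl divr_ge0 ?nsq_ge0// ltW.
Qed.

Lemma keller_osserman_smooth w c q : Ck 2 w -> (forall y, 0 <= w y) -> 0 < c ->
  1 < q -> (forall y, c * w y `^ q <= laplacian w y) -> forall x, w x = 0.
Proof.
move=> Cw w0 c0 q1 Hw x.
have [l Hl] : exists l, 2 <= l.+2%:R * (q - 1).
  exists (Num.truncn (2 / (q - 1))); rewrite -ler_pdivrMr ?subr_gt0//.
  by rewrite (le_trans (ltW (truncnS_gt _)))// ler_nat.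
apply/eqP; rewrite eq_le w0 andbT leNgt; apply/negP => wx.
set D := N%:R * (8 * l.+2%:R ^+ 2 + 2 * l.+2%:R) : R.
have D0 : 0 <= D by rewrite mulr_ge0// addr_ge0// mulr_ge0// sqr_ge0.
have D1 : 0 < D + 1 by rewrite ltr_wpDl.
have A0 : 0 < c * w x `^ (q - 1) by rewrite mulr_gt0// powR_gt0.
have t0 : 0 < (D + 1) / (c * w x `^ (q - 1)) by rewrite divr_gt0.
have := @osserman_bound w c q l (Num.sqrt ((D + 1) / (c * w x `^ (q - 1)))) x Cw w0 c0
  q1 Hl Hw.
rewrite sqrtr_gt0 => /(_ t0 wx); rewrite -/D sqr_sqrtr ?(ltW t0)//.
rewrite invf_div mulrA ler_pdivlMr// mulrC ler_pM2r//.
by rewrite leNgt ltrDl ltr01.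
Qed.

End keller_osserman_smooth.

(** * From smooth to weak subsolutions *)

Section keller_osserman_weak.
Context {R : realType} {N : nat}.
Local Notation mu := (lebesgue_rV R N).
Implicit Types (u f g w phi : 'rV[R]_N -> R) (r c q : R) (x y z : 'rV[R]_N).

Lemma ae_eq0_L1 u : Lloc u -> (forall r, L1 r u = 0) -> {ae mu, forall x, u x = 0}.
Proof.
move=> Lu H.
have /ae_foralln : forall n : nat, {ae mu, forall x, cb n%:R x -> u x = 0}.
  move=> n; have I : mu.-integrable (cb n%:R) (EFin \o u) := Lloc_integrable_cb _ Lu.
  have /integrableP[mI _] := I.
  have : (\int[mu]_(x in cb n%:R) `|(EFin \o u) x| = 0)%E.
    by have := L1E n%:R Lu; rewrite H => /esym.
  move/(ae_eq_integral_abs _ (measurable_cb _) mI); apply: filterS => x /= ux xn.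
  by have := ux xn => -[].
apply: filterS => x ux; apply: (ux (Num.truncn `|x|).+1).
by rewrite /cb /= ltW// truncnS_gt.
Qed.

(** The graph of the [q]-th power lies above its tangent at [a]; this is Young's inequality for [t]
    and [a^(q-1)] with exponents [q] and [q / (q - 1)]. *)
Lemma powR_tangent (q a t : R) : 1 < q -> 0 <= a -> 0 <= t ->
  q * a `^ (q - 1) * t <= t `^ q + (q - 1) * a `^ q.
Proof.
move=> q1 a0 t0; have q0 : 0 < q by rewrite (lt_trans ltr01).
have q10 : 0 < q - 1 by rewrite subr_gt0.
have qq : q^-1 + (q / (q - 1))^-1 = 1 by field; rewrite !gt_eqF.
have := conjugate_powR t0 (powR_ge0 a (q - 1)) q0 (divr_gt0 q0 q10) qq.
rewrite -powRrM (_ : (q - 1) * (q / (q - 1)) = q); last by field; rewrite gt_eqF.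
rewrite -(ler_pM2l q0) => H; apply: le_trans (le_trans H _).
  by rewrite le_eqVlt; apply/orP; left; apply/eqP; ring.
by rewrite le_eqVlt; apply/orP; left; apply/eqP; field; rewrite !gt_eqF.
Qed.

Lemma mollify_ge0 (e : R) u x : 0 < e -> (forall y, 0 <= u y) -> 0 <= mollify e u x.
Proof. by move=> e0 u0; apply: Rintegral_ge0 => y _; rewrite mulr_ge0// moll_ge0. Qed.

(* Jensen's inequality, from the tangent at the mean value. *)
Lemma mollify_powR (e : R) w q x : 0 < e -> 1 < q -> (forall y, 0 <= w y) -> Lloc w ->
  Lloc (fun y => w y `^ q) -> mollify e w x `^ q <= mollify e (fun y => w y `^ q) x.
Proof.
move=> e0 q1 w0 Lw Lwq; set a := mollify e w x.
have a0 : 0 <= a by exact: mollify_ge0.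
have q0 : 0 < q by rewrite (lt_trans ltr01).
have I1 := moll_intg x e0 Lw; have I2 := moll_intg x e0 Lwq.
have I3 : intg (fun y => (q - 1) * a `^ q * moll e (y - x)).
  exact: (moll_intg x e0 (Lloc_cst ((q - 1) * a `^ q))).
have I0 : intg (fun y => moll e (y - x)).
  have := moll_intg x e0 (Lloc_cst 1); rewrite (_ : (fun y => _) = fun y => moll e (y - x))//.
  by apply/funext => y; rewrite mul1r.
have : \int[mu]_y (q * a `^ (q - 1) * (w y * moll e (y - x))) <=
    \int[mu]_y (w y `^ q * moll e (y - x) + (q - 1) * a `^ q * moll e (y - x)).
  apply: le_Rintegral => //; [exact: (intgZ _ I1)|exact: (intgD I2 I3)|].
  move=> y _; rewrite mulrA -mulrDl ler_wpM2r ?moll_ge0// powR_tangent//.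
rewrite RintegralZl// RintegralD// RintegralZl// moll_shift1// mulr1.
rewrite -[X in _ * X]/a -mulrA [_ * a]mulrC mulr_powRB1//.
rewrite -[X in _ <= X + _]/(mollify e (fun y => w y `^ q) x).
by rewrite -lerBlDr -mulrBl opprB addrCA subrr addr0 mul1r.
Qed.

Lemma keller_osserman w c q : Lloc w -> Lloc (fun y => w y `^ q) ->
  (forall y, 0 <= w y) -> 0 < c -> 1 < q ->
  (forall phi, test_function phi -> (forall x, 0 <= phi x) ->
    c * \int[mu]_x (w x `^ q * phi x) <= \int[mu]_x (w x * laplacian phi x)) ->
  {ae mu, forall x, w x = 0}.
Proof.
move=> Lw Lwq w0 c0 q1 H; apply: ae_eq0_L1 => // r.
have Z (e : R) : 0 < e -> forall x, mollify e w x = 0.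
  move=> e0; apply: (keller_osserman_smooth (c := c) (q := q)) => //.
  - exact: Ck_mollify.
  - by move=> y; exact: mollify_ge0.
  - move=> x.
    apply: (@le_trans _ _ (c * mollify e (fun y => w y `^ q) x)).
      by rewrite ler_pM2l// mollify_powR.
    have := H _ (test_moll_shift x e0) (fun y => moll_ge0 (y - x) e0).
    rewrite (laplacian_conv x Lw (smooth_moll e 2) (supp_moll e0)) /conv.
    move/le_trans; apply; rewrite le_eqVlt; apply/orP; left; apply/eqP.
    by apply: eq_Rintegral => y _; rewrite (laplacian_shift x y (smooth_moll e 2)).
apply/eqP; rewrite eq_le L1_ge0 andbT; apply/ler_addgt0Pr => e e0; rewrite add0r.
have [d d0 Hd] := L1_mollify r Lw e0.
have d2 : 0 < d / 2 by rewrite divr_gt0.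
have := Hd (d / 2); rewrite d2 gtr_pMr// invf_lt1 ?ltr1n// => /(_ isT).
apply: le_trans; rewrite le_eqVlt; apply/orP; left; apply/eqP.
by apply: eq_Rintegral => x _; rewrite Z// sub0r normrN.
Qed.

End keller_osserman_weak.

(** * Weyl's lemma and Liouville's theorem *)

Section weyl.
Context {R : realType} {N : nat}.
Local Notation mu := (lebesgue_rV R N).
Implicit Types (u v f g h w phi : 'rV[R]_N -> R) (r e : R) (x y z : 'rV[R]_N).

Lemma rbump_bounded (p : {poly R}) : exists2 C : R, 0 <= C &
  forall e x y, `|rbump p e x y| <= C.
Proof.
have [C C0 HC] := flat_norm_le p.
exists C => // e x y; rewrite /rbump; set t := 1 - _.
have [t0|t0] := leP t 0; first by rewrite /flat ltNge t0 normr0.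
rewrite (le_trans (HC t))// ler_piMr// gtr0_norm//.
by rewrite /t gerBl divr_ge0 ?nsq_ge0// sqr_ge0.
Qed.

Lemma rbump_out_nsq (p : {poly R}) e x y : 0 < e -> e ^+ 2 <= nsq (y - x) ->
  rbump p e x y = 0.
Proof.
move=> e0 H; rewrite /rbump /flat ltNge subr_le0 ler_pdivlMr ?exprn_gt0//.
by rewrite mul1r H.
Qed.

Let dkern s x y : R := rbump (flatD (flatD 1)) s x y * (2 * nsq (y - x) / s ^+ 3).

(** Where the bump does not vanish, [nsq (y - x) < s^2], so the extra factor is at most [2 / s]. The
    bound is thus uniform over scales bounded away from [0]. *)
Let dkern_bounded : exists2 C : R, 0 <= C &
  forall (t s : R) x y, 0 < t -> t < s -> `|dkern s x y| <= C / t.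
Proof.
have [C C0 HC] := rbump_bounded (flatD (flatD 1)).
exists (2 * C) => [|t s x y t0 ts]; first by rewrite mulr_ge0.
have s0 := lt_trans t0 ts.
have [H|H] := leP (s ^+ 2) (nsq (y - x)).
  by rewrite /dkern rbump_out_nsq// mul0r normr0 divr_ge0 ?mulr_ge0 ?(ltW t0).
rewrite /dkern normrM [2 * C]mulrC -[X in _ <= X]mulrA.
apply: (ler_pM (normr_ge0 _) (normr_ge0 _) (HC _ _ _)).
have s3 : 0 < s ^+ 3 by exact: exprn_gt0.
rewrite ger0_norm; last exact: divr_ge0 (mulr_ge0 (ler0n R 2) (nsq_ge0 _)) (ltW s3).
rewrite -mulrA ler_pM2l// ler_pdivrMr ?exprn_gt0//.
apply: le_trans (ltW H) _; rewrite exprS mulrA ler_peMl ?sqr_ge0//.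
by rewrite mulrC ler_pdivlMr// mul1r ltW.
Qed.

(** The scale derivative of the kernel is [e / 2] times the Laplacian of the test function
    [rbump 1 e x], on which [u] vanishes by harmonicity, plus [N / e] times the kernel. *)
Lemma is_derive_conv_kern u x e : Lloc u -> 0 < e -> weak_laplacian u (fun=> 0) ->
  is_derive e 1 (fun s : R => conv u (kern s) x) (N%:R / e * conv u (kern e) x).
Proof.
move=> Lu e0 uw.
have e2 : 0 < e / 2 by rewrite divr_gt0.
have [C C0 HC] := dkern_bounded.
have ab : e \in `]e / 2, 2 * e[.
  rewrite in_itv /= ltr_pMl// ltr1n andbT.
  by rewrite ltr_pdivrMr// ltr_pMr// ltr1n.
have s0 s : s \in `]e / 2, 2 * e[ -> 0 < s.
  by rewrite in_itv /= => /andP[+ _]; apply: lt_trans.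
have sup s p : s \in `]e / 2, 2 * e[ -> supp (`|x| + 2 * e) (rbump p s x).
  move=> sab; apply: supp_bump; first exact: s0 sab.
  by move: sab; rewrite in_itv /= => /andP[_ /ltW]; rewrite lerD2l.
have D : is_derive e 1 (fun s : R => \int[mu]_y (u y * rbump (flatD 1) s x y))
    (\int[mu]_y (u y * dkern e x y)).
  apply: (@diff_under_Rintegral R N u (fun s => rbump (flatD 1) s x)
    (fun s => dkern s x) (e / 2) (2 * e) e (`|x| + 2 * e) (C / (e / 2)) Lu ab).
  - by move=> s _; exact: Ck_continuous (smooth_bump (flatD 1) s x 0).
  - by move=> s sab; exact: sup.
  - by move=> s sab y ry; rewrite /dkern (sup _ _ sab)// mul0r.
  - by move=> s y; rewrite in_itv /= => /andP[es _]; exact: HC.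
  - by move=> s y sab; apply: is_derive_bump_scale; exact: s0 sab.
have -> : (fun s : R => conv u (kern s) x) =
    (fun s : R => \int[mu]_y (u y * rbump (flatD 1) s x y)).
  by apply/funext => s; apply: eq_Rintegral => y _; rewrite kernE.
have -> : N%:R / e * conv u (kern e) x = \int[mu]_y (u y * dkern e x y).
  have tb := test_bump 1 x e0.
  have I1 : intg (fun y => u y * laplacian (rbump 1 e x) y).
    have [r r0 sr] := test_function_supp tb.
    apply: (Lloc_intgM_cont Lu _ (laplacian_supp sr)).
    exact: (@Ck_laplacian _ _ 0 _ (smooth_bump 1 e x 2)).
  have I2 := conv_intg x Lu (Ck_continuous (smooth_kern e 0)) (supp_kern e0).
  rewrite /conv -RintegralZ_T//.
  have -> : \int[mu]_y (u y * dkern e x y) =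
      \int[mu]_y (e / 2 * (u y * laplacian (rbump 1 e x) y) +
                  N%:R / e * (u y * kern e (y - x))).
    apply: eq_Rintegral => y _; rewrite laplacian_bump kernE /dkern.
    by field; rewrite gt_eqF.
  rewrite RintegralD//; [|exact: intgZ|exact: intgZ].
  rewrite (RintegralZ_T (e / 2) I1) (uw _ tb).
  rewrite [X in _ / 2 * X](_ : _ = 0) ?mulr0 ?add0r//.
  rewrite (_ : (fun _ => _) = fun=> 0); first by rewrite Rintegral_cst// mul0r.
  by apply/funext => y; rewrite mul0r.
exact: D.
Qed.

(* [e^-N (u * kern e)(x)] does not depend on [e]: its logarithmic derivative
   vanishes. *)
Lemma conv_kern_scale u x e1 e2 : Lloc u -> weak_laplacian u (fun=> 0) ->
  0 < e1 -> 0 < e2 ->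
  conv u (kern e1) x * e2 ^+ N = conv u (kern e2) x * e1 ^+ N.
Proof.
move=> Lu uw e10 e20.
(* The logarithmic scale turns positive scales into the whole line, where a function with zero
   derivative is constant. *)
pose F (s : R) := conv u (kern (expR s)) x * expR (- (N%:R * s)).
have dF (s : R) : is_derive s 1 F 0.
  have D1 := is_derive_chain (g := fun t : R => conv u (kern t) x)
    (is_derive_conv_kern x Lu (expR_gt0 s) uw) (is_derive_expR s).
  have D0 : is_derive s 1 (fun s : R => - (N%:R * s)) (- N%:R).
    by apply: is_derive_eq; rewrite /GRing.scale /= mulr1.
  have D2 := is_derive_chain (g := expR) (is_derive_expR _) D0.
  have := is_deriveM D1 D2.
  set a := (X in is_derive _ _ _ X -> _).
  suff -> : a = 0 by [].
  rewrite /a /GRing.scale /=; field.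
  by rewrite gt_eqF// expR_gt0.
have := @is_derive_0_is_cst R F (ln e1) (ln e2) dF.
rewrite /F !expRN !expRM_natl !lnK ?posrE// => H.
have n1 := lt0r_neq0 (exprn_gt0 N e10); have n2 := lt0r_neq0 (exprn_gt0 N e20).
by apply/eqP; rewrite -(eqr_div _ _ n1 n2); apply/eqP; exact: H.
Qed.

Lemma weak_laplacian_cst (c : R) : weak_laplacian (fun _ : 'rV[R]_N => c) (fun=> 0).
Proof.
move=> phi tp; have [r r0 sp] := test_function_supp tp.
have Cp : Ck 2 phi by case: tp.
rewrite (Rintegral_green (@Ck_cst R N 2 c) Cp sp).
apply: eq_Rintegral => x _; congr (_ * _).
rewrite /laplacian big1// => i _; apply: partialE.
rewrite (_ : partial i _ = fun=> 0); first exact: is_derive_cst.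
by apply/funext => y; apply: partialE; exact: is_derive_cst.
Qed.

(** The scaling law applied to the harmonic function [1]; it stands in for the change of variables
    [z -> e z]. *)
Lemma mass_scale e1 e2 : 0 < e1 -> 0 < e2 ->
  mass (N := N) e1 * e2 ^+ N = mass (N := N) e2 * e1 ^+ N.
Proof.
have E e : mass (N := N) e = conv (fun=> 1) (kern e) (0 : 'rV[R]_N).
  by apply: eq_Rintegral => y _; rewrite mul1r subr0.
move=> e10 e20; rewrite !E.
exact: (conv_kern_scale 0 (Lloc_cst 1) (weak_laplacian_cst 1) e10 e20).
Qed.

Lemma mollifyE e u x : 0 < e -> Lloc u -> mollify e u x = conv u (kern e) x / mass (N := N) e.
Proof.
move=> e0 Lu; rewrite /mollify /conv /moll mulrC -RintegralZ_T.
  by apply: eq_Rintegral => y _; ring.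
exact: (conv_intg x Lu (Ck_continuous (smooth_kern e 0)) (supp_kern e0)).
Qed.

Let eq_ratio (a1 a2 m1 m2 p1 p2 : R) : m1 != 0 /\ m2 != 0 -> p1 != 0 -> p2 != 0 ->
  a1 * p2 = a2 * p1 -> m1 * p2 = m2 * p1 -> a1 / m1 = a2 / m2.
Proof.
move=> [m10 m20] p10 p20 H1 H2.
apply/eqP; rewrite eqr_div//; apply/eqP; apply: (mulIf p10); apply: (mulIf p20).
transitivity (a1 * p2 * (m2 * p1)); first ring.
by rewrite H1 -H2; ring.
Qed.

Lemma mollify_scale u x e1 e2 : Lloc u -> weak_laplacian u (fun=> 0) ->
  0 < e1 -> 0 < e2 -> mollify e1 u x = mollify e2 u x.
Proof.
move=> Lu uw e10 e20; rewrite (mollifyE x e10 Lu) (mollifyE x e20 Lu).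
apply: (eq_ratio _ _ _ (conv_kern_scale x Lu uw e10 e20) (mass_scale e10 e20)).
- by split; apply/lt0r_neq0; exact: mass_gt0.
- exact: lt0r_neq0 (exprn_gt0 N e10).
- exact: lt0r_neq0 (exprn_gt0 N e20).
Qed.

(** The mollification does not depend on the scale, yet converges to [u] in [L^1] on every cube as
    the scale tends to [0]. *)
Lemma mollify_weyl u e : Lloc u -> weak_laplacian u (fun=> 0) -> 0 < e ->
  {ae mu, forall x, u x = mollify e u x}.
Proof.
move=> Lu uw e0; have Lm := Lloc_mollify e0 Lu.
have /(ae_eq0_L1 (LlocB Lm Lu)) : forall r, L1 r (fun x => mollify e u x - u x) = 0.
  move=> r; apply/eqP; rewrite eq_le L1_ge0 andbT.
  apply/ler_addgt0Pr => eta eta0; rewrite add0r.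
  have [d d0 Hd] := L1_mollify r Lu eta0.
  have d2 : 0 < d / 2 by rewrite divr_gt0.
  have := Hd (d / 2); rewrite d2 gtr_pMr// invf_lt1 ?ltr1n// => /(_ isT).
  have -> : mollify (d / 2) u = mollify e u.
    by apply/funext => x; exact: (mollify_scale x Lu uw d2 e0).
  exact.
by apply: filterS => x /eqP; rewrite subr_eq0 => /eqP.
Qed.

Lemma harmonic_mollify u e : Lloc u -> weak_laplacian u (fun=> 0) -> 0 < e ->
  harmonic_fun (mollify e u).
Proof.
move=> Lu uw e0; split; first exact: Ck_mollify.
move=> x; rewrite (laplacian_mollify x e0 Lu uw).
rewrite /mollify /conv (_ : (fun _ => _) = fun=> 0).
  by rewrite Rintegral_cst// mul0r.
by apply/funext => y; rewrite mul0r.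
Qed.

Lemma eq_ae_RintegralM u v phi : measurable_fun setT u -> measurable_fun setT v ->
  measurable_fun setT phi -> {ae mu, forall x, u x = v x} ->
  \int[mu]_x (u x * phi x) = \int[mu]_x (v x * phi x).
Proof.
move=> mu_ mv mp uv; congr fine; apply: ae_eq_integral => //.
- by apply/measurable_EFinP; exact: measurable_funM.
- by apply/measurable_EFinP; exact: measurable_funM.
- by apply: filterS uv => x /= -> _.
Qed.

Lemma weak_laplacian_ae u v f : measurable_fun setT u -> measurable_fun setT v ->
  {ae mu, forall x, u x = v x} -> weak_laplacian u f -> weak_laplacian v f.
Proof.
move=> mu_ mv uv uf phi tp; rewrite -(uf _ tp); apply/esym/eq_ae_RintegralM => //.
by apply: continuous_measurable_rV; apply: (@Ck_laplacian _ _ 0); case: tp.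
Qed.

Lemma nsqD x y : nsq (x + y) <= 2 * nsq x + 2 * nsq y.
Proof.
rewrite /nsq !mulr_sumr -big_split; apply: ler_sum => j _ /=; rewrite mxE.
have := sqr_ge0 (x 0 j - y 0 j); rewrite sqrrB sqrrD; lra.
Qed.

(** If [|z - x| < e] and [|x - y| <= e] (Euclidean norms), then [|z - y|^2 <= 4 e^2 <= (3 e)^2 / 2],
    so [kern_ge] bounds the wide kernel below by [exp(-2)]. In [K], [C] bounds the narrow kernel and
    [3^N] is the ratio of the masses. *)
Lemma moll_harnack : exists2 K : R, 0 < K & forall e x y z, 0 < e ->
  nsq (x - y) <= e ^+ 2 -> moll e (z - x) <= K * moll (3 * e) (z - y).
Proof.
have [C C0 HC] := @kern_le R N.
exists (C * expR 2 * 3 ^+ N) => [|e x y z e0 xy].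
  by rewrite !mulr_gt0 ?expR_gt0// exprn_gt0.
have e30 : 0 < 3 * e by rewrite mulr_gt0.
have m1 := mass_gt0 (N := N) e0; have m3 := mass_gt0 (N := N) e30.
have E : mass (N := N) (3 * e) = 3 ^+ N * mass (N := N) e.
  have eN : e ^+ N != 0 by rewrite expf_neq0// gt_eqF.
  by apply: (mulIf eN); rewrite (mass_scale e30 e0) exprMn; ring.
rewrite /moll E.
have -> : C * expR 2 * 3 ^+ N * (kern (3 * e) (z - y) / (3 ^+ N * mass (N := N) e)) =
   C * expR 2 * kern (3 * e) (z - y) / mass (N := N) e.
  by field; rewrite gt_eqF// expf_neq0// ; rewrite pnatr_eq0.
apply: ler_wpM2r; first by rewrite invr_ge0 ltW.
have [H|H] := leP (e ^+ 2) (nsq (z - x)).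
  by rewrite kern_out_nsq// !mulr_ge0 ?kern_ge0 ?expR_ge0 ?(ltW C0).
apply: le_trans (HC e (z - x)) _; rewrite -mulrA ler_peMr ?(ltW C0)//.
have kg : expR (- 2) <= kern (3 * e) (z - y).
  apply: kern_ge => //; rewrite -(subrK x z) -addrA.
  apply: le_trans (nsqD _ _) _; rewrite exprMn.
  have := sqr_ge0 e; move: H xy; lra.
by rewrite -(ler_pM2l (expR_gt0 2)) -?expRD ?subrr ?expR0 in kg.
Qed.

Let le_of_eqs (a b i1 i2 i3 K : R) : a = i1 -> b = i2 -> i3 = K * i2 -> i1 <= i3 ->
  a <= K * b.
Proof. by move=> -> -> ->. Qed.

(** The Harnack constant does not depend on the distance between the points, because the scale may
    be taken larger than that distance. *)
Lemma liouville_lower u (M : R) : Lloc u -> weak_laplacian u (fun=> 0) ->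
  (forall x, M <= u x) -> exists c, {ae mu, forall x, u x = c}.
Proof.
move=> Lu uw uM; pose h := mollify 1 u.
have uh := mollify_weyl Lu uw ltr01; rewrite -/h in uh.
have Lh : Lloc h := Lloc_mollify ltr01 Lu.
have [mu_ _] := Lu; have [mh _] := Lh.
have hw := weak_laplacian_ae mu_ mh uh uw.
have hM x : M <= h x.
  by rewrite -subr_ge0 mollify_sub//; apply: Rintegral_ge0 => y _;
    rewrite mulr_ge0 ?moll_ge0// subr_ge0.
(* A mean value property at every point and every scale: [h = u] almost everywhere, and the
   mollifications of [u] agree at all scales. *)
have hh e x : 0 < e -> mollify e h x = h x.
  move=> e0; rewrite {2}/h (mollify_scale x Lu uw ltr01 e0).
  apply/esym/eq_ae_RintegralM => //.
  by apply: continuous_measurable_rV; apply: continuous_subl; exact: continuous_moll.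
pose i := inf (range h).
have hl : has_lbound (range h) by exists M => _ [y _ <-].
have h0 : range h !=set0 by exists (h 0), 0.
have ih x : i <= h x by apply: ge_inf => //; exists x.
have [K K0 HK] := moll_harnack.
have harnack x y : h x - i <= K * (h y - i).
  have [e e0 xy] : exists2 e : R, 0 < e & nsq (x - y) <= e ^+ 2.
    exists (Num.sqrt (nsq (x - y) + 1)).
      by rewrite sqrtr_gt0 ltr_wpDl// nsq_ge0.
    by rewrite sqr_sqrtr ?lerDl// addr_ge0// nsq_ge0.
  have e3 : 0 < 3 * e by rewrite mulr_gt0.
  have Lhi : Lloc (fun z => h z - i) := LlocB Lh (Lloc_cst i).
  have I1 := moll_intg x e0 Lhi.
  have I2 := moll_intg y e3 Lhi.
  have E1 : h x - i = \int[mu]_z ((h z - i) * moll e (z - x)).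
    by rewrite -(mollify_sub x i e0 Lh) (hh e x e0).
  have E2 : h y - i = \int[mu]_z ((h z - i) * moll (3 * e) (z - y)).
    by rewrite -(mollify_sub y i e3 Lh) (hh (3 * e) y e3).
  apply: (le_of_eqs E1 E2 (RintegralZ_T K I2)).
  apply: (le_Rintegral measurableT I1 (intgZ K I2)) => z _.
  have hz0 : 0 <= h z - i by rewrite subr_ge0 ih.
  have := ler_wpM2l hz0 (HK e x y z e0 xy).
  by rewrite [X in _ <= X -> _]mulrCA.
(* Harnack's inequality is used against points [y] where [h] is within [eps / K] of its infimum. *)
have hi x : h x = i.
  apply/eqP; rewrite eq_le ih andbT; apply/ler_addgt0Pr => eps eps0.
  have [|_ [y _ <-] hy] := @inf_adherent _ (range h) (eps / K) _ (conj h0 hl).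
    by rewrite divr_gt0.
  rewrite -lerBlDl; apply: le_trans (harnack x y) _.
  by rewrite mulrC -ler_pdivlMr// lerBlDl ltW.
by exists i; apply: filterS uh => x ->.
Qed.

(** Truncating [u] from below by [M] changes it on a null set only and makes the bound hold
    everywhere. *)
Lemma liouville_ae_lower u : Lloc u -> weak_laplacian u (fun=> 0) ->
  (exists M, {ae mu, forall x, M <= u x}) -> exists c, {ae mu, forall x, u x = c}.
Proof.
move=> Lu uw [M uM]; have [mu_ _] := Lu.
pose v x := Num.max (u x) M.
have mv : measurable_fun setT v by exact: measurable_maxr.
have Lv : Lloc v.
  apply: (@Lloc_le _ _ _ (fun x => `|u x| + `|M|)) => //.
    move=> x; rewrite /v /Num.max; case: ifP => _; first by rewrite lerDr.
    by rewrite lerDl.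
  exact: (LlocD (Lloc_norm Lu) (Lloc_cst `|M|)).
have uv : {ae mu, forall x, u x = v x} by apply: filterS uM => x ux; rewrite /v max_l.
have [|c vc] := liouville_lower Lv (weak_laplacian_ae mu_ mv uv uw) (M := M).
  by move=> x; rewrite /v le_max lexx orbT.
by exists c; apply: filterS2 uv vc => x -> ->.
Qed.

Lemma liouville u : Lloc u -> weak_laplacian u (fun=> 0) -> bounded_one_side u ->
  exists c, {ae mu, forall x, u x = c}.
Proof.
move=> Lu uw [[M uM]|]; last exact: liouville_ae_lower.
have nw : weak_laplacian (fun x => - u x) (fun=> 0).
  move=> phi tp; have [r r0 sp] := test_function_supp tp.
  have := uw _ tp.
  under [in X in _ -> X]eq_Rintegral do rewrite mulNr.
  rewrite RintegralN_T.
    move=> ->; rewrite (_ : (fun _ => _) = fun=> 0).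
      by rewrite Rintegral_cst// mul0r oppr0.
    by apply/funext => y; rewrite mul0r.
  apply: (Lloc_intgM_cont Lu _ (laplacian_supp sp)).
  by apply: (@Ck_laplacian _ _ 0); case: tp.
have [|c H] := liouville_ae_lower (LlocN Lu) nw.
  by exists (- M); apply: filterS uM => x; rewrite lerN2.
by exists (- c); apply: filterS H => x <-; rewrite opprK.
Qed.

End weyl.

(** * The coupled system *)

Section powers.
Context {R : realType}.
Implicit Types a b c q s t x y : R.

Lemma powR_addM x s a : 0 < s + a -> x `^ (s + a) = x `^ s * x `^ a.
Proof. by move=> sa; rewrite powRD// (gt_eqF sa). Qed.

Lemma powR_mixed_le s a x y : 0 <= s -> 0 < a -> 0 <= x -> 0 <= y ->
  x `^ s * y `^ a + y `^ s * x `^ a <= x `^ (s + a) + y `^ (s + a).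
Proof.
move=> s0 a0 x0 y0; have sa : 0 < s + a by rewrite ltr_wpDl.
rewrite !powR_addM// -subr_ge0.
have -> : x `^ s * x `^ a + y `^ s * y `^ a - (x `^ s * y `^ a + y `^ s * x `^ a) =
  (x `^ s - y `^ s) * (x `^ a - y `^ a) by ring.
have [xy|/ltW yx] := leP x y.
  rewrite -mulrNN !opprB mulr_ge0// subr_ge0; apply: ge0_ler_powR => //; exact: ltW.
by rewrite mulr_ge0// subr_ge0; apply: ge0_ler_powR => //; exact: ltW.
Qed.

Lemma powRD_le q x y : 0 <= q -> 0 <= x -> 0 <= y ->
  (x + y) `^ q <= 2 `^ q * (x `^ q + y `^ q).
Proof.
move=> q0; wlog xy : x y / x <= y.
  move=> H x0 y0; have [xy|/ltW yx] := leP x y; first exact: H.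
  by rewrite addrC [X in _ * X]addrC; exact: H.
move=> x0 y0; apply: (@le_trans _ _ ((2 * y) `^ q)).
  apply: ge0_ler_powR => //; rewrite ?nnegrE ?addr_ge0 ?mulr_ge0//.
  by rewrite mulr_natl mulr2n lerD2r.
by rewrite powRM//; apply: ler_wpM2l; rewrite ?powR_ge0// lerDr powR_ge0.
Qed.

Lemma powRD_scaled_le c q x y : 0 <= c -> 0 <= q -> 0 <= x -> 0 <= y ->
  c * 2 `^ (- q) * (x + y) `^ q <= c * (x `^ q + y `^ q).
Proof.
move=> c0 q0 x0 y0; rewrite -mulrA; apply: ler_wpM2l => //.
apply: (@le_trans _ _ (2 `^ (- q) * (2 `^ q * (x `^ q + y `^ q)))).
  by apply: ler_wpM2l; [exact: powR_ge0|exact: powRD_le].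
by rewrite mulrA -powRD ?pnatr_eq0 ?implybT// addNr powRr0 mul1r.
Qed.

Lemma powR_half_le q x : 0 <= q -> 0 <= x -> 2 `^ (- q) * x `^ q = (x / 2) `^ q.
Proof.
move=> q0 x0; rewrite powRM ?invr_ge0// mulrC; congr (_ * _).
by rewrite -[2^-1]powR_inv1// -powRrM mulN1r.
Qed.

Lemma norm_signed_pow q t : 0 < q -> `|signed_pow q t| = `|t| `^ q.
Proof.
move=> q0; rewrite /signed_pow normrM ger0_norm ?powR_ge0// mulrC.
by rewrite mulr_powRB1.
Qed.

Lemma sg_signed_pow q t : 0 < q -> Num.sg t * signed_pow q t = `|t| `^ q.
Proof.
by move=> q0; rewrite /signed_pow mulrCA -normrEsg mulrC mulr_powRB1.
Qed.

Lemma signed_powN q t : signed_pow q (- t) = - signed_pow q t.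
Proof. by rewrite /signed_pow normrN mulrN. Qed.

Lemma signed_pow_add s a t : 0 < s + a -> signed_pow (s + a) t = `|t| `^ s * signed_pow a t.
Proof.
move=> sa; rewrite /signed_pow; have [->|t0] := eqVneq t 0; first by rewrite !mulr0.
rewrite -addrA (@powRD _ _ s (a - 1)); first by rewrite mulrA.
by rewrite normr_eq0 t0 implybT.
Qed.

Let signed_powB_pos a x y : 1 <= a -> 0 <= y -> y < x ->
  (x - y) `^ a <= signed_pow a x - signed_pow a y.
Proof.
move=> a1 y0 yx; have x0 := le_lt_trans y0 yx.
have a0 : 0 < a by rewrite (lt_le_trans ltr01).
have a10 : 0 <= a - 1 by rewrite subr_ge0.
have d0 : 0 < x - y by rewrite subr_gt0.
rewrite /signed_pow (gtr0_norm x0) (ger0_norm y0).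
rewrite -(@mulr_powRB1 _ (x - y) a) ?(ltW d0)//.
apply: (@le_trans _ _ ((x - y) * x `^ (a - 1))).
  apply: ler_wpM2l; first exact: ltW.
  by apply: ge0_ler_powR; rewrite // ?nnegrE ?(ltW d0) ?(ltW x0)// gerBl.
rewrite mulrBl [x * _]mulrC [y * _]mulrC lerD2l lerN2.
by apply: ler_wpM2r => //; apply: ge0_ler_powR; rewrite // ?nnegrE ltW.
Qed.

(** The factor [1/2] is only used up when [y < 0 < x], where the right-hand side is [x^a + |y|^a];
    with equal signs, oddness reduces to [signed_powB_pos]. *)
Let signed_powB a x y : 1 <= a -> y < x ->
  ((x - y) / 2) `^ a <= signed_pow a x - signed_pow a y.
Proof.
move=> a1 yx; have a0 : 0 < a by rewrite (lt_le_trans ltr01).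
have d0 : 0 < x - y by rewrite subr_gt0.
have half z : 0 <= z -> (z / 2) `^ a <= z `^ a.
  move=> z0; apply: ge0_ler_powR; rewrite ?(ltW a0) ?nnegrE ?divr_ge0//.
  by rewrite ler_pdivrMr// ler_peMr// ler1n.
have [y0|y0] := leP 0 y.
  exact: le_trans (half _ (ltW d0)) (signed_powB_pos a1 y0 yx).
have [x0|x0] := leP x 0.
  have := @signed_powB_pos a (- y) (- x) a1; rewrite oppr_ge0 ltrN2 => /(_ x0 yx).
  rewrite !signed_powN !opprK [- y + x]addrC [- signed_pow _ _ + _]addrC.
  by move=> H; exact: le_trans (half _ (ltW d0)) H.
have Sx : signed_pow a x = x `^ a.
  by rewrite -(gtr0_norm x0) -sg_signed_pow ?(gtr0_norm x0)// gtr0_sg// mul1r.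
have Sy : - signed_pow a y = (- y) `^ a.
  by rewrite -(ltr0_norm y0) -sg_signed_pow// ltr0_sg// mulN1r.
rewrite Sx Sy; have ny : 0 < - y by rewrite oppr_gt0.
have := powRD_le (ltW a0) (ltW x0) (ltW ny).
rewrite -(@powR_half_le a (x - y)) ?(ltW a0) ?(ltW d0)// => H.
rewrite -(ler_pM2l (powR_gt0 a (ltr0n R 2))) mulrA -powRD ?subrr ?powRr0 ?mul1r//.
by rewrite pnatr_eq0 implybT.
Qed.

(** For [y < x], one of [|x|], [|y|] is at least [(x - y) / 2], which bounds the sum of [s]-th
    powers; [signed_powB] bounds the other factor, and the exponents add up. *)
Lemma coupling_coercive s a x y : 0 <= s -> 1 <= a ->
  2 `^ (- (s + a)) * `|x - y| `^ (s + a) <=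
  Num.sg (x - y) * ((`|x| `^ s + `|y| `^ s) * (signed_pow a x - signed_pow a y)).
Proof.
move=> s0 a1; have a0 : 0 < a by rewrite (lt_le_trans ltr01).
have sa : 0 < s + a by rewrite ltr_wpDl.
wlog yx : x y / y < x.
  move=> H; have [yx|xy|->] := ltgtP y x; first exact: H.
    have := H _ _ xy; rewrite distrC [`|y| `^ s + _]addrC.
    by rewrite -[x - y]opprB sgrN -[signed_pow a x - _]opprB mulrN mulNr mulrN opprK.
  by rewrite subrr normr0 powR0 ?gt_eqF// mulr0 sgr0 mul0r.
have d0 : 0 < x - y by rewrite subr_gt0.
rewrite gtr0_sg// mul1r gtr0_norm// powR_half_le ?(ltW sa) ?(ltW d0)//.
rewrite powR_addM//; apply: ler_pM; rewrite ?powR_ge0//; last exact: signed_powB.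
have d2 : 0 <= (x - y) / 2 by rewrite divr_ge0// ltW.
have : (x - y) / 2 <= `|x| \/ (x - y) / 2 <= `|y|.
  have [H|H] := leP ((x - y) / 2) `|x|; [by left|right].
  have := ler_norm x; have := ler_norm (- y); rewrite normrN; lra.
case=> H; [apply: (@le_trans _ _ (`|x| `^ s))|apply: (@le_trans _ _ (`|y| `^ s))].
- by apply: ge0_ler_powR.
- by rewrite lerDl powR_ge0.
- by apply: ge0_ler_powR.
- by rewrite lerDr powR_ge0.
Qed.

End powers.

(** * Vanishing for pairs of equations, and integrability of the nonlinear terms *)

Section coupled.
Context {R : realType} {N : nat}.
Local Notation mu := (lebesgue_rV R N).
Implicit Types (u v f g h w phi : 'rV[R]_N -> R) (q r c : R) (x y z : 'rV[R]_N).

(* Summing Kato's inequalities for [u] and [v] puts [w = |u| + |v|] in the scope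
   of [keller_osserman]. *)
Lemma liouville_coupled u v f g c q : Lloc u -> Lloc v -> Lloc f -> Lloc g ->
  weak_laplacian u f -> weak_laplacian v g -> 1 < q -> 0 < c ->
  Lloc (fun x => (`|u x| + `|v x|) `^ q) ->
  (forall x, c * (`|u x| + `|v x|) `^ q <= Num.sg (u x) * f x + Num.sg (v x) * g x) ->
  {ae mu, forall x, u x = 0} /\ {ae mu, forall x, v x = 0}.
Proof.
move=> Lu Lv Lf Lg uf vg q1 c0 Lw H.
have Luv := LlocD (Lloc_norm Lu) (Lloc_norm Lv).
have sgL u' f' : Lloc u' -> Lloc f' -> Lloc (fun x => Num.sg (u' x) * f' x).
  move=> [mu' _] Lf'; have [mf' _] := Lf'; apply: (Lloc_le _ _ (Lloc_norm Lf')).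
    by apply: measurable_funM => //; exact: measurable_sg.
  move=> x; rewrite normrM normr_sg; case: (u' x == 0); rewrite ?mul0r ?mul1r//=.
have LS := LlocD (sgL _ _ Lu Lf) (sgL _ _ Lv Lg).
have : {ae mu, forall x, `|u x| + `|v x| = 0}.
  apply: (keller_osserman Luv Lw _ c0 q1).
    by move=> x; rewrite addr_ge0.
  move=> phi tp p0; have [r r0 sp] := test_function_supp tp.
  have Cp : Ck 2 phi by case: tp.
  have cp := Ck_continuous Cp.
  have cL : continuous (laplacian phi) := @Ck_laplacian _ _ 0 _ Cp.
  have sL := laplacian_supp sp.
  have I1 := Lloc_intgM_cont Lw cp sp.
  have I2 := Lloc_intgM_cont LS cp sp.
  have I3 := Lloc_intgM_cont (sgL _ _ Lu Lf) cp sp.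
  have I4 := Lloc_intgM_cont (sgL _ _ Lv Lg) cp sp.
  have I5 := Lloc_intgM_cont (Lloc_norm Lu) cL sL.
  have I6 := Lloc_intgM_cont (Lloc_norm Lv) cL sL.
  apply: (@le_trans _ _ (\int[mu]_x ((Num.sg (u x) * f x + Num.sg (v x) * g x) * phi x))).
    rewrite -(RintegralZ_T c I1); apply: (le_Rintegral measurableT (intgZ c I1) I2).
    by move=> x _; rewrite mulrA; apply: ler_wpM2r; [exact: p0|exact: H].
  under eq_Rintegral do rewrite mulrDl.
  rewrite (RintegralD measurableT I3 I4).
  under [leRHS]eq_Rintegral do rewrite mulrDl.
  rewrite (RintegralD measurableT I5 I6).
  exact: (lerD (kato Lu Lf uf tp p0) (kato Lv Lg vg tp p0)).
move=> Z; split; apply: filterS Z => x /eqP; rewrite paddr_eq0// => /andP[/eqP + /eqP].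
- by move=> /normr0_eq0.
- by move=> _ /normr0_eq0.
Qed.

(** Lower powers are dominated by [1 + |u|^p], the [1] covering the points where [|u| <= 1]. *)
Lemma Lp_loc_powR u (p q : R) : 0 <= q <= p -> Lp_loc p u -> Lloc (fun x => `|u x| `^ q).
Proof.
move=> /andP[q0 qp] [mu_ Iu].
have mpow t : measurable_fun setT (fun x => `|u x| `^ t).
  apply: (measurableT_comp (measurable_powR t)).
  exact: (measurableT_comp (@normr_measurable _ setT) mu_).
have Lp : Lloc (fun x => `|u x| `^ p).
  by split=> // r; apply: Iu; exact: compact_cb.
apply: (@Lloc_le _ _ _ (fun x => 1 + `|u x| `^ p)) => //; last first.
  exact: (LlocD (Lloc_cst 1) Lp).
move=> x; rewrite ger0_norm ?powR_ge0//.
have [u1|u1] := leP `|u x| 1.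
  apply: (@le_trans _ _ 1); last by rewrite lerDl powR_ge0.
  have := @ge0_ler_powR R q q0 `|u x| 1; rewrite powR1 !nnegrE.
  by apply.
by apply: (le_trans (ler_powR (ltW u1) qp)); rewrite lerDr.
Qed.

Lemma Lp_loc_Lloc u (p : R) : 1 <= p -> Lp_loc p u -> Lloc u.
Proof.
move=> p1 Lu; have [mu_ _] := Lu.
apply: (@Lloc_le _ _ _ (fun x => `|u x| `^ 1)) => //.
  by move=> x; rewrite powRr1 ?normr_ge0.
by apply: Lp_loc_powR Lu; rewrite ler01.
Qed.

Lemma measurable_signed_pow u q : measurable_fun setT u ->
  measurable_fun setT (fun x => signed_pow q (u x)).
Proof.
move=> mu_; apply: measurable_funM => //.
apply: (measurableT_comp (measurable_powR (q - 1))).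
exact: (measurableT_comp (@normr_measurable _ setT) mu_).
Qed.

Lemma Lloc_signed_pow u (p q : R) : 0 < q <= p -> Lp_loc p u ->
  Lloc (fun x => signed_pow q (u x)).
Proof.
move=> /andP[q0 qp] Lu; have [mu_ _] := Lu.
apply: (@Lloc_le _ _ _ (fun x => `|u x| `^ q)).
- exact: measurable_signed_pow.
- by move=> x; rewrite norm_signed_pow.
- by apply: Lp_loc_powR Lu; rewrite qp ltW.
Qed.

Lemma Lloc_coupling u v (p s a : R) : 0 <= s -> 0 < a -> s + a <= p ->
  Lp_loc p u -> Lp_loc p v -> Lloc (fun x => `|u x| `^ s * signed_pow a (v x)).
Proof.
move=> s0 a0 sap Lu Lv; have [mu_ _] := Lu; have [mv _] := Lv.
have sa : 0 <= s + a by rewrite addr_ge0// ltW.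
have h : 0 <= s + a <= p by rewrite sa.
apply: (@Lloc_le _ _ _ (fun x => `|u x| `^ (s + a) + `|v x| `^ (s + a))).
- apply: measurable_funM; last exact: measurable_signed_pow.
  apply: (measurableT_comp (measurable_powR s)).
  exact: (measurableT_comp (@normr_measurable _ setT) mu_).
- move=> x; rewrite normrM norm_signed_pow// ger0_norm ?powR_ge0//.
  apply: le_trans (powR_mixed_le s0 a0 (normr_ge0 (u x)) (normr_ge0 (v x))).
  by rewrite lerDl mulr_ge0 ?powR_ge0.
- exact: (LlocD (Lp_loc_powR h Lu) (Lp_loc_powR h Lv)).
Qed.

Lemma weak_laplacian_of_distributional u g h : Lloc u -> Lloc g -> Lloc h ->
  distributional_eq u g h -> weak_laplacian u (fun x => g x - h x).
Proof.
move=> Lu Lg Lh H phi tp; have := H _ tp.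
have [r r0 sp] := test_function_supp tp.
have Cp : Ck 2 phi by case: tp.
have cp := Ck_continuous Cp.
have cL : continuous (laplacian phi) := @Ck_laplacian _ _ 0 _ Cp.
have I0 := Lloc_intgM_cont Lu cL (laplacian_supp sp).
have I1 := Lloc_intgM_cont Lg cp sp.
have I2 := Lloc_intgM_cont Lh cp sp.
under [in X in X + _]eq_Rintegral do rewrite mulrN.
rewrite (RintegralN_T I0) => E.
under [RHS]eq_Rintegral do rewrite mulrBl.
by rewrite (RintegralB measurableT I1 I2) -E opprD opprK addrC subrK.
Qed.

Lemma ereal_inf_gt0 (F : 'rV[R]_N -> R) :
  (0 < ereal_inf (range (fun x => (F x)%:E)))%E -> exists2 c, 0 < c & forall x, c <= F x.
Proof.
move=> H; have lb x : (ereal_inf (range (fun x => (F x)%:E)) <= (F x)%:E)%E.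
  by apply: ereal_inf_lbound; exists x.
(* An infimum equal to [+oo] is excluded by the finite value of [F] at [0]. *)
move: H lb; case: ereal_inf => [c| |] //= H lb; first by exists c.
by have := lb 0.
Qed.

Lemma weak_laplacianB u v f g : Lloc u -> Lloc v -> Lloc f -> Lloc g ->
  weak_laplacian u f -> weak_laplacian v g ->
  weak_laplacian (fun x => u x - v x) (fun x => f x - g x).
Proof.
move=> Lu Lv Lf Lg uf vg phi tp.
have [r r0 sp] := test_function_supp tp.
have Cp : Ck 2 phi by case: tp.
have cp := Ck_continuous Cp.
have cL : continuous (laplacian phi) := @Ck_laplacian _ _ 0 _ Cp.
have I1 := Lloc_intgM_cont Lu cL (laplacian_supp sp).
have I2 := Lloc_intgM_cont Lv cL (laplacian_supp sp).
have I3 := Lloc_intgM_cont Lf cp sp.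
have I4 := Lloc_intgM_cont Lg cp sp.
under eq_Rintegral do rewrite mulrBl.
under [RHS]eq_Rintegral do rewrite mulrBl.
by rewrite (RintegralB measurableT I1 I2) (RintegralB measurableT I3 I4) (uf _ tp) (vg _ tp).
Qed.

End coupled.

(** Multiplied by the sign of its own unknown, each equation turns its own powers into absolute
    powers exactly. The coupling terms are at most [|x|^s |y|^a + |y|^s |x|^a], which
    [powR_mixed_le] trades for pure powers of order [s + a]; [B >= 0] preserves the direction. *)
Lemma system_absorption {R : realType} (A L B m s a x y : R) :
  0 < m -> 0 <= s -> 0 < a -> 0 <= B ->
  A * (`|x| `^ m + `|y| `^ m) + (L - B) * (`|x| `^ (s + a) + `|y| `^ (s + a)) <=
  Num.sg x * (A * signed_pow m x -
    (- L * signed_pow (s + a) x + B * `|x| `^ s * signed_pow a y)) +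
  Num.sg y * (A * signed_pow m y -
    (- L * signed_pow (s + a) y + B * `|y| `^ s * signed_pow a x)).
Proof.
move=> m0 s0 a0 B0; have sa : 0 < s + a by rewrite ltr_wpDl.
have split_sg z w : Num.sg z * (A * signed_pow m z -
    (- L * signed_pow (s + a) z + B * `|z| `^ s * signed_pow a w)) =
    A * `|z| `^ m + L * `|z| `^ (s + a) -
    B * (`|z| `^ s * (Num.sg z * signed_pow a w)).
  rewrite -(sg_signed_pow z m0) -(sg_signed_pow z sa); ring.
have mixed z w : `|z| `^ s * (Num.sg z * signed_pow a w) <= `|z| `^ s * `|w| `^ a.
  apply: ler_wpM2l; first exact: powR_ge0.
  apply: (le_trans (ler_norm _)); rewrite normrM norm_signed_pow// normr_sg.
  by case: (z == 0); rewrite ?mul1r// mul0r powR_ge0.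
rewrite !split_sg.
have := ler_wpM2l B0 (lerD (mixed x y) (mixed y x)).
have := ler_wpM2l B0 (powR_mixed_le s0 a0 (normr_ge0 x) (normr_ge0 y)).
move: (`|x| `^ s * (Num.sg x * _)) (`|y| `^ s * (Num.sg y * _)) => p q.
move: (`|x| `^ s * _) (`|y| `^ s * _) (`|x| `^ (s + a)) (`|y| `^ (s + a)).
move: (`|x| `^ m) (`|y| `^ m) => t1 t2 t3 t4 t5 t6.
rewrite !mulrDr !mulrBl; lra.
Qed.

Unset Implicit Arguments.

Theorem theorem2p2 (R : realType) (N : nat) (hN : (1 <= N)%N)
  (alpha beta lambda : 'rV[R]_N -> R)
  (calpha : continuous alpha) (cbeta : continuous beta)
  (clambda : continuous lambda)
  (m theta s gamma lambda0 : R)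
  (hm : 0 < m) (htheta : 1 < theta) (hs : 0 <= s) (hgamma : 1 <= gamma)
  (halpha : forall x, 0 <= alpha x) (hbeta : forall x, 0 <= beta x)
  (hlambda0 : 0 < lambda0) (hlambda : forall x, lambda0 <= lambda x)
  (u v : 'rV[R]_N -> R)
  (huv : distributional_solution m theta s gamma alpha beta lambda u v)
  (hcrit : theta = 2 * s + gamma) :
  [/\ (* (i) *)
      (0 < ereal_inf (range (fun x => (lambda x - beta x)%:E)))%E ->
        ae_eq_fun u (cst 0) /\ ae_eq_fun v (cst 0),
      (* (ii) *)
      (forall x, beta x <= lambda x) ->
        (exists2 alpha0, 0 < alpha0 & forall x, alpha0 <= alpha x) ->
        1 < m ->
        ae_eq_fun u (cst 0) /\ ae_eq_fun v (cst 0),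
      (* (iii) *)
      m = theta ->
        (0 < ereal_inf (range (fun x => (alpha x + lambda x - beta x)%:E)))%E ->
        ae_eq_fun u (cst 0) /\ ae_eq_fun v (cst 0) &
      (* (iv) *)
      (forall x, lambda x = beta x) -> (forall x, alpha x = 0) ->
        (ae_eq_fun u v /\ exists2 h, harmonic_fun h & ae_eq_fun u h) /\
        (bounded_one_side u \/ bounded_one_side v ->
          exists c : R, ae_eq_fun u (cst c) /\ ae_eq_fun v (cst c))].
Proof.
case: huv => Lpu Lpv eu ev; set p := Num.max m _ in Lpu Lpv.
pose a := s + gamma.
have a1 : 1 <= a by rewrite /a -[1]add0r lerD.
have a0 : 0 < a := lt_le_trans ltr01 a1.
have theta_sa : theta = s + a by rewrite hcrit /a addrA mulr_natl mulr2n.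
have theta0 : 0 < theta := lt_trans ltr01 htheta.
have mp : m <= p by rewrite /p le_max lexx.
have thetap : theta <= p by rewrite /p !le_max lexx orbT.
have p1 : 1 <= p by apply: le_trans thetap; exact: ltW.
have sap : s + a <= p by rewrite -theta_sa.
have Lu := Lp_loc_Lloc p1 Lpu; have Lv := Lp_loc_Lloc p1 Lpv.
pose g w x := alpha x * signed_pow m (w x).
pose h w z x := - lambda x * signed_pow theta (w x) +
  beta x * `|w x| `^ s * signed_pow a (z x).
have Lg w : Lp_loc p w -> Lloc (g w).
  move=> Lw; apply: (LlocM calpha); apply: (@Lloc_signed_pow _ _ _ p) => //.
  by rewrite hm.
have Lh w z : Lp_loc p w -> Lp_loc p z -> Lloc (h w z).
  move=> Lw Lz; have t0p : 0 < theta <= p by rewrite theta0.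
  have := LlocD (LlocN (LlocM clambda (Lloc_signed_pow t0p Lw)))
    (LlocM cbeta (Lloc_coupling hs a0 sap Lw Lz)).
  by congr Lloc; apply/funext => x; rewrite /h mulNr mulrA.
have Lgu := Lg _ Lpu; have Lgv := Lg _ Lpv.
have Lhu := Lh _ _ Lpu Lpv; have Lhv := Lh _ _ Lpv Lpu.
have Lfu := LlocB Lgu Lhu; have Lfv := LlocB Lgv Lhv.
have wu := weak_laplacian_of_distributional Lu Lgu Lhu eu.
have wv := weak_laplacian_of_distributional Lv Lgv Lhv ev.
have Lsum q : 0 <= q <= p -> Lloc (fun x => (`|u x| + `|v x|) `^ q).
  move=> qp; have [q0 _] := andP qp; have [mu_ _] := Lu; have [mv _] := Lv.
  apply: (@Lloc_le _ _ _ (fun x => 2 `^ q * (`|u x| `^ q + `|v x| `^ q))).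
  - apply: (measurableT_comp (measurable_powR q)).
    by apply: measurable_funD; apply: (measurableT_comp (@normr_measurable _ setT)).
  - by move=> x; rewrite ger0_norm ?powR_ge0// powRD_le.
  - exact: (LlocZ _ (LlocD (Lp_loc_powR qp Lpu) (Lp_loc_powR qp Lpv))).
have vanish c q : 0 < c -> 1 < q -> q <= p ->
    (forall x, c * (`|u x| `^ q + `|v x| `^ q) <=
       alpha x * (`|u x| `^ m + `|v x| `^ m) +
       (lambda x - beta x) * (`|u x| `^ theta + `|v x| `^ theta)) ->
    ae_eq_fun u (cst 0) /\ ae_eq_fun v (cst 0).
  move=> c0 q1 qp H; have q0 := ltW (lt_trans ltr01 q1).
  have c'0 : 0 < c * 2 `^ (- q) by rewrite mulr_gt0// powR_gt0.
  apply: (liouville_coupled Lu Lv Lfu Lfv wu wv q1 c'0).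
    by apply: Lsum; rewrite q0.
  move=> x; apply: le_trans (powRD_scaled_le (ltW c0) q0 (normr_ge0 _) (normr_ge0 _)) _.
  apply: le_trans (H x) _; rewrite /g /h theta_sa.
  exact: system_absorption.
have pow_ge0 q x : 0 <= `|u x| `^ q + `|v x| `^ q by rewrite addr_ge0 ?powR_ge0.
split.
- move=> /ereal_inf_gt0[c c0 Hc]; apply: (vanish c theta) => // x.
  rewrite -[leLHS]add0r; apply: lerD; first by rewrite mulr_ge0.
  exact: ler_wpM2r.
- move=> lb [alpha0 alpha00 Ha] m1; apply: (vanish alpha0 m) => // x.
  rewrite -[leLHS]addr0; apply: lerD; first exact: ler_wpM2r.
  by rewrite mulr_ge0// subr_ge0.
- move=> mtheta /ereal_inf_gt0[c c0 Hc]; apply: (vanish c theta) => // x.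
  by rewrite mtheta -mulrDl addrA; apply: ler_wpM2r.
move=> lb al0.
(* With [alpha = 0], [lambda = beta] and [theta = s + a], the right-hand side factors; it is
   antisymmetric in the two unknowns apart from the weight [|w|^s], so subtraction adds the
   weights. *)
have fE w z x : g w x - h w z x =
    lambda x * (`|w x| `^ s * (signed_pow a (w x) - signed_pow a (z x))).
  rewrite /g /h al0 -lb theta_sa signed_pow_add -?theta_sa//; ring.
have wuv := weak_laplacianB Lu Lv Lfu Lfv wu wv.
(* The vanishing result for pairs is applied to [u - v] together with the zero function. *)
have [uv _] : {ae lebesgue_rV R N, forall x, u x - v x = 0} /\
    {ae lebesgue_rV R N, forall x : 'rV[R]_N, (0 : R) = 0}.
  have c0 : 0 < lambda0 * 2 `^ (- theta) by rewrite mulr_gt0// powR_gt0.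
  apply: (liouville_coupled (LlocB Lu Lv) (Lloc_cst 0) (LlocB Lfu Lfv) (Lloc_cst 0)
    wuv (weak_laplacian_cst 0) htheta c0).
    have th : 0 <= theta <= p by rewrite (ltW theta0).
    have [mu_ _] := Lu; have [mv _] := Lv.
    apply: (Lloc_le _ _ (Lsum theta th)).
      apply: (measurableT_comp (measurable_powR theta)).
      apply: measurable_funD => //.
      by apply: (measurableT_comp (@normr_measurable _ setT)); exact: measurable_funB.
    move=> x; rewrite ger0_norm ?powR_ge0// normr0 addr0.
    by apply: ge0_ler_powR; rewrite ?nnegrE ?addr_ge0 ?(ltW theta0)// ler_normB.
  move=> x; rewrite normr0 addr0 mulr0 addr0 !fE.
  have -> : Num.sg (u x - v x) *
      (lambda x * (`|u x| `^ s * (signed_pow a (u x) - signed_pow a (v x))) -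
       lambda x * (`|v x| `^ s * (signed_pow a (v x) - signed_pow a (u x)))) =
      lambda x * (Num.sg (u x - v x) *
        ((`|u x| `^ s + `|v x| `^ s) * (signed_pow a (u x) - signed_pow a (v x)))).
    by ring.
  have C := coupling_coercive (u x) (v x) hs a1.
  rewrite -theta_sa in C; rewrite -mulrA.
  have P : 0 <= 2 `^ (- theta) * `|u x - v x| `^ theta by rewrite mulr_ge0 ?powR_ge0.
  exact: (ler_pM (ltW hlambda0) P (hlambda x) C).
have {}uv : ae_eq_fun u v by apply: filterS uv => x /eqP; rewrite subr_eq0 => /eqP.
(* Once [u = v] almost everywhere, the factored right-hand side vanishes almost everywhere. *)
have wu0 : weak_laplacian u (fun=> 0).
  move=> phi tp; rewrite (wu _ tp); apply: eq_ae_RintegralM.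
  - by have [] := Lfu.
  - exact: measurable_cst.
  - by apply: continuous_measurable_rV; apply: (Ck_continuous (tp.1 2%N)).
  - by apply: filterS uv => x E; rewrite fE E subrr !mulr0.
split.
  split=> //; exists (mollify 1 u); first exact: harmonic_mollify.
  exact: mollify_weyl.
move=> b; have {b} bu : bounded_one_side u.
  case: b => // -[] [M vM]; [left|right]; exists M;
    by apply: filterS2 uv vM => x ->.
have [c uc] := liouville Lu wu0 bu; exists c; split=> //.
by apply: filterS2 uv uc => x <- ->.
Qed.
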